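(* Let $V$ be a vertex operator algebra. Assume that $V$ is $C_1$-cofinite and that there exists a positive integer $N$ such that $|\Re(n_1)-\Re(n_2)|\le N$ for the lowest weights $n_1$ and $n_2$ of any two irreducible $V$-modules and such that the associative algebra $A_N(V)$ is finite dimensional. Then the category of grading-restricted generalized $V$-modules is a finite abelian category over $\mathbb C$.
   Context: $V=\coprod_{n\in\mathbb Z}V_{(n)}$ is a vertex operator algebra over $\mathbb C$ (with $\dim V_{(n)}<\infty$ and $V_{(n)}=0$ for $n$ sufficiently negative), $Y(u,x)=\sum_{n\in\mathbb Z}u_nx^{-n-1}$, $V_+=\coprod_{n>0}V_{(n)}$. A generalized $V$-module is a $\mathbb C$-graded space $W=\coprod_{n\in\mathbb C}W_{[n]}$ with a vertex operator map $Y_W:V\otimes W\to W((x))$ satisfying all axioms for $V$-modules except the two grading-restriction conditions (finite-dimensionality and lower truncation of the grading), and with the $L(0)$-grading property weakened to: $W_{[n]}$ is the generalized eigenspace of $L(0)$ with eigenvalue $n$. It is lower truncated if $W_{[n]}=0$ when $\Re(n)$ is sufficiently negative, grading restricted if in addition $\dim W_{[n]}<\infty$ for all $n$, and a (ordinary) $V$-module if it is grading restricted and $L(0)$ acts semisimply. Morphisms are module maps. Irreducible means nonzero with no proper nonzero generalized submodule. The lowest weight of a lower-truncated $W$, if it exists, is the $n_0\in\mathbb C$ with $W_{[n_0]}\neq0$ and $W_{[n]}=0$ whenever $\Re(n)<\Re(n_0)$, or $\Re(n)=\Re(n_0)$ and $n\ne n_0$; irreducible $V$-modules have lowest weights. $V$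 is $C_1$-cofinite (in the sense of Li) if $V/C_1(V)$ is finite dimensional, where $C_1(V)$ is spanned by $u_{-1}v$ for $u,v\in V_+$ and $L(-1)v$ for $v\in V$. For $n\in\mathbb N$, $A_n(V)=V/O_n(V)$ is the (Zhu, Dong–Li–Mason) associative algebra with product induced by $u*_nv=\sum_{m=0}^n(-1)^m\binom{m+n}{n}\mathrm{Res}_x\,x^{-n-m-1}Y((1+x)^{L(0)+n}u,x)v$, where $O_n(V)$ is spanned by $\mathrm{Res}_x\,x^{-2n-2}Y((1+x)^{L(0)+n}u,x)v$ for $u,v\in V$ and $(L(-1)+L(0))u$ for $u\in V$. An abelian category over $\mathbb C$ is finite if every object is of finite length, every space of morphisms is finite dimensional, there are only finitely many inequivalent simple objects, and every simple object has a projective cover. Here a projective cover of an object $W$ is a projective object $U$ with a surjective module map $p:U\to W$ such that for any projective object $W_1$ and any surjective module map $q:W_1\to W$ there is a surjective module map $\tilde q:W_1\to U$ with $p\circ\tilde q=q$. *)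

(* Defs.v *)
(* The field of complex numbers is R[i], for R : realType. *)
From HB Require Import structures.
From mathcomp Require Import all_boot all_order all_algebra.
From mathcomp Require Import generic_quotient ring_quotient.
From mathcomp Require Import complex.
From mathcomp Require Import boolp classical_sets functions cardinality fsbigop.
From mathcomp Require Import reals.

Set Implicit Arguments.
Unset Strict Implicit.
Unset Printing Implicit Defensive.

Import Order.TTheory GRing.Theory Num.Theory.
Local Open Scope classical_set_scope.
Local Open Scope ring_scope.

Section LinearAlgebra.
Variables (K : fieldType) (V : lmodType K).

Definition subspace (S : set V) : Prop :=
  S 0 /\ forall (a : K) (u v : V), S u -> S v -> S (a *: u + v).

Definition span (G : set V) : set V := smallest subspace G.

Definition fin_dim (S : set V) : Prop := exists s : seq V, S = span [set` s].

Definition direct_sum (I : choiceType) (S : I -> set V) : Prop :=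
  (forall i, subspace (S i)) /\
  forall v : V, exists! f : I -> V,
    [/\ forall i, S i (f i),
        finite_set [set i | f i != 0]
      & v = \sum_(i \in [set: I]) f i].

Lemma span_subspace (G : set V) : subspace (span G).
Proof.
split=> [S [[S0 _] _] //|a u v Gu Gv S SG].
by case: (SG) => -[_ SD] _; apply: SD; [apply: Gu|apply: Gv].
Qed.

Definition span_pred (G : set V) : {pred V} := fun v => v \in span G.

Lemma span_predP (G : set V) (v : V) : reflect (span G v) (v \in span_pred G).
Proof. by rewrite unfold_in; apply: (iffP idP); rewrite inE. Qed.

Lemma span_zmod_closed (G : set V) : zmod_closed (span_pred G).
Proof.
have [G0 GD] := span_subspace G.
split=> [|u v /span_predP Gu /span_predP Gv]; first exact/span_predP.
by apply/span_predP; rewrite addrC -scaleN1r; apply: GD.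
Qed.

HB.instance Definition _ (G : set V) :=
  GRing.isZmodClosed.Build V (span_pred G) (span_zmod_closed G).

Definition quot_span (G : set V) : Type := Quotient.quot (span_pred G).

Section Quotient.
Variable G : set V.
Local Notation Q := (quot_span G).
Local Open Scope quotient_scope.

HB.instance Definition _ := GRing.Zmodule.copy Q (Quotient.quot (span_pred G)).
HB.instance Definition _ := Quotient.copy Q (Quotient.quot (span_pred G)).

Definition quot_scale (a : K) (x : Q) : Q := \pi_Q (a *: repr x).

Lemma quot_eq (u v : V) : (\pi_Q u = \pi_Q v) <-> span G (u - v).
Proof.
split=> [/eqP|/span_predP].
  by rewrite -Quotient.idealrBE => /span_predP.
by rewrite (Quotient.idealrBE (span_pred G)) => /eqP.
Qed.

Lemma quot_piD (u v : V) : \pi_Q (u + v) = \pi_Q u + \pi_Q v.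
Proof. exact: (Quotient.pi_add (span_pred G)). Qed.

Lemma quot_scaleE (a : K) (u : V) : quot_scale a (\pi_Q u) = \pi_Q (a *: u).
Proof.
apply/quot_eq; rewrite -scalerBr.
have [G0 GD] := span_subspace G.
rewrite -[X in span G X]addr0; apply: GD G0.
by apply/(quot_eq _ u); rewrite reprK.
Qed.

Fact quot_scaleA a b (x : Q) :
  quot_scale a (quot_scale b x) = quot_scale (a * b) x.
Proof. by elim/quotW: x => x; rewrite (quot_scaleE b) !quot_scaleE scalerA. Qed.

Fact quot_scale1 : left_id 1 quot_scale.
Proof. by elim/quotW=> x; rewrite quot_scaleE scale1r. Qed.

Fact quot_scaleDr : right_distributive quot_scale +%R.
Proof.
move=> a; elim/quotW=> x; elim/quotW=> y.
by rewrite -quot_piD !quot_scaleE scalerDr quot_piD.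
Qed.

Fact quot_scaleDl (x : Q) : {morph quot_scale^~ x : a b / a + b}.
Proof. by elim/quotW: x => x a b; rewrite !quot_scaleE scalerDl quot_piD. Qed.

HB.instance Definition _ := GRing.Zmodule_isLmodule.Build K Q
  quot_scaleA quot_scale1 quot_scaleDr quot_scaleDl.
End Quotient.
End LinearAlgebra.

(** [gbinom a k] is the coefficient of [x^k] in [(1 + x)^a]. *)
Definition gbinom (K : fieldType) (a : K) (k : nat) : K :=
  (\prod_(i < k) (a - i%:R)) / (k`!)%:R.

(** [opbinom T k] is the coefficient of [x^k] in [(1 + x)^T], i.e.
    [T (T - 1) ... (T - k + 1) / k!]. *)
Definition opbinom (K : fieldType) (V : lmodType K) (T : V -> V) (k : nat)
    (v : V) : V :=
  (k`!%:R)^-1 *: foldr (fun i x => T x - i%:R *: x) v (iota 0 k).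

(** A vertex operator map [Y : V (x) W -> W((x))] is given by its modes:
    [Y u n w] is [u_n w], where [Y(u,x)w = \sum_n u_n w x^(-n-1)]. *)
Section VertexMaps.
Variables (R : realType) (V : lmodType R[i]).
Variables (YV : V -> int -> V -> V) (vac omega : V) (c : R[i]).

Definition virasoro_op (W : lmodType R[i]) (Y : V -> int -> W -> W) (n : int) :
  W -> W := Y omega (n + 1).

(** Coefficient of [x_0^(-l-1) x_1^(-m-1) x_2^(-n-1)] in the Jacobi identity
<<
    x_0^-1 delta((x_1 - x_2)/x_0) Y(u,x_1) Y(v,x_2) w
      - x_0^-1 delta((x_2 - x_1)/(-x_0)) Y(v,x_2) Y(u,x_1) w
    = x_2^-1 delta((x_1 - x_0)/x_2) Y(Y(u,x_0)v,x_2) w.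
>>
    The sums over [i] have finite support by lower truncation. *)
Definition jacobi_identity (W : lmodType R[i]) (Y : V -> int -> W -> W) : Prop :=
  forall (u v : V) (w : W) (l m n : int),
    (\sum_(i \in [set: nat])
        ((-1) ^+ i * gbinom l%:~R i) *: Y u (m + l - i%:Z) (Y v (n + i%:Z) w))
    - (\sum_(i \in [set: nat])
        ((-1) ^ l * (-1) ^+ i * gbinom l%:~R i) *:
          Y v (n + l - i%:Z) (Y u (m + i%:Z) w))
    = \sum_(i \in [set: nat])
        gbinom m%:~R i *: Y (YV u (l + i%:Z) v) (m + n - i%:Z) w.

Record vertex_map_axioms (W : lmodType R[i]) (Y : V -> int -> W -> W) : Prop := {
  vm_linear_l : forall (a : R[i]) (u v : V) (n : int) (w : W),
    Y (a *: u + v) n w = a *: Y u n w + Y v n w;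
  vm_linear_r : forall (a : R[i]) (u : V) (n : int) (w z : W),
    Y u n (a *: w + z) = a *: Y u n w + Y u n z;
  vm_truncation : forall (u : V) (w : W),
    exists N : int, forall n : int, N <= n -> Y u n w = 0;
  vm_vacuum : forall (n : int) (w : W),
    Y vac n w = if n == -1 then w else 0;
  vm_jacobi : jacobi_identity Y;
  vm_virasoro : forall (m n : int) (w : W),
    let L := virasoro_op Y in
    L m (L n w) - L n (L m w) =
      (m - n)%:~R *: L (m + n) w
      + (if m + n == 0 then (c / 12%:R * (m ^+ 3 - m)%:~R) *: w else 0);
  vm_derivative : forall (u : V) (n : int) (w : W),
    Y (virasoro_op YV (-1) u) n w = - n%:~R *: Y u (n - 1) w
}.

End VertexMaps.

Record voa (R : realType) : Type := VOA {
  voa_space :> lmodType R[i];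
  voa_homog : int -> set voa_space;
  voa_Y : voa_space -> int -> voa_space -> voa_space;
  voa_vac : voa_space;
  voa_omega : voa_space;
  voa_c : R[i];
  voa_grading : direct_sum voa_homog;
  voa_fin_dim : forall n : int, fin_dim (voa_homog n);
  voa_lower : exists N : int, forall n : int, n < N -> voa_homog n = [set 0];
  voa_vertex_map : vertex_map_axioms voa_Y voa_vac voa_omega voa_c voa_Y;
  voa_creation : forall u : voa_space,
    voa_Y u (-1) voa_vac = u /\ forall n : int, 0 <= n -> voa_Y u n voa_vac = 0;
  voa_vac_homog : voa_homog 0 voa_vac;
  voa_omega_homog : voa_homog 2 voa_omega;
  voa_L0 : forall (n : int) (v : voa_space), voa_homog n v ->
    virasoro_op voa_omega voa_Y 0 v = n%:~R *: v
}.

Section VOATheory.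
Variables (R : realType) (V : voa R).

Definition voa_L (n : int) : V -> V := virasoro_op (voa_omega V) (@voa_Y R V) n.

Definition voa_plus : set V :=
  span [set v | exists2 n : int, 0 < n & voa_homog n v].

Definition C1_gen : set V :=
  [set x | exists u v : V,
     [/\ voa_plus u, voa_plus v & x = voa_Y u (-1) v]]
  `|` [set voa_L (-1) v | v in [set: V]].

Definition C1_cofinite : Prop := fin_dim [set: quot_span C1_gen].

(** [Res_x x^p Y((1 + x)^(L(0) + n) u, x) v] *)
Definition zhu_res (n : nat) (p : int) (u v : V) : V :=
  \sum_(j \in [set: nat])
    voa_Y (opbinom (fun x => voa_L 0 x + n%:R *: x) j u) (p + j%:Z) v.

Definition zhu_star (n : nat) (u v : V) : V :=
  \sum_(m < n.+1)
    ((-1) ^+ m * ('C(m + n, n))%:R) *: zhu_res n (- (n + m + 1)%N%:Z) u v.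

Definition zhu_O_gen (n : nat) : set V :=
  [set x | exists u v : V, x = zhu_res n (- (2 * n + 2)%N%:Z) u v]
  `|` [set voa_L (-1) u + voa_L 0 u | u in [set: V]].

Definition zhu_algebra (n : nat) : lmodType R[i] := quot_span (zhu_O_gen n).

(** The choice of representatives is immaterial, since [O_n(V)] is a two-sided
    ideal for [*_n] (Zhu, Dong-Li-Mason). *)
Definition zhu_mul (n : nat) (a b : zhu_algebra n) : zhu_algebra n :=
  (\pi_(quot_span (zhu_O_gen n)) (zhu_star n (repr a) (repr b)))%qT.

End VOATheory.

Record gen_module (R : realType) (V : voa R) : Type := GenModule {
  gm_space :> lmodType R[i];
  gm_homog : R[i] -> set gm_space;
  gm_Y : V -> int -> gm_space -> gm_space;
  gm_grading : direct_sum gm_homog;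
  gm_vertex_map :
    vertex_map_axioms (@voa_Y R V) (voa_vac V) (voa_omega V) (voa_c V) gm_Y;
  gm_L0 : forall (n : R[i]) (w : gm_space),
    gm_homog n w <->
    exists k : nat,
      iter k (fun x => virasoro_op (voa_omega V) gm_Y 0 x - n *: x) w = 0
}.

Section Modules.
Variables (R : realType) (V : voa R).
Implicit Types W : gen_module V.

Definition gm_L W (n : int) : W -> W :=
  virasoro_op (voa_omega V) (@gm_Y R V W) n.

Definition lower_truncated W : Prop :=
  exists B : R, forall n : R[i], complex.Re n < B ->
    @gm_homog R V W n = [set 0].

Definition grading_restricted W : Prop :=
  lower_truncated W /\ forall n : R[i], fin_dim (@gm_homog R V W n).

Definition L0_semisimple W : Prop :=
  direct_sum (fun n : R[i] => [set w : W | gm_L 0 w = n *: w]).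

Definition ordinary_module W : Prop := grading_restricted W /\ L0_semisimple W.

(** Stability under [L(0) = omega_1] makes such a subspace graded. *)
Definition gen_submodule W (S : set W) : Prop :=
  subspace S /\ forall (u : V) (n : int) (w : W), S w -> S (gm_Y u n w).

Definition irreducible_module W : Prop :=
  (exists w : W, w != 0) /\
  forall S : set W, gen_submodule S -> S = [set 0] \/ S = [set: W].

Definition lowest_weight W (n0 : R[i]) : Prop :=
  @gm_homog R V W n0 <> [set 0] /\
  forall n : R[i],
    complex.Re n < complex.Re n0 \/ (complex.Re n = complex.Re n0 /\ n <> n0) ->
    @gm_homog R V W n = [set 0].

Definition module_map (W1 W2 : gen_module V) (f : W1 -> W2) : Prop :=
  linear f /\ forall (u : V) (n : int) (w : W1), f (gm_Y u n w) = gm_Y u n (f w).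

End Modules.

Section ModuleHom.
Variables (R : realType) (V : voa R) (W1 W2 : gen_module V).

Definition module_map_pred : {pred W1 -> W2} := fun f => `[< module_map f >].

Record module_hom : Type := ModuleHom {
  module_hom_val :> W1 -> W2;
  _ : module_hom_val \in module_map_pred
}.

HB.instance Definition _ := [isSub for module_hom_val].
HB.instance Definition _ := [Choice of module_hom by <:].

Lemma module_homP (f : module_hom) : module_map f.
Proof. by case: f => f /= /asboolP. Qed.

Lemma gm_Y_linear (W : gen_module V) u n : linear (@gm_Y R V W u n).
Proof. by move=> a w z; rewrite (vm_linear_r (gm_vertex_map W)). Qed.

Lemma gm_Y0 (W : gen_module V) u n : @gm_Y R V W u n 0 = 0.
Proof. by have := gm_Y_linear u n (-1) (0 : W) 0; rewrite !scaleN1r oppr0 addr0 addNr. Qed.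

Fact module_map_submod_closed : submod_closed module_map_pred.
Proof.
split=> [|a f g /asboolP[fl fY] /asboolP[gl gY]]; apply/asboolP; split.
- by move=> a x y; rewrite /= [RHS]addr0 [RHS]scaler0.
- by move=> u n w; rewrite [RHS]gm_Y0.
- move=> b x y.
  rewrite -![(a *: f + g) _]/(a *: f _ + g _) fl gl !scalerDr !scalerA.
  by rewrite addrACA [a * b]mulrC.
- move=> u n w.
  by rewrite -![(a *: f + g) _]/(a *: f _ + g _) fY gY gm_Y_linear.
Qed.

HB.instance Definition _ :=
  GRing.SubChoice_isSubLmodule.Build R[i] (W1 -> W2) module_map_pred module_hom
    module_map_submod_closed.

End ModuleHom.
Arguments module_map_pred {R V} W1 W2.

Record linear_category (K : fieldType) : Type := LinearCategory {
  obj :> Type;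
  hom : obj -> obj -> lmodType K;
  idm : forall X, hom X X;
  comp : forall X Y Z, hom Y Z -> hom X Y -> hom X Z;
  comp_idl : forall X Y (f : hom X Y), comp (idm Y) f = f;
  comp_idr : forall X Y (f : hom X Y), comp f (idm X) = f;
  comp_assoc : forall X Y Z T (h : hom Z T) (g : hom Y Z) (f : hom X Y),
    comp h (comp g f) = comp (comp h g) f;
  comp_linear_l : forall X Y Z (a : K) (g h : hom Y Z) (f : hom X Y),
    comp (a *: g + h) f = a *: comp g f + comp h f;
  comp_linear_r : forall X Y Z (a : K) (g : hom Y Z) (f h : hom X Y),
    comp g (a *: f + h) = a *: comp g f + comp g h
}.

Section Abelian.
Variables (K : fieldType) (A : linear_category K).

Definition zero_object (Z : A) : Prop :=
  forall X : A, (forall f : hom X Z, f = 0) /\ (forall f : hom Z X, f = 0).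

Definition monic (X Y : A) (f : hom X Y) : Prop :=
  forall (T : A) (g h : hom T X), comp f g = comp f h -> g = h.

Definition epic (X Y : A) (f : hom X Y) : Prop :=
  forall (T : A) (g h : hom Y T), comp g f = comp h f -> g = h.

Definition is_kernel (X Y : A) (f : hom X Y) (M : A) (k : hom M X) : Prop :=
  comp f k = 0 /\
  forall (T : A) (g : hom T X), comp f g = 0 ->
    exists! t : hom T M, comp k t = g.

Definition is_cokernel (X Y : A) (f : hom X Y) (M : A) (p : hom Y M) : Prop :=
  comp p f = 0 /\
  forall (T : A) (g : hom Y T), comp g f = 0 ->
    exists! t : hom M T, comp t p = g.

Definition is_biproduct (X Y P : A) (i : hom X P) (j : hom Y P)
    (p : hom P X) (q : hom P Y) : Prop :=
  [/\ comp p i = idm X, comp q j = idm Y, comp q i = 0, comp p j = 0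
    & comp i p + comp j q = idm P].

Record is_abelian : Prop := {
  ab_zero : exists Z : A, zero_object Z;
  ab_biproduct : forall X Y : A, exists (P : A) (i : hom X P) (j : hom Y P)
    (p : hom P X) (q : hom P Y), is_biproduct i j p q;
  ab_kernel : forall (X Y : A) (f : hom X Y),
    exists (M : A) (k : hom M X), is_kernel f k;
  ab_cokernel : forall (X Y : A) (f : hom X Y),
    exists (M : A) (p : hom Y M), is_cokernel f p;
  ab_monic : forall (X Y : A) (f : hom X Y), monic f ->
    exists (Z : A) (g : hom Y Z), is_kernel g f;
  ab_epic : forall (X Y : A) (f : hom X Y), epic f ->
    exists (Z : A) (g : hom Z X), is_cokernel g f
}.

End Abelian.

Record gr_module (R : realType) (V : voa R) : Type := GrModule {
  grm_module :> gen_module V;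
  grm_restricted : grading_restricted grm_module
}.

Section GrModuleCategory.
Variables (R : realType) (V : voa R).
Implicit Types W X Y Z : gr_module V.

Fact id_module_map (W : gen_module V) : (id : W -> W) \in module_map_pred W W.
Proof. by apply/asboolP; split. Qed.

Fact comp_module_map (X Y Z : gen_module V) (g : module_hom Y Z)
    (f : module_hom X Y) : g \o f \in module_map_pred X Z.
Proof.
have [gl gY] := module_homP g; have [fl fY] := module_homP f.
by apply/asboolP; split=> [a x y|u n w] /=; rewrite ?fl ?gl ?fY ?gY.
Qed.

Definition id_hom (W : gen_module V) : module_hom W W :=
  ModuleHom (id_module_map W).

Definition comp_hom (X Y Z : gen_module V) (g : module_hom Y Z)
    (f : module_hom X Y) : module_hom X Z := ModuleHom (comp_module_map g f).

Lemma comp_hom_linear_l (X Y Z : gen_module V) (a : R[i])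
    (g h : module_hom Y Z) (f : module_hom X Y) :
  comp_hom (a *: g + h) f = a *: comp_hom g f + comp_hom h f.
Proof. exact/val_inj. Qed.

Lemma comp_hom_linear_r (X Y Z : gen_module V) (a : R[i])
    (g : module_hom Y Z) (f h : module_hom X Y) :
  comp_hom g (a *: f + h) = a *: comp_hom g f + comp_hom g h.
Proof.
by apply/val_inj/funext => x; have [gl _] := module_homP g; apply: gl.
Qed.

Definition gr_module_category : linear_category R[i].
Proof.
refine (@LinearCategory R[i] (gr_module V)
  (fun X Y => module_hom X Y : lmodType R[i])
  (fun X => id_hom X) (fun X Y Z => @comp_hom X Y Z) _ _ _ _ _).
- by move=> X Y f; apply/val_inj.
- by move=> X Y f; apply/val_inj.
- by move=> X Y Z T h g f; apply/val_inj.
- by move=> *; apply: comp_hom_linear_l.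
- by move=> *; apply: comp_hom_linear_r.
Defined.

Definition surjective_hom (X Y : gen_module V) (f : module_hom X Y) : Prop :=
  forall y : Y, exists x : X, f x = y.

Definition equivalent_modules (X Y : gen_module V) : Prop :=
  exists (f : module_hom X Y) (g : module_hom Y X), cancel f g /\ cancel g f.

Definition short_exact (X Y Z : gen_module V) (i : module_hom X Y)
    (p : module_hom Y Z) : Prop :=
  [/\ injective i, surjective_hom p
    & forall y : Y, p y = 0 <-> exists x : X, i x = y].

Inductive finite_length : gr_module V -> Prop :=
| finite_length_zero W : (forall w : W, w = 0) -> finite_length W
| finite_length_ext X Y Z (i : module_hom X Y) (p : module_hom Y Z) :
    finite_length X -> irreducible_module Z -> short_exact i p ->
    finite_length Y.

Definition projective P : Prop :=
  forall X Y (q : module_hom X Y) (f : module_hom P Y), surjective_hom q ->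
    exists g : module_hom P X, comp_hom q g = f.

Definition projective_cover W U (p : module_hom U W) : Prop :=
  [/\ projective U, surjective_hom p
    & forall W1 (q : module_hom W1 W), projective W1 -> surjective_hom q ->
        exists2 qt : module_hom W1 U, surjective_hom qt & comp_hom p qt = q].

Record finite_abelian_category : Prop := {
  fac_abelian : is_abelian gr_module_category;
  fac_length : forall W, finite_length W;
  fac_hom : forall X Y, fin_dim [set: hom (X : gr_module_category) Y];
  fac_simple : exists (k : nat) (S : 'I_k -> gr_module V),
    forall W, irreducible_module W -> exists i : 'I_k, equivalent_modules W (S i);
  fac_cover : forall W, irreducible_module W ->
    exists (U : gr_module V) (p : module_hom U W), projective_cover p
}.

End GrModuleCategory.

(* Main.v *)
(** Let [L] be the set of lowest weights of irreducible modules. Minimal weights of any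
    module belong to [L], so for [n \in L] no module has weights in [n - N - 1 - nat];
    hence the operators [o(u)] act on [W_[n]] through the finite-dimensional [A_N(V)].
    This bounds the number of irreducible modules, by a density argument, and makes [L]
    finite. If [W] is generated by [w \in W_[n]], then [C_1]-cofiniteness gives a
    PBW-type spanning set of [W], namely products of raising, weight-preserving and
    lowering modes of finitely many vectors applied to [w]. Only boundedly many lowering
    and raising modes matter in weights [n + k] with [|k| <= N], and [A_N(V)] controls the
    weight-preserving ones: the sum [F(W)] of the [W_[m]], [m \in L], has dimension bounded
    independently of [W].

    The exact functor [F] detects nonzero submodules, whence finite lengths and
    finite-dimensional spaces of morphisms. A pair [(P, w)] generated by [w \in P_[n]] with
    [dim F(P)] maximal is universal, so that [Hom(P, X) = X_[n]] is exact in [X] and [P] is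
    projective. A projective module mapping onto a simple one with [dim F] minimal is a
    projective cover, by Fitting's argument. *)
From HB Require Import structures.
From mathcomp Require Import all_boot all_order all_algebra.
From mathcomp Require Import generic_quotient.
From mathcomp Require Import complex.
From mathcomp Require Import boolp classical_sets functions cardinality fsbigop reals.
From mathcomp Require Import zify.
Require Import Defs.

Set Implicit Arguments.
Unset Strict Implicit.
Unset Printing Implicit Defensive.

Import Order.TTheory GRing.Theory Num.Theory.
Local Open Scope classical_set_scope.
Local Open Scope ring_scope.

(** * Spanning sets and dimension *)

(** The gap of length [N] below a weight of [L] serves twice: it cuts off the lowering modes, and it
    makes the left side of the Jacobi identity vanish, so that what remains says that [o] kills
    [O_N(V)]. One obstacle shapes the bound on [F(W)]: the spanning words contain arbitrarily long
    products of weight-preserving modes, whereas finite-dimensionality of [A_N(V)] bounds only the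
    span of the vectors [o(u) x]. Such a product applied to [x] lies in the submodule generated by
    [x], whose elements are sums of single modes of [x]; by its weight only the modes of shift zero
    contribute, hence it is one vector [o(u) x]. Here [x] is a lowered vector, and the gap condition
    holds a fortiori at lower weights. The words come from [V] and [N] alone, whence a bound uniform
    in [W]. Exactness of [F] is that of taking weight spaces. It detects a nonzero submodule because
    that submodule is itself grading restricted, so has a minimal weight, which lies in [L]. Hence
    [dim F] grows strictly along strict inclusions of submodules, and the maximum and minimum
    arguments on modules use it. *)

Section LinearAlgebraOfSets.
Variables (K : fieldType) (V : lmodType K).
Implicit Types (S G : set V) (s : seq V).

Section Subspaces.
Variables (S : set V) (S_sub : subspace S).

Lemma subspace0 : S 0. Proof. by case: S_sub. Qed.

Lemma subspaceZ a v : S v -> S (a *: v).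
Proof. by move=> Sv; rewrite -[_ *: _]addr0; apply: S_sub.2 => //; apply: subspace0. Qed.

Lemma subspaceD u v : S u -> S v -> S (u + v).
Proof. by move=> Su Sv; rewrite -[u]scale1r; apply: S_sub.2. Qed.

Lemma subspaceN v : S v -> S (- v).
Proof. by rewrite -scaleN1r; apply: subspaceZ. Qed.

Lemma subspaceB u v : S u -> S v -> S (u - v).
Proof. by move=> Su /subspaceN; apply: subspaceD. Qed.

Lemma subspace_sum (I : Type) (r : seq I) (P : pred I) (F : I -> V) :
  (forall i, P i -> S (F i)) -> S (\sum_(i <- r | P i) F i).
Proof. by move=> SF; elim/big_ind: _ => //; [apply: subspace0|apply: subspaceD]. Qed.

Lemma subspace_sum_mem (I : eqType) (r : seq I) (F : I -> V) :
  (forall i, i \in r -> S (F i)) -> S (\sum_(i <- r) F i).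
Proof. by move=> SF; rewrite big_seq; apply: subspace_sum. Qed.

End Subspaces.

Lemma sub_span G : G `<=` span G.
Proof. exact: sub_smallest. Qed.

Lemma span_min S G : subspace S -> G `<=` S -> span G `<=` S.
Proof. by move=> S_sub GS v; apply. Qed.

Lemma span_mono G G' : G `<=` G' -> span G `<=` span G'.
Proof.
by move=> GG'; apply: span_min; [apply: span_subspace|apply: subset_trans GG' (@sub_span _)].
Qed.

Lemma subspaceI S S' : subspace S -> subspace S' -> subspace (S `&` S').
Proof.
move=> S1 S2; split=> [|a u v [u1 u2] [v1 v2]].
  by split; apply: subspace0.
by split; [apply: S1.2|apply: S2.2].
Qed.

Lemma subspace_setT : subspace [set: V]. Proof. by []. Qed.

Lemma subspace_set0 : subspace [set 0 : V].
Proof. by split=> // a u v /= -> ->; rewrite scaler0 addr0. Qed.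

Lemma spanZ G a v : span G v -> span G (a *: v).
Proof. exact: (subspaceZ (span_subspace G)). Qed.

Lemma spanD G u v : span G u -> span G v -> span G (u + v).
Proof. exact: (subspaceD (span_subspace G)). Qed.

Lemma spanB G u v : span G u -> span G v -> span G (u - v).
Proof. exact: (subspaceB (span_subspace G)). Qed.

Lemma span0 G : span G 0.
Proof. exact: (subspace0 (span_subspace G)). Qed.

Lemma span_sum G (I : eqType) (r : seq I) (F : I -> V) :
  (forall i, i \in r -> span G (F i)) -> span G (\sum_(i <- r) F i).
Proof. exact: (subspace_sum_mem (span_subspace G)). Qed.

Lemma span_seqP s v :
  span [set` s] v <-> exists c : 'I_(size s) -> K, v = \sum_i c i *: s`_i.
Proof.
split; last first.
  move=> [c ->]; apply: span_sum => i _; apply: spanZ.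
  by apply: (@sub_span [set` s]); apply: mem_nth.
move: v; apply: span_min => [|x xs].
  split=> [|a u v [c ->] [d ->]].
    by exists (fun=> 0); rewrite big1 // => i _; rewrite scale0r.
  exists (fun i => a * c i + d i); rewrite scaler_sumr -big_split.
  by apply: eq_bigr => i _; rewrite scalerDl scalerA.
exists (fun i => (val i == index x s)%:R).
have ix : (index x s < size s)%N by rewrite index_mem.
rewrite (bigD1 (Ordinal ix)) //= eqxx scale1r nth_index // big1 ?addr0 // => i.
by rewrite -val_eqE /= => /negPf ->; rewrite scale0r.
Qed.

Definition free_family m (v : 'I_m -> V) : Prop :=
  forall c : 'I_m -> K, \sum_i c i *: v i = 0 -> forall i, c i = 0.

(** Unlike in [fin_dim], the spanning vectors may lie outside [S], so the property passes to
    arbitrary subsets; [fin_spanned_dim] returns to [fin_dim] for subspaces. *)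
Definition fin_spanned S : Prop := exists s : seq V, S `<=` span [set` s].

(** With more vectors than generators the coefficient matrix has more rows than columns, and a
    nonzero row of its left kernel is a linear relation. *)
Lemma free_family_le m (v : 'I_m -> V) s :
  free_family v -> (forall i, span [set` s] (v i)) -> (m <= size s)%N.
Proof.
move=> fv sv; rewrite leqNgt; apply/negP => lt_sm.
have /choice [A vA] i : exists c : 'I_(size s) -> K, v i = \sum_j c j *: s`_j.
  exact/span_seqP.
pose M := \matrix_(i, j) A i j; pose c := nz_row (kermx M).
have kn0 : kermx M != 0.
  rewrite -mxrank_eq0 mxrank_ker -lt0n subn_gt0.
  by apply: leq_ltn_trans lt_sm; apply: rank_leq_col.
have c0 : c *m M = 0 by apply/sub_kermxP; apply: nz_row_sub.
suff : c = 0 by move/eqP; rewrite nz_row_eq0 (negPf kn0).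
apply/rowP => i; rewrite mxE; apply: (fv (fun i => c 0 i)).
transitivity (\sum_j (c *m M) 0 j *: s`_j); last first.
  by rewrite c0 big1 // => j _; rewrite mxE scale0r.
under eq_bigr do rewrite vA scaler_sumr.
rewrite exchange_big; apply: eq_bigr => j _ /=.
rewrite mxE scaler_suml; apply: eq_bigr => k _.
by rewrite scalerA !mxE.
Qed.

Definition has_free S m : Prop :=
  exists v : 'I_m -> V, (forall i, S (v i)) /\ free_family v.

(** The junk value [0] is taken when [S] is not finitely spanned. *)
Definition set_dim S : nat :=
  xget 0%N [set m | has_free S m /\ forall k, has_free S k -> (k <= m)%N].

Lemma has_free_le S s m : S `<=` span [set` s] -> has_free S m -> (m <= size s)%N.
Proof. by move=> Ss [v [Sv fv]]; apply: (free_family_le fv) => i; apply: Ss. Qed.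

Lemma set_dimP S : fin_spanned S ->
  has_free S (set_dim S) /\ forall k, has_free S k -> (k <= set_dim S)%N.
Proof.
move=> [s Ss]; rewrite /set_dim; case: xgetP => [m -> //|none].
have ex0 : exists m, `[< has_free S m >].
  by exists 0%N; apply/asboolP; exists (fun=> 0); split=> [[]|c _ []].
have ub m : `[< has_free S m >] -> (m <= size s)%N.
  by move=> /asboolP; apply: has_free_le.
case: (ex_maxnP ex0 ub) => m /asboolP Sm max_m.
by case: (none m); split=> // k /asboolP; apply: max_m.
Qed.

Lemma set_dim_le S s : S `<=` span [set` s] -> (set_dim S <= size s)%N.
Proof.
by move=> Ss; apply: (has_free_le Ss); case: (@set_dimP S) => //; exists s.
Qed.

(** Adjoining [x] at index 0 exceeds the dimension, so there is a relation; the coefficient of [x]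
    in it is nonzero because [v] is free. *)
Lemma set_dim_max S m (v : 'I_m -> V) :
  subspace S -> fin_spanned S -> (forall i, S (v i)) -> free_family v ->
  (set_dim S <= m)%N -> forall x, S x -> exists c : 'I_m -> K, x = \sum_i c i *: v i.
Proof.
move=> S_sub S_fin Sv fv le_m x Sx.
pose w (i : 'I_m.+1) := oapp v x (unlift ord0 i).
have w0 : w ord0 = x by rewrite /w unlift_none.
have wS i : w (lift ord0 i) = v i by rewrite /w liftK.
have nfw : ~ free_family w.
  move=> fw; have /(set_dimP S_fin).2 : has_free S m.+1.
    exists w; split=> // i; rewrite /w; case: unliftP => [j|] _ //=.
  by rewrite ltnNge le_m.
move: nfw => /existsNP[c /not_implyP[cw /existsNP[i ci]]].
move: cw; rewrite big_ord_recl w0; under eq_bigr do rewrite wS.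
have [c0|c0] := eqVneq (c ord0) 0.
  rewrite c0 scale0r add0r => /fv cv; case: ci.
  by case: (unliftP ord0 i) => [j ->|->] //; apply: cv.
move/eqP; rewrite addr_eq0 => /eqP cx.
exists (fun i => - ((c ord0)^-1 * c (lift ord0 i))).
rewrite -[LHS]scale1r -(mulVf c0) -scalerA cx scalerN scaler_sumr -sumrN.
by apply: eq_bigr => j _; rewrite scalerA scaleNr.
Qed.

Lemma fin_spanned_sub S S' : S `<=` S' -> fin_spanned S' -> fin_spanned S.
Proof. by move=> SS' [s S's]; exists s; apply: subset_trans S's. Qed.

Lemma fin_dim_spanned S : fin_dim S -> fin_spanned S.
Proof. by move=> [s ->]; exists s. Qed.

Lemma fin_spanned_dim S : subspace S -> fin_spanned S -> fin_dim S.
Proof.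
move=> S_sub S_fin; have [[v [Sv fv]] _] := set_dimP S_fin.
exists [seq v i | i <- enum 'I_(set_dim S)]; apply/seteqP; split.
  move=> x /(set_dim_max S_sub S_fin Sv fv (leqnn _))[c ->].
  apply: span_sum => i _; apply: spanZ.
  by apply: sub_span => /=; apply: map_f; rewrite mem_enum.
by apply: span_min => // x /= /mapP[i _ ->].
Qed.

Lemma set_dim_mono S S' : S `<=` S' -> fin_spanned S' -> (set_dim S <= set_dim S')%N.
Proof.
move=> SS' S'_fin; have [[v [Sv fv]] _] := set_dimP (fin_spanned_sub SS' S'_fin).
by apply: (set_dimP S'_fin).2; exists v; split=> // i; apply: SS'.
Qed.

Lemma set_dim_eq S S' : subspace S -> subspace S' -> S `<=` S' ->
  fin_spanned S' -> (set_dim S' <= set_dim S)%N -> S' `<=` S.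
Proof.
move=> S_sub S'_sub SS' S'_fin le_dim x S'x.
have [[v [Sv fv]] _] := set_dimP (fin_spanned_sub SS' S'_fin).
have S'v i : S' (v i) by apply: SS'.
have [c ->] := set_dim_max S'_sub S'_fin S'v fv le_dim S'x.
by apply: subspace_sum => // i _; apply: subspaceZ.
Qed.

Lemma fin_spanned_bigcup (I : choiceType) (r : seq I) (S : I -> set V) :
  (forall i, i \in r -> fin_spanned (S i)) ->
  fin_spanned (span [set x | exists2 i, i \in r & S i x]).
Proof.
elim: r => [_|i r IH Sr].
  exists [::]; apply: span_mono => x [] //.
have [j rj|s1 s1P] := IH; first by apply: Sr; rewrite inE rj orbT.
have [s2 s2P] := Sr i (mem_head _ _).
exists (s1 ++ s2); apply: (@span_min (span [set` s1 ++ s2])) => [|x [j]].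
  exact: span_subspace.
rewrite inE => /orP[/eqP ->|rj] Sx.
  by apply: (@span_mono [set` s2]); [move=> y /= ys; rewrite mem_cat ys orbT|exact: s2P].
apply: (@span_mono [set` s1]); [by move=> y /= ys; rewrite mem_cat ys|].
by apply: s1P; apply: sub_span; exists j.
Qed.
End LinearAlgebraOfSets.

Section LinearMapsOfSets.
Variables (K : fieldType) (V W : lmodType K) (f : V -> W) (f_lin : linear f).

Lemma lin0 : f 0 = 0.
Proof. by have := f_lin (-1) 0 0; rewrite !scaleN1r oppr0 addr0 addNr. Qed.

Lemma linZ a x : f (a *: x) = a *: f x.
Proof. by rewrite -[a *: x]addr0 f_lin lin0 addr0. Qed.

Lemma linD x y : f (x + y) = f x + f y.
Proof. by rewrite -[x]scale1r f_lin !scale1r. Qed.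

Lemma linN x : f (- x) = - f x.
Proof. by rewrite -!scaleN1r linZ. Qed.

Lemma linB x y : f (x - y) = f x - f y.
Proof. by rewrite linD linN. Qed.

Lemma lin_sum (I : Type) (r : seq I) (P : pred I) (F : I -> V) :
  f (\sum_(i <- r | P i) F i) = \sum_(i <- r | P i) f (F i).
Proof. exact: (big_morph f linD lin0). Qed.

Lemma subspace_preim (S : set W) : subspace S -> subspace (f @^-1` S).
Proof.
move=> S_sub; split=> [|a u v] /=; first by rewrite lin0; apply: subspace0.
by rewrite f_lin; apply: S_sub.2.
Qed.

Lemma subspace_img (S : set V) : subspace S -> subspace (f @` S).
Proof.
move=> S_sub; split=> [|a _ _ [u Su <-] [v Sv <-]].
  by exists 0; [apply: subspace0|apply: lin0].
by exists (a *: u + v); [apply: S_sub.2|apply: f_lin].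
Qed.

Lemma subspace_ker : subspace [set x | f x = 0].
Proof. exact: (subspace_preim (@subspace_set0 _ _)). Qed.

Lemma span_img (G : set V) (G' : set W) :
  f @` G `<=` G' -> f @` span G `<=` span G'.
Proof.
move=> GG' _ [x Gx <-]; move: x Gx.
apply: (@span_min _ _ (f @^-1` span G')); first exact: subspace_preim (span_subspace _).
by move=> x Gx; apply: sub_span; apply: GG'; exists x.
Qed.

Lemma fin_spanned_img (S : set V) : fin_spanned S -> fin_spanned (f @` S).
Proof.
move=> [s Ss]; exists (map f s); apply: subset_trans (@span_img [set` s] _ _).
  by move=> _ [x /Ss Sx <-]; exists x.
by move=> _ [x /= xs <-]; apply: map_f.
Qed.

Lemma set_dim_inj (S : set V) (S' : set W) :
  subspace S -> fin_spanned S -> f @` S `<=` S' -> fin_spanned S' ->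
  (forall x, S x -> f x = 0 -> x = 0) -> (set_dim S <= set_dim S')%N.
Proof.
move=> S_sub S_fin SS' S'_fin f_inj; have [[v [Sv fv]] _] := set_dimP S_fin.
apply: (set_dimP S'_fin).2; exists (fun i => f (v i)); split.
  by move=> i; apply: SS'; exists (v i).
move=> c cfv; apply: fv; apply: f_inj.
  by apply: subspace_sum => // i _; apply: subspaceZ.
by rewrite lin_sum -[RHS]cfv; apply: eq_bigr => i _; rewrite linZ.
Qed.

(** Lifts of a basis of [S'] form a free family in [S], large enough to span [S]; hence an element
    of [S] with zero image has zero coordinates. *)
Lemma set_dim_surj_inj (S : set V) (S' : set W) :
  subspace S -> fin_spanned S -> S' `<=` f @` S -> fin_spanned S' ->
  (set_dim S <= set_dim S')%N -> forall x, S x -> f x = 0 -> x = 0.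
Proof.
move=> S_sub S_fin SS' S'_fin le_dim x Sx fx0.
have [[w [S'w fw]] _] := set_dimP S'_fin.
have /choice [v vP] i : exists x, S x /\ f x = w i.
  by have [y Sy fy] := SS' _ (S'w i); exists y.
have fv : free_family v.
  move=> c cv; apply: fw; rewrite -[RHS]lin0 -[in RHS]cv lin_sum.
  by apply: eq_bigr => i _; rewrite linZ (vP i).2.
have [c xc] := set_dim_max S_sub S_fin (fun i => (vP i).1) fv le_dim Sx.
rewrite xc big1 // => i _; rewrite (fw c) ?scale0r // -[RHS]fx0 [in RHS]xc lin_sum.
by apply: eq_bigr => j _; rewrite linZ (vP j).2.
Qed.

Lemma fin_spanned_ker (S : set V) : subspace S -> fin_spanned (f @` S) ->
  fin_spanned (S `&` [set x | f x = 0]) -> fin_spanned S.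
Proof.
move=> S_sub fS_fin [s sP].
have fS_sub := subspace_img S_sub.
have [[w [Sw fw]] _] := set_dimP fS_fin.
have /choice [v vP] i : exists x, S x /\ f x = w i.
  by have [y Sy fy] := Sw i; exists y.
exists ([seq v i | i <- enum 'I_(set_dim (f @` S))] ++ s) => x Sx.
have [|c fxc] := set_dim_max fS_sub fS_fin Sw fw (leqnn _) (x := f x).
  by exists x.
rewrite -[x](subrK (\sum_i c i *: v i)); apply: spanD.
  apply: (@span_mono _ _ [set` s]).
    by move=> y /= ys; rewrite mem_cat ys orbT.
  apply: sP; split.
    apply: subspaceB => //.
    by apply: subspace_sum => // i _; apply: subspaceZ => //; apply: (vP i).1.
  rewrite /= linB fxc lin_sum; apply/eqP; rewrite subr_eq0; apply/eqP.
  by apply: eq_bigr => i _; rewrite linZ (vP i).2.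
apply: span_sum => i _; apply: spanZ; apply: sub_span => /=.
by rewrite mem_cat map_f // mem_enum.
Qed.
End LinearMapsOfSets.

(** * Direct sums and generalized eigenspaces *)

Section FiniteSums.
Variables (V : zmodType) (I : choiceType).

Lemma fsum_seq (r : seq I) (F : I -> V) : uniq r -> (forall i, i \notin r -> F i = 0) ->
  \sum_(i \in [set: I]) F i = \sum_(i <- r) F i.
Proof.
move=> r_uniq Fr; rewrite (fsbigE r) //; last by move=> i _; apply: Fr.
by apply: eq_bigl => i; rewrite in_setT.
Qed.

Lemma finite_support_seq (F : I -> V) : finite_set [set i | F i != 0] ->
  exists r, uniq r /\ forall i, i \notin r -> F i = 0.
Proof.
move=> /finite_seqP[s sE]; exists (undup s); split; first exact: undup_uniq.
move=> i; rewrite mem_undup => /negP is_; apply/eqP; apply: contra_notT is_ => Fi.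
by have : [set i | F i != 0] i by []; rewrite sE.
Qed.

Lemma seq_finite_support (r : seq I) (F : I -> V) : (forall i, i \notin r -> F i = 0) ->
  finite_set [set i | F i != 0].
Proof.
move=> Fr; apply: (@sub_finite_set _ _ [set` r]); last exact: finite_seq.
by move=> i /=; apply: contra_neqT => /Fr.
Qed.
End FiniteSums.

Lemma fsum_ord (V : zmodType) (k : nat) (F : nat -> V) :
  (forall i, (k <= i)%N -> F i = 0) ->
  \sum_(i \in [set: nat]) F i = \sum_(i < k) F i.
Proof.
move=> Fk; rewrite (@fsum_seq _ _ (iota 0 k)) ?iota_uniq //.
  by rewrite -{1}[k]subn0 -/(index_iota 0 k) big_mkord.
by move=> i; rewrite mem_iota add0n -leqNgt; apply: Fk.
Qed.

Section DirectSum.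
Variables (K : fieldType) (V : lmodType K) (I : choiceType) (S : I -> set V).

Lemma direct_sumI : (forall i, subspace (S i)) ->
  (forall v, span [set x | exists i, S i x] v) ->
  (forall (r : seq I) (h : I -> V), uniq r -> (forall i, S i (h i)) ->
    \sum_(i <- r) h i = 0 -> forall i, i \in r -> h i = 0) ->
  direct_sum S.
Proof.
move=> S_sub S_span S_ind; split=> // v.
have ex (u : V) : exists f : I -> V, [/\ forall i, S i (f i),
   finite_set [set i | f i != 0] & u = \sum_(i \in [set: I]) f i].
  move: u (S_span u); apply: span_min => [|x [i Six]].
    split=> [|a u w [f [Sf ff ->]] [g [Sg fg ->]]].
      exists (fun=> 0); split=> [i||]; first exact: subspace0.
        by apply: (@seq_finite_support _ _ [::]).
      by rewrite fsbig1.
    have [[r [ur fr]] [s [us gs]]] := (finite_support_seq ff, finite_support_seq fg).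
    (* A list containing both supports turns all the finitely supported sums into sums over the same
       indices. *)
    pose t := undup (r ++ s).
    have ft i : i \notin t -> f i = 0.
      by rewrite mem_undup mem_cat negb_or => /andP[/fr].
    have gt i : i \notin t -> g i = 0.
      by rewrite mem_undup mem_cat negb_or => /andP[_ /gs].
    have ht i : i \notin t -> a *: f i + g i = 0.
      by move=> it; rewrite ft // gt // scaler0 addr0.
    exists (fun i => a *: f i + g i); split=> [i||]; first exact: (S_sub i).2.
      exact: seq_finite_support ht.
    rewrite !(@fsum_seq _ _ t) ?undup_uniq // scaler_sumr -big_split.
    by [].
  have ne j : j \notin [:: i] -> (if j == i then x else 0) = 0.
    by rewrite inE => /negPf ->.
  exists (fun j => if j == i then x else 0); split=> [j||].
  - by case: eqP => [->|_] //; apply: subspace0.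
  - exact: seq_finite_support ne.
  - by rewrite (@fsum_seq _ _ [:: i]) // big_seq1 eqxx.
have [f [Sf ff vf]] := ex v; exists f; split=> // g [Sg fg vg].
have [[r [ur fr]] [s [us gs]]] := (finite_support_seq ff, finite_support_seq fg).
pose t := undup (r ++ s).
have ft i : i \notin t -> f i = 0.
  by rewrite mem_undup mem_cat negb_or => /andP[/fr].
have gt i : i \notin t -> g i = 0.
  by rewrite mem_undup mem_cat negb_or => /andP[_ /gs].
have fg0 : \sum_(i <- t) (f i - g i) = 0.
  rewrite sumrB -(@fsum_seq _ _ t f) ?undup_uniq // -vf vg.
  by rewrite (@fsum_seq _ _ t) ?undup_uniq // subrr.
apply/funext => i; have [it|it] := boolP (i \in t); last by rewrite ft // gt.
apply/eqP; rewrite -subr_eq0; apply/eqP.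
apply: (S_ind t (fun i => f i - g i)) => //; first exact: undup_uniq.
by move=> j; apply: subspaceB.
Qed.

Hypothesis dS : direct_sum S.

Definition dproj (i : I) (v : V) : V := projT1 (cid (dS.2 v)) i.

Lemma dproj_in i v : S i (dproj i v).
Proof. by rewrite /dproj; case: cid => f [[]]. Qed.

Lemma dproj_unique (r : seq I) (f : I -> V) v : uniq r -> (forall i, S i (f i)) ->
  (forall i, i \notin r -> f i = 0) -> v = \sum_(i <- r) f i ->
  forall i, dproj i v = f i.
Proof.
move=> r_uniq Sf fr vE i; rewrite /dproj; case: cid => g [gP /= uniq_g].
rewrite (uniq_g f) //; split=> //; first exact: seq_finite_support fr.
by rewrite (@fsum_seq _ _ r).
Qed.

Lemma dproj_seq v : exists r, [/\ uniq r, forall i, i \notin r -> dproj i v = 0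
  & v = \sum_(i <- r) dproj i v].
Proof.
rewrite /dproj; case: cid => f /= [[_ /finite_support_seq[r [ur fr]] vE] _].
by exists r; split=> //; rewrite {1}vE (@fsum_seq _ _ r).
Qed.

Lemma dproj_linear i : linear (dproj i).
Proof.
move=> a u v.
have [[r [ur fr uE]] [s [us gs vE]]] := (dproj_seq u, dproj_seq v).
pose t := undup (r ++ s).
have ft j : j \notin t -> dproj j u = 0.
  by rewrite mem_undup mem_cat negb_or => /andP[/fr].
have gt j : j \notin t -> dproj j v = 0.
  by rewrite mem_undup mem_cat negb_or => /andP[_ /gs].
have sumE w q : uniq q -> w = \sum_(j <- q) dproj j w ->
    (forall j, j \notin q -> dproj j w = 0) -> (forall j, j \notin t -> dproj j w = 0) ->
    w = \sum_(j <- t) dproj j w.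
  move=> uq wE wq wt; rewrite {1}wE.
  rewrite -(@fsum_seq _ _ q (fun j => dproj j w)) //.
  by rewrite -(@fsum_seq _ _ t (fun j => dproj j w)) ?undup_uniq.
apply: (@dproj_unique t (fun i => a *: dproj i u + dproj i v)).
- exact: undup_uniq.
- by move=> j; apply: (dS.1 j).2; apply: dproj_in.
- by move=> j jt; rewrite ft // gt // scaler0 addr0.
- rewrite {1}(sumE u r) // {1}(sumE v s) //.
  by rewrite scaler_sumr -big_split.
Qed.

Lemma dprojE i j v : S i v -> dproj j v = if j == i then v else 0.
Proof.
move=> Siv; apply: (@dproj_unique [:: i] (fun j => if j == i then v else 0)) => //.
- by move=> k; case: eqP => [->|_] //; apply: (subspace0 (dS.1 k)).
- by move=> k; rewrite inE => /negPf ->.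
- by rewrite big_seq1 eqxx.
Qed.

Lemma direct_sum_ind (P : set V) : subspace P -> (forall i v, S i v -> P v) ->
  forall v, P v.
Proof.
move=> P_sub SP v; have [r [_ _ ->]] := dproj_seq v.
by apply: subspace_sum => // i _; apply: (SP i); apply: dproj_in.
Qed.

Section Extension.
Variables (W : lmodType K) (f : I -> V -> W).
Hypothesis f_lin : forall i, linear (f i).

(** Universal property of the direct sum: the linear map that is [f i] on [S i]. It serves to define
    [o(u)], where the mode depends on the weight of [u]. *)
Definition dext (v : V) : W := \sum_(i \in [set: I]) f i (dproj i v).

Lemma dextE i v : S i v -> dext v = f i v.
Proof.
move=> Siv; rewrite /dext (@fsum_seq _ _ [:: i]) //.
  by rewrite big_seq1 (dprojE _ Siv) eqxx.
by move=> j; rewrite inE (dprojE _ Siv) => /negPf ->; rewrite (lin0 (f_lin j)).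
Qed.

Lemma dext_linear : linear dext.
Proof.
move=> a u v.
have [[r [ur fr _]] [s [us gs _]]] := (dproj_seq u, dproj_seq v).
pose t := undup (r ++ s).
have ft j : j \notin t -> dproj j u = 0.
  by rewrite mem_undup mem_cat negb_or => /andP[/fr].
have gt j : j \notin t -> dproj j v = 0.
  by rewrite mem_undup mem_cat negb_or => /andP[_ /gs].
rewrite /dext !(@fsum_seq _ _ t) ?undup_uniq //.
- rewrite scaler_sumr -big_split; apply: eq_bigr => i _ /=.
  by rewrite dproj_linear f_lin.
- by move=> i it; rewrite gt // (lin0 (f_lin i)).
- by move=> i it; rewrite ft // (lin0 (f_lin i)).
- by move=> i it; rewrite dproj_linear ft // gt // scaler0 addr0 (lin0 (f_lin i)).
Qed.
End Extension.
End DirectSum.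

Section GeneralizedEigenspaces.
Variables (K : fieldType) (V : lmodType K) (T : V -> V) (T_lin : linear T).

Definition eigshift (a : K) (x : V) : V := T x - a *: x.

Definition geneig (a : K) : set V := [set v | exists k, iter k (eigshift a) v = 0].

(** Each vector is killed by a product of factors [T - a]. Over all generalized eigenspaces this is
    equivalent to a direct sum decomposition, but it is inherited at once by submodules, quotients
    and products. *)
Definition locally_finite : Prop :=
  forall v, exists s : seq K, foldr eigshift v s = 0.

Lemma eigshift_linear a : linear (eigshift a).
Proof.
move=> b u v; rewrite /eigshift T_lin !scalerDr !scalerA mulrC opprD scalerN scalerA.
by rewrite addrACA.
Qed.

Lemma eigshiftC a b v : eigshift a (eigshift b v) = eigshift b (eigshift a v).
Proof.
rewrite /eigshift !(linB T_lin) !(linZ T_lin) !scalerBr !scalerA mulrC.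
by rewrite !opprB addrACA [RHS]addrACA; congr (_ + _); rewrite addrC.
Qed.

Lemma iter_linear (f : V -> V) k : linear f -> linear (iter k f).
Proof. by move=> f_lin a u v; elim: k => //= k ->; apply: f_lin. Qed.

Lemma iter_eigshift_linear k a : linear (iter k (eigshift a)).
Proof. exact: iter_linear (eigshift_linear a). Qed.

Lemma iter_eigshiftC k a b v :
  iter k (eigshift a) (eigshift b v) = eigshift b (iter k (eigshift a) v).
Proof. by elim: k => //= k ->; apply: eigshiftC. Qed.

Lemma foldr_eigshift_linear s : linear (fun v => foldr eigshift v s).
Proof. by move=> a u v; elim: s => //= b s ->; apply: eigshift_linear. Qed.

Lemma foldr_eigshiftC s a v :
  foldr eigshift (eigshift a v) s = eigshift a (foldr eigshift v s).
Proof. by elim: s => //= b s ->; apply: eigshiftC. Qed.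

Lemma foldr_eigshift_foldrC s t v :
  foldr eigshift (foldr eigshift v t) s = foldr eigshift (foldr eigshift v s) t.
Proof. by elim: t => //= b t IH; rewrite foldr_eigshiftC IH. Qed.

Lemma iter_leq0 (f : V -> V) k l v : linear f -> (k <= l)%N -> iter k f v = 0 ->
  iter l f v = 0.
Proof.
move=> f_lin /subnK <- fv; rewrite iterD fv.
exact: lin0 (iter_linear _ f_lin).
Qed.

Lemma geneig_subspace a : subspace (geneig a).
Proof.
split=> [|b u v [k uk] [l vl]]; first by exists 0%N.
exists (maxn k l); rewrite iter_eigshift_linear.
rewrite (iter_leq0 (eigshift_linear a) (leq_maxl k l) uk).
by rewrite (iter_leq0 (eigshift_linear a) (leq_maxr k l) vl) scaler0 addr0.
Qed.

Lemma geneig_shift a b v : geneig a v -> geneig a (eigshift b v).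
Proof.
by move=> [k kv]; exists k; rewrite iter_eigshiftC kv (lin0 (eigshift_linear b)).
Qed.

Lemma eigshift_subr a b v : eigshift a v - eigshift b v = (b - a) *: v.
Proof. by rewrite /eigshift addrC opprB -addrA [_ + (T v - _)]addrA addNr add0r scalerBl. Qed.

(** [T - a] differs from the locally nilpotent [T - b] by the nonzero scalar [b - a]. If [w] solves
    [(T - a) w = (T - b) v], then [(T - a) (v - w) = (b - a) v]. *)
Lemma eigshift_surj a b v : a != b -> geneig b v -> exists2 w, geneig b w & eigshift a w = v.
Proof.
move=> ab [k]; elim: k v => [|k IH] v.
  move=> /= ->; exists 0; last exact: lin0 (eigshift_linear a).
  exact: subspace0 (geneig_subspace b).
rewrite iterSr => kv; have [w bw aw] := IH _ kv.
exists ((b - a)^-1 *: (v - w)).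
  apply: (subspaceZ (geneig_subspace b)); apply: (subspaceB (geneig_subspace b)) => //.
  by exists k.+1; rewrite iterSr.
rewrite (linZ (eigshift_linear a)) (linB (eigshift_linear a)) aw eigshift_subr.
by rewrite scalerA mulVf ?scale1r // subr_eq0 eq_sym.
Qed.

Lemma eigshift_inj a b v : a != b -> geneig b v -> eigshift a v = 0 -> v = 0.
Proof.
move=> ab [k]; elim: k v => [//|k IH] v; rewrite iterSr => kv av.
have bv : eigshift b v = 0.
  by apply: IH => //; rewrite eigshiftC av (lin0 (eigshift_linear b)).
have := eigshift_subr a b v; rewrite av bv subr0 => /esym/eqP.
by rewrite scaler_eq0 subr_eq0 eq_sym (negPf ab) => /eqP.
Qed.

Lemma iter_eigshift_inj k a b v : a != b -> geneig b v -> iter k (eigshift a) v = 0 -> v = 0.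
Proof.
move=> ab; elim: k v => [//|k IH] v bv; rewrite iterSr => /IH av.
by apply: (eigshift_inj ab bv); apply: av; apply: geneig_shift.
Qed.

Lemma iter_geneig k a b v : geneig b v -> geneig b (iter k (eigshift a) v).
Proof. by move=> bv; elim: k => //= k; apply: geneig_shift. Qed.

Lemma geneig_span s v : foldr eigshift v s = 0 -> span [set x | exists a, geneig a x] v.
Proof.
elim: s v => [|a s IH] v /=; first by move->; apply: span0.
rewrite -foldr_eigshiftC => /IH.
(* By induction [(T - a) v] is a sum of generalized eigenvectors. Its components for eigenvalues
   other than [a] have preimages [w] under [T - a]; what is left of [v] is a generalized eigenvector
   for [a]. *)
suff key u : span [set x | exists b, geneig b x] u ->
    exists2 w, span [set x | exists b, geneig b x] w & geneig a (u - eigshift a w).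
  move=> /key[w w_span]; rewrite -(linB (eigshift_linear a)) => -[k kw].
  rewrite -[v](subrK w); apply: spanD => //; apply: sub_span; exists a.
  by exists k.+1; rewrite iterSr.
move: u; apply: (@span_min _ _ [set u | exists2 w, _ w & _]) => [|u [b bu]] /=.
  split=> [|c u v' [w1 sw1 e1] [w2 sw2 e2]].
    exists 0; first exact: span0.
    by rewrite sub0r (lin0 (eigshift_linear a)) oppr0; apply: subspace0 (geneig_subspace a).
  exists (c *: w1 + w2); first by apply: spanD => //; apply: spanZ.
  rewrite eigshift_linear opprD addrACA -scalerBr.
  exact: (geneig_subspace a).2.
have [ab|ab] := eqVneq a b.
  exists 0; first exact: span0.
  by rewrite (lin0 (eigshift_linear a)) subr0 ab.
have [w bw aw] := eigshift_surj ab bu.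
exists w; first by apply: sub_span; exists b.
by rewrite aw subrr; apply: subspace0 (geneig_subspace a).
Qed.

(** A power of [T - a] kills the first term and is injective on the generalized eigenspaces of the
    other terms, so the induction hypothesis applies to its image. *)
Lemma geneig_indep (r : seq K) (h : K -> V) : uniq r -> (forall a, geneig a (h a)) ->
  \sum_(a <- r) h a = 0 -> forall a, a \in r -> h a = 0.
Proof.
elim: r h => [//|a r IH] h /= /andP[ar ur] gh; rewrite big_cons => sum0.
have [k ka] := gh a.
have r0 b : b \in r -> h b = 0.
  move=> br; have ab : a != b by apply: contraNneq ar => ->.
  apply: (@iter_eigshift_inj k a b) => //.
  apply: (IH (fun b => iter k (eigshift a) (h b))) => //.
    by move=> c; apply: iter_geneig.
  rewrite -(lin_sum (iter_eigshift_linear k a)).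
  have /(congr1 (iter k (eigshift a))) := sum0.
  by rewrite (linD (iter_eigshift_linear k a)) ka add0r (lin0 (iter_eigshift_linear k a)).
move=> b; rewrite inE => /orP[/eqP -> |/r0 //].
by move: sum0; rewrite big_seq big1 ?addr0 // => c /r0.
Qed.

Lemma locally_finite_direct_sum : locally_finite -> direct_sum geneig.
Proof.
move=> lf; apply: direct_sumI; first exact: geneig_subspace.
  by move=> v; have [s] := lf v; apply: geneig_span.
exact: geneig_indep.
Qed.

Lemma direct_sum_locally_finite : direct_sum geneig -> locally_finite.
Proof.
move=> dT v; apply: (direct_sum_ind dT (P := [set v | exists s, foldr eigshift v s = 0])).
  split=> [|a u w [s su] [t tw]] /=; first by exists [::].
  exists (s ++ t); rewrite foldr_cat (foldr_eigshift_linear t) (foldr_eigshift_linear s) tw.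
  by rewrite foldr_eigshift_foldrC su !(lin0 (foldr_eigshift_linear _)) scaler0 addr0.
move=> a u [k ku]; exists (nseq k a); rewrite -[RHS]ku.
by elim: k {ku} => //= k ->.
Qed.
End GeneralizedEigenspaces.

(** * Submodules, quotients and products *)

Section Transfer.
Variables (R : realType) (V : voa R).
Local Notation C := R[i].
Local Notation vma W Y :=
  (@vertex_map_axioms R V (@voa_Y R V) (voa_vac V) (voa_omega V) (voa_c V) W Y).
Local Notation L0 Y := (virasoro_op (voa_omega V) Y 0).

Definition truncated (W : lmodType C) (Y : V -> int -> W -> W) : Prop :=
  forall (u : V) (w : W), exists N : int, forall n : int, N <= n -> Y u n w = 0.

Definition bilinear (W : lmodType C) (Y : V -> int -> W -> W) : Prop :=
  (forall u n, linear (Y u n)) /\ forall n w, linear (fun u => Y u n w).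

Lemma truncated_nat (W : lmodType C) (Y : V -> int -> W -> W) u w (n : int) :
  truncated Y -> exists k : nat, forall i : nat, (k <= i)%N -> Y u (n + i%:Z) w = 0.
Proof.
move=> /(_ u w)[N YN]; exists `|N - n|%N => i ki; apply: YN; lia.
Qed.

(** Linear maps commute with these finite sums, so in this form the identity can be transported
    along inclusions and quotient maps. *)
Definition jacobi_fin (W : lmodType C) (Y : V -> int -> W -> W) : Prop :=
  forall (u v : V) (w : W) (l m n : int), exists k0 : nat, forall k, (k0 <= k)%N ->
    (\sum_(i < k) ((-1) ^+ i * gbinom l%:~R i) *: Y u (m + l - i%:Z) (Y v (n + i%:Z) w))
    - (\sum_(i < k) ((-1) ^ l * (-1) ^+ i * gbinom l%:~R i) *:
          Y v (n + l - i%:Z) (Y u (m + i%:Z) w))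
    = \sum_(i < k) gbinom m%:~R i *: Y (voa_Y u (l + i%:Z) v) (m + n - i%:Z) w.

Lemma jacobi_finP (W : lmodType C) (Y : V -> int -> W -> W) :
  bilinear Y -> truncated Y -> jacobi_identity (@voa_Y R V) Y <-> jacobi_fin Y.
Proof.
move=> [Yr Yl] Yt; have Vt : truncated (@voa_Y R V) := vm_truncation (voa_vertex_map V).
have bound u v w (l m n : int) : exists k0 : nat, forall i, (k0 <= i)%N ->
   [/\ Y v (n + i%:Z) w = 0, Y u (m + i%:Z) w = 0 & voa_Y u (l + i%:Z) v = 0].
  have [k1 H1] := truncated_nat v w n Yt; have [k2 H2] := truncated_nat u w m Yt.
  have [k3 H3] := truncated_nat u v l Vt.
  by exists (k1 + k2 + k3)%N => i ki; split; [apply: H1|apply: H2|apply: H3]; lia.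
have conv u v w (l m n : int) (k0 : nat) : (forall i, (k0 <= i)%N ->
   [/\ Y v (n + i%:Z) w = 0, Y u (m + i%:Z) w = 0 & voa_Y u (l + i%:Z) v = 0]) ->
  [/\ \sum_(i \in [set: nat]) ((-1) ^+ i * gbinom l%:~R i) *: Y u (m + l - i%:Z) (Y v (n + i%:Z) w)
      = \sum_(i < k0) ((-1) ^+ i * gbinom l%:~R i) *: Y u (m + l - i%:Z) (Y v (n + i%:Z) w),
     \sum_(i \in [set: nat]) ((-1) ^ l * (-1) ^+ i * gbinom l%:~R i) *:
          Y v (n + l - i%:Z) (Y u (m + i%:Z) w)
      = \sum_(i < k0) ((-1) ^ l * (-1) ^+ i * gbinom l%:~R i) *:
          Y v (n + l - i%:Z) (Y u (m + i%:Z) w) &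
     \sum_(i \in [set: nat]) gbinom m%:~R i *: Y (voa_Y u (l + i%:Z) v) (m + n - i%:Z) w
      = \sum_(i < k0) gbinom m%:~R i *: Y (voa_Y u (l + i%:Z) v) (m + n - i%:Z) w].
  move=> H; split; apply: fsum_ord => i /H[e1 e2 e3].
  - by rewrite e1 (lin0 (Yr _ _)) scaler0.
  - by rewrite e2 (lin0 (Yr _ _)) scaler0.
  - by rewrite e3 (lin0 (Yl _ _)) scaler0.
split=> J u v w l m n; have [k0 H] := bound u v w l m n.
  exists k0 => k k0k; have H' i : (k <= i)%N -> _ := fun ki => H i (leq_trans k0k ki).
  by have [<- <- <-] := conv _ _ _ _ _ _ _ H'; apply: J.
have [k1 Jk] := J u v w l m n.
have H' i : (k0 + k1 <= i)%N -> _ := fun ki => H i (leq_trans (leq_addr _ _) ki).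
by have [-> -> ->] := conv _ _ _ _ _ _ _ H'; apply: Jk; apply: leq_addl.
Qed.

Lemma vma_bilinear (W : lmodType C) (Y : V -> int -> W -> W) : vma W Y -> bilinear Y.
Proof.
move=> H; split=> [u n a w z|n w a u v]; first exact: vm_linear_r H _ _ _ _ _.
exact: vm_linear_l H _ _ _ _ _.
Qed.

Lemma vma_jacobi (W : lmodType C) (Y : V -> int -> W -> W) : vma W Y -> jacobi_fin Y.
Proof.
move=> H; apply/jacobi_finP; [exact: vma_bilinear|exact: vm_truncation H|exact: vm_jacobi H].
Qed.

Section Injective.
Variables (W W1 W2 : lmodType C) (Y : V -> int -> W -> W).
Variables (Y1 : V -> int -> W1 -> W1) (Y2 : V -> int -> W2 -> W2).
Variables (f1 : W -> W1) (f2 : W -> W2).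
Hypotheses (f1_lin : linear f1) (f2_lin : linear f2).
Hypotheses (f1Y : forall u n w, f1 (Y u n w) = Y1 u n (f1 w))
  (f2Y : forall u n w, f2 (Y u n w) = Y2 u n (f2 w)).
Hypothesis f_inj : forall x y, f1 x = f1 y -> f2 x = f2 y -> x = y.
Hypotheses (H1 : vma W1 Y1) (H2 : vma W2 Y2).

Lemma joint_truncated : truncated Y.
Proof.
move=> u w; have [N1 t1] := vm_truncation H1 u (f1 w); have [N2 t2] := vm_truncation H2 u (f2 w).
exists (`|N1| + `|N2|)%R => n nN; apply: f_inj.
  by rewrite f1Y t1 ?(lin0 f1_lin) //; lia.
by rewrite f2Y t2 ?(lin0 f2_lin) //; lia.
Qed.

Lemma joint_bilinear : bilinear Y.
Proof.
have [[r1 l1] [r2 l2]] := (vma_bilinear H1, vma_bilinear H2).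
split=> [u n a w z|n w a u v]; apply: f_inj; rewrite ?(f1_lin, f2_lin) !(f1Y, f2Y).
- by rewrite f1_lin r1.
- by rewrite f2_lin r2.
- exact: l1.
- exact: l2.
Qed.

(** The axioms are equations, apart from truncation, so they can be tested after two jointly
    injective maps. Taking the inclusion twice gives submodules, and taking the two projections
    gives products. *)
Lemma joint_vma : vma W Y.
Proof.
split.
- by move=> a u v n w; apply: joint_bilinear.2.
- by move=> a u n w z; apply: joint_bilinear.1.
- exact: joint_truncated.
- move=> n w; apply: f_inj; rewrite ?(f1Y, f2Y).
    by rewrite (vm_vacuum H1); case: ifP; rewrite ?(lin0 f1_lin).
  by rewrite (vm_vacuum H2); case: ifP; rewrite ?(lin0 f2_lin).
- apply/(jacobi_finP joint_bilinear joint_truncated) => u v w l m n.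
  have [k1 J1] := vma_jacobi H1 u v (f1 w) l m n; have [k2 J2] := vma_jacobi H2 u v (f2 w) l m n.
  exists (k1 + k2)%N => k kk; apply: f_inj.
    rewrite (linB f1_lin) !(lin_sum f1_lin).
    under eq_bigr do rewrite (linZ f1_lin) !f1Y.
    under [X in _ - X]eq_bigr do rewrite (linZ f1_lin) !f1Y.
    under [RHS]eq_bigr do rewrite (linZ f1_lin) !f1Y.
    by apply: J1; lia.
  rewrite (linB f2_lin) !(lin_sum f2_lin).
  under eq_bigr do rewrite (linZ f2_lin) !f2Y.
  under [X in _ - X]eq_bigr do rewrite (linZ f2_lin) !f2Y.
  under [RHS]eq_bigr do rewrite (linZ f2_lin) !f2Y.
  by apply: J2; lia.
- move=> m n w; rewrite /virasoro_op; apply: f_inj.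
    have := vm_virasoro H1 m n (f1 w); rewrite /virasoro_op /=.
    rewrite (linB f1_lin) (linD f1_lin) !f1Y => ->.
    by rewrite (linZ f1_lin) f1Y; case: ifP; rewrite ?(linZ f1_lin) ?(lin0 f1_lin).
  have := vm_virasoro H2 m n (f2 w); rewrite /virasoro_op /=.
  rewrite (linB f2_lin) (linD f2_lin) !f2Y => ->.
  by rewrite (linZ f2_lin) f2Y; case: ifP; rewrite ?(linZ f2_lin) ?(lin0 f2_lin).
- move=> u n w; apply: f_inj.
    by rewrite (linZ f1_lin) !f1Y (vm_derivative H1).
  by rewrite (linZ f2_lin) !f2Y (vm_derivative H2).
Qed.

Lemma joint_locally_finite : locally_finite (L0 Y1) -> locally_finite (L0 Y2) ->
  locally_finite (L0 Y).
Proof.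
move=> lf1 lf2 w; have [[s1 e1] [s2 e2]] := (lf1 (f1 w), lf2 (f2 w)).
have lin1 : linear (L0 Y1) := (vma_bilinear H1).1 _ _.
have lin2 : linear (L0 Y2) := (vma_bilinear H2).1 _ _.
have g1 s x : f1 (foldr (eigshift (L0 Y)) x s) = foldr (eigshift (L0 Y1)) (f1 x) s.
  by elim: s => //= a s IH; rewrite /eigshift (linB f1_lin) (linZ f1_lin) f1Y -IH.
have g2 s x : f2 (foldr (eigshift (L0 Y)) x s) = foldr (eigshift (L0 Y2)) (f2 x) s.
  by elim: s => //= a s IH; rewrite /eigshift (linB f2_lin) (linZ f2_lin) f2Y -IH.
exists (s1 ++ s2); apply: f_inj.
  rewrite g1 foldr_cat foldr_eigshift_foldrC // e1 (lin0 f1_lin).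
  exact: (lin0 (foldr_eigshift_linear lin1 _)).
rewrite g2 foldr_cat e2 (lin0 f2_lin).
exact: (lin0 (foldr_eigshift_linear lin2 _)).
Qed.
End Injective.

Section Surjective.
Variables (W W' : lmodType C) (Y : V -> int -> W -> W) (Y' : V -> int -> W' -> W').
Variables (f : W -> W') (f_lin : linear f).
Hypothesis fY : forall u n w, f (Y u n w) = Y' u n (f w).
Hypothesis f_surj : forall y, exists x, f x = y.
Hypothesis H : vma W Y.

Lemma surj_truncated : truncated Y'.
Proof.
move=> u y; have [w <-] := f_surj y; have [N t] := vm_truncation H u w.
by exists N => n nN; rewrite -fY t ?(lin0 f_lin).
Qed.

Lemma surj_bilinear : bilinear Y'.
Proof.
have [r l] := vma_bilinear H.
split=> [u n a y z|n y a u v]; have [w <-] := f_surj y; last by rewrite -!fY l f_lin.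
by have [x <-] := f_surj z; rewrite -f_lin -!fY -f_lin r.
Qed.

Lemma surj_vma : vma W' Y'.
Proof.
split.
- by move=> a u v n w; apply: surj_bilinear.2.
- by move=> a u n w z; apply: surj_bilinear.1.
- exact: surj_truncated.
- move=> n y; have [w <-] := f_surj y; rewrite -fY (vm_vacuum H).
  by case: ifP; rewrite ?(lin0 f_lin).
- apply/(jacobi_finP surj_bilinear surj_truncated) => u v y l m n; have [w <-] := f_surj y.
  have [k1 J1] := vma_jacobi H u v w l m n.
  exists k1 => k kk; have /(congr1 f) := J1 k kk.
  rewrite (linB f_lin) !(lin_sum f_lin).
  under eq_bigr do rewrite (linZ f_lin) !fY.
  under [X in _ - X]eq_bigr do rewrite (linZ f_lin) !fY.
  by under [RHS]eq_bigr do rewrite (linZ f_lin) !fY.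
- move=> m n y; have [w <-] := f_surj y; rewrite /virasoro_op /=.
  have /(congr1 f) := vm_virasoro H m n w; rewrite /virasoro_op /=.
  rewrite (linB f_lin) (linD f_lin) !fY => ->.
  by rewrite (linZ f_lin) fY; case: ifP; rewrite ?(linZ f_lin) ?(lin0 f_lin).
- by move=> u n y; have [w <-] := f_surj y; rewrite -!fY (vm_derivative H) (linZ f_lin).
Qed.

Lemma surj_locally_finite : locally_finite (L0 Y) -> locally_finite (L0 Y').
Proof.
move=> lf y; have [w <-] := f_surj y; have [s e] := lf w; exists s.
suff <- : f (foldr (eigshift (L0 Y)) w s) = foldr (eigshift (L0 Y')) (f w) s.
  by rewrite e (lin0 f_lin).
by elim: s {e} => //= a s IH; rewrite /eigshift (linB f_lin) (linZ f_lin) fY -IH.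
Qed.
End Surjective.

(** The field [gm_L0] forces the grading to be the one by generalized eigenspaces of [L(0)], so
    local finiteness is all that has to be supplied. *)
Definition mk_module (W : lmodType C) (Y : V -> int -> W -> W) (H : vma W Y)
    (lf : locally_finite (L0 Y)) : gen_module V :=
  @GenModule R V W (geneig (L0 Y)) Y
    (locally_finite_direct_sum ((vma_bilinear H).1 _ _) lf) H
    (fun n w => iff_refl _).

Lemma gm_homogE (W : gen_module V) : @gm_homog R V W = geneig (@gm_L R V W 0).
Proof. by apply/funext => n; apply/seteqP; split=> w /gm_L0. Qed.

Lemma gm_bilinear (W : gen_module V) : bilinear (@gm_Y R V W).
Proof. exact: vma_bilinear (gm_vertex_map W). Qed.

Lemma gm_L0_linear (W : gen_module V) : linear (@gm_L R V W 0).
Proof. exact: (gm_bilinear W).1. Qed.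

Lemma gm_locally_finite (W : gen_module V) : locally_finite (@gm_L R V W 0).
Proof.
apply: direct_sum_locally_finite; first exact: gm_L0_linear.
by rewrite -gm_homogE; apply: gm_grading.
Qed.
End Transfer.

Section SubspaceType.
Variables (K : fieldType) (V : lmodType K) (G : set V).

(** Closure holds for any [G] since the carrier is a span, so the module structure needs no
    hypothesis; for a subspace the span is the set itself. *)
Definition span_type : Type := {x : V | x \in span_pred G}.

Fact span_submod_closed : submod_closed (span_pred G).
Proof.
split=> [|a u v /span_predP Gu /span_predP Gv]; first by apply/span_predP; apply: span0.
by apply/span_predP; apply: spanD => //; apply: spanZ.
Qed.

HB.instance Definition _ := SubType.on span_type.
HB.instance Definition _ := Choice.on span_type.
HB.instance Definition _ :=
  GRing.SubChoice_isSubLmodule.Build K V (span_pred G) span_type span_submod_closed.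

Definition span_val (x : span_type) : V := val x.

Lemma span_val_linear : linear span_val.
Proof. by move=> a u v; rewrite /span_val linearP. Qed.

Lemma span_val_inj : injective span_val.
Proof. exact: val_inj. Qed.

Lemma span_valP x : span G (span_val x).
Proof. by apply/span_predP; apply: (valP x). Qed.

Lemma span_val_surj v : span G v -> exists x, span_val x = v.
Proof. by move=> /span_predP Gv; exists (exist _ v Gv). Qed.
End SubspaceType.

Section Homs.
Variables (R : realType) (V : voa R).
Local Notation C := R[i].
Implicit Types W : gen_module V.

Lemma hom_linear W1 W2 (f : module_hom W1 W2) : linear f.
Proof. by case: (module_homP f). Qed.

Lemma homY W1 W2 (f : module_hom W1 W2) u n w : f (gm_Y u n w) = gm_Y u n (f w).
Proof. by case: (module_homP f) => _ ->. Qed.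

Lemma hom_ext W1 W2 (f g : module_hom W1 W2) : f =1 g -> f = g.
Proof. by move=> fg; apply/val_inj/funext. Qed.

Definition mk_hom W1 W2 (f : W1 -> W2) (fm : module_map f) : module_hom W1 W2 :=
  ModuleHom (asboolT fm : f \in @module_map_pred R V W1 W2).

Definition gmpr W (n : C) : W -> W := dproj (gm_grading W) n.

Lemma gmpr_linear W n : linear (@gmpr W n).
Proof. exact: dproj_linear. Qed.

Lemma gmpr_in W n w : gm_homog n (@gmpr W n w).
Proof. exact: dproj_in. Qed.

Lemma gmprE W m n w : gm_homog m w -> @gmpr W n w = if n == m then w else 0.
Proof. exact: dprojE. Qed.

Lemma gmpr_id W n w : gm_homog n w -> @gmpr W n w = w.
Proof. by move/gmprE->; rewrite eqxx. Qed.

Lemma gmpr_seq W (w : W) : exists r, [/\ uniq r, forall n, n \notin r -> gmpr n w = 0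
  & w = \sum_(n <- r) gmpr n w].
Proof. exact: dproj_seq. Qed.

Lemma gm_homog_subspace W n : subspace (@gm_homog R V W n).
Proof. exact: (gm_grading W).1. Qed.

Lemma gm_ind W (P : set W) : subspace P -> (forall n w, gm_homog n w -> P w) ->
  forall w, P w.
Proof. exact: (direct_sum_ind (gm_grading W)). Qed.

Lemma hom_homog W1 W2 (f : module_hom W1 W2) n w : gm_homog n w -> gm_homog n (f w).
Proof.
rewrite !gm_homogE => -[k kw]; exists k; rewrite -[RHS](lin0 (hom_linear f)) -kw.
elim: k {kw} => //= k ->; rewrite /eigshift (linB (hom_linear f)) (linZ (hom_linear f)).
by rewrite homY.
Qed.

Lemma hom_gmpr W1 W2 (f : module_hom W1 W2) n w : f (gmpr n w) = gmpr n (f w).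
Proof.
have fl := hom_linear f.
apply: (@gm_ind W1 [set w | f (gmpr n w) = gmpr n (f w)]) => [|m x xm /=].
  split=> [|a u v /= uE vE] /=; first by rewrite !(lin0 (gmpr_linear _), lin0 fl).
  by rewrite (gmpr_linear n) !fl uE vE (gmpr_linear n).
rewrite (gmprE _ xm) (gmprE _ (hom_homog f xm)).
by case: eqP => // _; rewrite (lin0 fl).
Qed.

Section Submodule.
Variables (W : gen_module V) (S : set W) (S_sub : gen_submodule S).

Fact sub_Y_proof u n (x : span_type S) : gm_Y u n (val x) \in span_pred S.
Proof.
apply/span_predP; apply: sub_span; apply: S_sub.2.
exact: (span_min S_sub.1 (@subset_refl _ S)) (span_valP x).
Qed.

Definition sub_Y (u : V) (n : int) (x : span_type S) : span_type S :=
  exist _ (gm_Y u n (val x)) (sub_Y_proof u n x).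

Definition sub_module : gen_module V :=
  mk_module (@joint_vma R V (span_type S) W W sub_Y _ _ _ _
      (@span_val_linear _ _ S) (@span_val_linear _ _ S)
      (fun _ _ _ => erefl) (fun _ _ _ => erefl)
      (fun x y e _ => @span_val_inj _ _ S x y e) (gm_vertex_map W) (gm_vertex_map W))
    (@joint_locally_finite R V (span_type S) W W sub_Y _ _ _ _
      (@span_val_linear _ _ S) (@span_val_linear _ _ S)
      (fun _ _ _ => erefl) (fun _ _ _ => erefl)
      (fun x y e _ => @span_val_inj _ _ S x y e) (gm_vertex_map W) (gm_vertex_map W)
      (@gm_locally_finite R V W) (@gm_locally_finite R V W)).

Fact sub_incl_map : module_map (@span_val _ _ S : sub_module -> W).
Proof. by []. Qed.

Definition sub_incl : module_hom sub_module W := mk_hom sub_incl_map.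

Lemma sub_incl_inj : injective sub_incl.
Proof. exact: span_val_inj. Qed.

Lemma sub_incl_in x : S (sub_incl x).
Proof. exact: (span_min S_sub.1 (@subset_refl _ S)) (span_valP x). Qed.

Lemma sub_incl_surj w : S w -> exists x, sub_incl x = w.
Proof. by move=> Sw; apply: span_val_surj; apply: sub_span. Qed.

Lemma gmpr_sub n w : S w -> S (gmpr n w).
Proof.
by move=> /sub_incl_surj[x <-]; rewrite -hom_gmpr; apply: sub_incl_in.
Qed.
End Submodule.

Section QuotientModule.
Variables (W : gen_module V) (S : set W) (S_sub : gen_submodule S).
Local Notation Q := (quot_span S).
Local Open Scope quotient_scope.

Definition quo_pi (w : W) : Q := \pi_Q w.

Definition quo_Y (u : V) (n : int) (x : Q) : Q := quo_pi (gm_Y u n (repr x)).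

Lemma quo_pi_eq0 w : quo_pi w = 0 <-> S w.
Proof.
have pi0 : \pi_Q 0 = 0.
  by have := quot_piD S 0 0; rewrite addr0 => /esym/eqP; rewrite -subr_eq0 addrK => /eqP.
split=> [w0|Sw].
  apply: (span_min S_sub.1 (@subset_refl _ S)).
  by have := (quot_eq S w 0).1; rewrite subr0 pi0; apply.
by rewrite -pi0; apply/quot_eq; rewrite subr0; apply: sub_span.
Qed.

Lemma quo_pi_linear : linear quo_pi.
Proof. by move=> a u v; rewrite /quo_pi quot_piD -quot_scaleE. Qed.

Lemma quo_pi_surj x : exists w, quo_pi w = x.
Proof. by exists (repr x); rewrite /quo_pi reprK. Qed.

Lemma quo_piY u n w : quo_pi (gm_Y u n w) = quo_Y u n (quo_pi w).
Proof.
apply/eqP; rewrite -subr_eq0; apply/eqP.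
rewrite /quo_Y -(linB quo_pi_linear); apply/quo_pi_eq0.
rewrite -(linB ((gm_bilinear W).1 _ _)); apply: S_sub.2; apply/quo_pi_eq0.
by rewrite (linB quo_pi_linear) {2}/quo_pi reprK subrr.
Qed.

Definition quo_module : gen_module V :=
  mk_module (surj_vma quo_pi_linear quo_piY quo_pi_surj (gm_vertex_map W))
    (surj_locally_finite quo_pi_linear quo_piY quo_pi_surj (@gm_locally_finite R V W)).

Fact quo_proj_map : module_map (quo_pi : W -> quo_module).
Proof. by split; [apply: quo_pi_linear|apply: quo_piY]. Qed.

Definition quo_proj : module_hom W quo_module := mk_hom quo_proj_map.

Lemma quo_proj_surj : surjective_hom quo_proj.
Proof. exact: quo_pi_surj. Qed.

Lemma quo_proj_eq0 w : quo_proj w = 0 <-> S w.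
Proof. exact: quo_pi_eq0. Qed.
End QuotientModule.

Section ProductModule.
Variables (W1 W2 : gen_module V).

Definition prod_Y (u : V) (n : int) (x : W1 * W2) : W1 * W2 :=
  (gm_Y u n x.1, gm_Y u n x.2).

Fact fst_linear : linear (fst : W1 * W2 -> W1). Proof. by []. Qed.
Fact snd_linear : linear (snd : W1 * W2 -> W2). Proof. by []. Qed.

Fact pair_inj (x y : W1 * W2) : x.1 = y.1 -> x.2 = y.2 -> x = y.
Proof. by case: x y => [a b] [c d] /= -> ->. Qed.

Definition prod_module : gen_module V :=
  mk_module (@joint_vma R V (W1 * W2)%type W1 W2 prod_Y _ _ _ _ fst_linear snd_linear
      (fun _ _ _ => erefl) (fun _ _ _ => erefl) pair_inj
      (gm_vertex_map W1) (gm_vertex_map W2))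
    (@joint_locally_finite R V (W1 * W2)%type W1 W2 prod_Y _ _ _ _ fst_linear snd_linear
      (fun _ _ _ => erefl) (fun _ _ _ => erefl) pair_inj
      (gm_vertex_map W1) (gm_vertex_map W2)
      (@gm_locally_finite R V W1) (@gm_locally_finite R V W2)).

Definition prod_fst : module_hom prod_module W1 :=
  @mk_hom prod_module W1 fst (conj fst_linear (fun _ _ _ => erefl)).

Definition prod_snd : module_hom prod_module W2 :=
  @mk_hom prod_module W2 snd (conj snd_linear (fun _ _ _ => erefl)).

Fact prod_inl_map : module_map ((fun x => (x, 0)) : W1 -> prod_module).
Proof.
split=> [a x y|u n x]; apply: pair_inj => //=; first by rewrite scaler0 addr0.
by rewrite gm_Y0.
Qed.

Fact prod_inr_map : module_map ((fun x => (0, x)) : W2 -> prod_module).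
Proof.
split=> [a x y|u n x]; apply: pair_inj => //=; first by rewrite scaler0 addr0.
by rewrite gm_Y0.
Qed.

Definition prod_inl : module_hom W1 prod_module := mk_hom prod_inl_map.
Definition prod_inr : module_hom W2 prod_module := mk_hom prod_inr_map.
End ProductModule.

Definition zero_space : lmodType C := 'rV[C]_0.

Lemma zero_space_eq (x y : zero_space) : x = y.
Proof. by rewrite [x]thinmx0 [y]thinmx0. Qed.

Fact zero_vma : @vertex_map_axioms R V (@voa_Y R V) (voa_vac V) (voa_omega V) (voa_c V)
  zero_space (fun _ _ x => x).
Proof.
by split; rewrite /jacobi_identity /=; intros; do ?exact: zero_space_eq; exists 0; intros;
  exact: zero_space_eq.
Qed.

Fact zero_locally_finite :
  locally_finite (@virasoro_op R V (voa_omega V) zero_space (fun _ _ x => x) 0).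
Proof. by move=> v; exists [::]; apply: zero_space_eq. Qed.

Definition zero_module : gen_module V := mk_module zero_vma zero_locally_finite.

Lemma zero_module_eq (x y : zero_module) : x = y.
Proof. exact: zero_space_eq. Qed.

(** Linearity reduces single-valuedness to the fibre over 0. Inverses, factorizations and maps given
    by their graph are all obtained in this way, without computing with chosen preimages. *)
Lemma hom_of_rel W1 W2 (r : W1 -> W2 -> Prop) :
  (forall x, exists y, r x y) -> (forall y, r 0 y -> y = 0) ->
  (forall a x y z t, r x z -> r y t -> r (a *: x + y) (a *: z + t)) ->
  (forall u n x y, r x y -> r (gm_Y u n x) (gm_Y u n y)) ->
  exists f : module_hom W1 W2, forall x, r x (f x).
Proof.
move=> r_tot r0 r_lin rY; have [f fr] := choice r_tot.
have fE x y : r x y -> f x = y.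
  move=> xy; apply/eqP; rewrite -subr_eq0; apply/eqP/r0.
  have := r_lin (-1) x x y (f x) xy (fr x).
  by rewrite !scaleN1r addNr addrC.
have fm : module_map f.
  by split=> [a x y|u n x]; apply: fE; [apply: r_lin|apply: rY].
by exists (mk_hom fm).
Qed.

Lemma gen_submodule_ker W1 W2 (f : module_hom W1 W2) : gen_submodule [set x | f x = 0].
Proof.
split=> [|u n w /= w0]; first exact: subspace_ker (hom_linear f).
by rewrite homY w0 gm_Y0.
Qed.

Lemma gen_submodule_img W1 W2 (f : module_hom W1 W2) (S : set W1) :
  gen_submodule S -> gen_submodule (f @` S).
Proof.
move=> S_sub; split; first exact: subspace_img (hom_linear f) _ S_sub.1.
by move=> u n _ [x Sx <-]; exists (gm_Y u n x); [apply: S_sub.2|rewrite homY].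
Qed.

Lemma gen_submodule_preim W1 W2 (f : module_hom W1 W2) (S : set W2) :
  gen_submodule S -> gen_submodule (f @^-1` S).
Proof.
move=> S_sub; split; first exact: subspace_preim (hom_linear f) _ S_sub.1.
by move=> u n x; rewrite /preimage /= homY; apply: S_sub.2.
Qed.

Lemma gen_submoduleI W (S S' : set W) :
  gen_submodule S -> gen_submodule S' -> gen_submodule (S `&` S').
Proof.
move=> [S1 SY] [S2 SY']; split; first exact: subspaceI.
by move=> u n w [w1 w2]; split; [apply: SY|apply: SY'].
Qed.

Lemma gen_submoduleT W : gen_submodule [set: W]. Proof. by split. Qed.

Lemma gen_submodule0 W : gen_submodule [set 0 : W].
Proof. by split=> [|u n w /= ->]; [apply: subspace_set0|apply: gm_Y0]. Qed.

Lemma hom_inj W1 W2 (f : module_hom W1 W2) :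
  (forall x, f x = 0 -> x = 0) -> injective f.
Proof.
move=> f0 x y fxy; apply/eqP; rewrite -subr_eq0; apply/eqP/f0.
by rewrite (linB (hom_linear f)) fxy subrr.
Qed.

Lemma bij_equivalent W1 W2 (f : module_hom W1 W2) :
  injective f -> surjective_hom f -> equivalent_modules W1 W2.
Proof.
move=> f_inj f_surj.
have [||||g gf] := @hom_of_rel W2 W1 (fun y x => f x = y).
- exact: f_surj.
- by move=> y; rewrite -(lin0 (hom_linear f)) => /f_inj.
- by move=> a x y z t <- <-; apply: hom_linear.
- by move=> u n x y <-; apply: homY.
by exists f, g; split=> x //; apply: f_inj; rewrite gf.
Qed.

Lemma equivalent_sym W1 W2 : equivalent_modules W1 W2 -> equivalent_modules W2 W1.
Proof. by move=> [f [g [fg gf]]]; exists g, f. Qed.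

Lemma equivalent_homog W1 W2 n : equivalent_modules W1 W2 ->
  @gm_homog R V W1 n = [set 0] -> @gm_homog R V W2 n = [set 0].
Proof.
move=> [f [g [fg gf]]] W10; apply/seteqP; split=> [x xn|_ ->].
  have : gm_homog n (g x) by apply: hom_homog.
  rewrite W10 => /= gx0; rewrite /set1 /= -[LHS]gf gx0.
  exact: lin0 (hom_linear f).
exact: subspace0 (gm_homog_subspace _ _).
Qed.
End Homs.

(** * Modes and cyclic submodules *)

Section Modes.
Variables (R : realType) (V : voa R).
Local Notation C := R[i].
Implicit Types (W : gen_module V) (u v : V) (q m n l j : int).

Lemma voa_bilinear : bilinear (@voa_Y R V).
Proof. exact: vma_bilinear (voa_vertex_map V). Qed.

Lemma gbinom0 (a : C) : gbinom a 0 = 1.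
Proof. by rewrite /gbinom big_ord0 divr1. Qed.

Lemma gbinom_small (p k : nat) : (p < k)%N -> gbinom (p%:R : C) k = 0.
Proof. by move=> pk; rewrite /gbinom (bigD1 (Ordinal pk)) //= subrr mul0r mul0r. Qed.

Lemma gbinom1 : gbinom (1 : C) 1 = 1.
Proof. by rewrite /gbinom big_ord_recl big_ord0 subr0 mulr1 divr1. Qed.

(** The case [l = 0] of the Jacobi identity: the binomial coefficients of 0 leave only the terms
    [i = 0] on the left. *)
Lemma gm_commutator W u v m n (w : W) : exists k0 : nat, forall k, (k0 <= k)%N ->
  gm_Y u m (gm_Y v n w) - gm_Y v n (gm_Y u m w) =
  \sum_(i < k) gbinom m%:~R i *: gm_Y (voa_Y u i%:Z v) (m + n - i%:Z) w.
Proof.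
have [k0 J] := vma_jacobi (gm_vertex_map W) u v w 0 m n.
exists k0.+1 => -[//|k] kk0; have := J k.+1 (ltnW kk0).
under [RHS]eq_bigr do rewrite add0r.
have e1 (x : int) : x + 0 - 0%N%:Z = x by lia.
have e2 (x : int) : x + 0%N%:Z = x by lia.
move=> <-; rewrite !big_ord_recl /= !gbinom0 !mulr1 !scale1r !e1 !e2.
by rewrite !big1 ?addr0 // => i _; rewrite (@gbinom_small 0) ?mulr0 ?scale0r.
Qed.

(** In the commutator formula for [omega_1] only [i = 0, 1] survive. They give
    [(L(-1) u)_(m+1) = - (m + 1) u_m] and [(L(0) u)_m = q u_m]. *)
Lemma gm_L0_mode W q u m (w : W) : voa_homog q u ->
  gm_L 0 (gm_Y u m w) - gm_Y u m (gm_L 0 w) = (q - m - 1)%:~R *: gm_Y u m w.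
Proof.
move=> uq; rewrite /gm_L /virasoro_op add0r.
have [k0 J] := gm_commutator (voa_omega V) u 1 m w.
rewrite (J k0.+2) ?leqW // !big_ord_recl /= gbinom0 gbinom1 !scale1r.
rewrite big1 => [|i _]; last by rewrite (@gbinom_small 1) ?scale0r.
have -> : 1 + m - 0%N%:Z = 1 + m by lia.
have -> : 1 + m - (bump 0 0)%:Z = m by rewrite /bump; lia.
have -> : voa_Y (voa_omega V) (bump 0 0)%:Z u = q%:~R *: u by rewrite -(voa_L0 uq).
have := vm_derivative (gm_vertex_map W) u (1 + m) w.
rewrite /virasoro_op addNr => ->.
have -> : 1 + m - 1 = m by lia.
rewrite (linZ ((gm_bilinear W).2 _ _)) addr0 -scalerDl -intrN -intrD; congr (_%:~R *: _).
lia.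
Qed.
End Modes.

Section Cyclic.
Variables (R : realType) (V : voa R).
Local Notation C := R[i].
Implicit Types (W : gen_module V) (u v : V) (q m n j : int) (s : C).

Lemma gm_Y_homog W q u m s (w : W) : voa_homog q u -> gm_homog s w ->
  gm_homog (s + (q - m - 1)%:~R) (gm_Y u m w).
Proof.
rewrite !gm_homogE => uq [k kw]; exists k.
have shift (x : W) : eigshift (gm_L 0) (s + (q - m - 1)%:~R) (gm_Y u m x) =
    gm_Y u m (eigshift (gm_L 0) s x).
  rewrite /eigshift (linB ((gm_bilinear W).1 _ _)) (linZ ((gm_bilinear W).1 _ _)).
  rewrite scalerDl -(gm_L0_mode m x uq) opprD opprB.
  by rewrite addrCA [X in _ + X = _]addrC subrK addrC.
rewrite -[RHS](gm_Y0 W u m) -kw.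
by elim: k {kw} => //= k ->; rewrite shift.
Qed.

(** The letter [(g, q, j)] stands for the mode of [g], of weight [q], that raises
    weights by [j]. *)
Definition letter : Type := (V * int * int)%type.

Definition lok (a : letter) : Prop := voa_homog a.1.2 a.1.1.

Definition lact W (a : letter) (x : W) : W := gm_Y a.1.1 (a.1.2 - 1 - a.2) x.

Lemma lact_linear W a : linear (@lact W a).
Proof. exact: (gm_bilinear W).1. Qed.

Lemma lact_hom W1 W2 (f : module_hom W1 W2) a x : f (lact a x) = lact a (f x).
Proof. exact: homY. Qed.

Lemma lact_homog W a s (x : W) : lok a -> gm_homog s x ->
  gm_homog (s + a.2%:~R) (lact a x).
Proof.
move=> ok sx; have := gm_Y_homog (a.1.2 - 1 - a.2) ok sx.
by congr (gm_homog (_ + _%:~R) _); lia.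
Qed.

(** Single modes suffice: by [cyclic_assoc] this span is already the submodule generated by [w]. *)
Definition cyclic_set W (w : W) : set W := span [set x | exists u m, x = gm_Y u m w].

Lemma cyclic_mem W (w : W) : cyclic_set w w.
Proof.
apply: sub_span; exists (voa_vac V), (-1).
by rewrite (vm_vacuum (gm_vertex_map W)) eqxx.
Qed.

Lemma cyclic_min W (S : set W) (w : W) : gen_submodule S -> S w -> cyclic_set w `<=` S.
Proof. by move=> S_sub Sw; apply: (span_min S_sub.1) => _ [u [m ->]]; apply: S_sub.2. Qed.

(* Solving the Jacobi identity, with m large enough to kill its second sum, for
   its leading term writes u_p v_q w through the u_(p-i) v_(q+i) w with i > 0. *)
Lemma cyclic_assoc W u v p q (w : W) : cyclic_set w (gm_Y u p (gm_Y v q w)).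
Proof.
have [M HM] := vm_truncation (gm_vertex_map W) u w.
have [N HN] := vm_truncation (gm_vertex_map W) v w.
suff H (d : nat) p' q' : (N <= q' + d%:Z) -> cyclic_set w (gm_Y u p' (gm_Y v q' w)).
  by apply: (H `|N - q|%N); lia.
elim/ltn_ind: d p' q' => d IH p' q' Nd.
have [k0 J] := vma_jacobi (gm_vertex_map W) u v w (p' - M) M q'.
have := J k0.+1 (leqnSn _).
rewrite [X in _ - X]big1 => [|i _]; last first.
  by rewrite (HM (M + _)) ?gm_Y0 ?scaler0 //; lia.
rewrite subr0 big_ord_recl /= gbinom0 mulr1 scale1r.
have -> : M + (p' - M) - 0%N%:Z = p' by lia.
have -> : q' + 0%N%:Z = q' by lia.
move=> /(canRL (addrK _)) ->.
apply: spanB.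
  apply: span_sum => i _; apply: spanZ; apply: sub_span.
  by do 2 eexists; reflexivity.
apply: span_sum => i _; apply: spanZ.
have [d0|d_gt0] := posnP d.
  rewrite (HN (q' + _)) ?gm_Y0; first exact: span0.
  by rewrite /bump; lia.
apply: (IH d.-1); first by rewrite prednK.
by rewrite /bump; lia.
Qed.

Lemma cyclic_submodule W (w : W) : gen_submodule (cyclic_set w).
Proof.
split=> [|u n]; first exact: span_subspace.
apply: (span_min (subspace_preim ((gm_bilinear W).1 u n) (span_subspace _))).
by move=> _ [v [m ->]]; apply: cyclic_assoc.
Qed.

Lemma cyclicP W (w x : W) : cyclic_set w x <->
  exists l : seq letter, (forall a, a \in l -> lok a) /\ x = \sum_(a <- l) lact a w.
Proof.
split; last first.
  move=> [l [_ ->]]; apply: span_sum => a _; apply: sub_span.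
  by do 2 eexists; reflexivity.
pose P := [set x | exists l : seq letter,
  (forall a, a \in l -> lok a) /\ x = \sum_(a <- l) lact a w].
have P_sub : subspace P.
  split=> [|b y z [l1 [ok1 ->]] [l2 [ok2 ->]]]; first by exists [::]; rewrite big_nil.
  exists ([seq (b *: a.1.1, a.1.2, a.2) | a <- l1] ++ l2); split=> [a|].
    rewrite mem_cat => /orP[/mapP[c /ok1 okc ->]|/ok2 //].
    exact: (subspaceZ ((voa_grading V).1 _)).
  rewrite big_cat big_map /= scaler_sumr; congr (_ + _); apply: eq_bigr => a _.
  by rewrite /lact (linZ ((gm_bilinear W).2 _ _)).
move: x; apply: (span_min P_sub) => _ [u [m ->]].
apply: (direct_sum_ind (voa_grading V) (P := [set u | P (gm_Y u m w)])).
  exact: (subspace_preim ((gm_bilinear W).2 _ _) P_sub).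
move=> q v vq; exists [:: (v, q, q - 1 - m)]; split=> [a|].
  by rewrite inE => /eqP ->.
by rewrite big_seq1 /lact /=; congr gm_Y; lia.
Qed.

Definition generates W (w : W) : Prop := forall x, cyclic_set w x.

Lemma gmpr_lact_sum W s j (w : W) (l : seq letter) : (forall a, a \in l -> lok a) ->
  gm_homog s w -> gmpr (s + j%:~R) (\sum_(a <- l) lact a w) =
  \sum_(a <- l | a.2 == j) lact a w.
Proof.
move=> ok sw; rewrite (lin_sum (gmpr_linear _)) [RHS]big_mkcond.
apply: eq_big_seq => a /ok oka; rewrite (gmprE _ (lact_homog oka sw)).
by rewrite (inj_eq (addrI s)) eqr_int eq_sym.
Qed.

Lemma cyclic_weight W s t (w x : W) : gm_homog s w -> cyclic_set w x ->
  gmpr t x != 0 -> exists j, t = s + j%:~R.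
Proof.
move=> sw /cyclicP[l [ok ->]]; rewrite (lin_sum (gmpr_linear _)).
apply: contra_neqP => /forallNP no; rewrite big_seq big1 // => a /ok oka.
by rewrite (gmprE _ (lact_homog oka sw)); case: eqP => // /no.
Qed.

Lemma cyclic_hom W1 W2 (f : module_hom W1 W2) w x : cyclic_set w x ->
  cyclic_set (f w) (f x).
Proof.
move=> wx; apply: (span_img (hom_linear f) (G := [set x | exists u m, x = gm_Y u m w])).
  by move=> _ [_ [u [m ->]] <-]; exists u, m; rewrite homY.
by exists x.
Qed.

Lemma generates_surj W1 W2 (f : module_hom W1 W2) w : generates (f w) -> surjective_hom f.
Proof.
move=> gen y; have := gen y.
move/(cyclic_min (gen_submodule_img f (gen_submoduleT W1))) => [|x _ <-].
  by exists w.
by exists x.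
Qed.

Lemma generates_hom_ext W1 W2 (f g : module_hom W1 W2) w : generates w -> f w = g w ->
  f = g.
Proof.
move=> gen fgw; apply: hom_ext => x; move: x (gen x).
apply: (@cyclic_min _ [set x | f x = g x]) => //; split=> [|u n y /= yE].
  split=> [|a y z /= yE zE]; first by rewrite /= !(lin0 (hom_linear _)).
  by rewrite /= !(hom_linear _ a) yE zE.
by rewrite /= !homY yE.
Qed.

Lemma irreducible_generates W (w : W) : irreducible_module W -> w != 0 -> generates w.
Proof.
move=> [_ irr] w0 x; have [W0|->//] := irr _ (cyclic_submodule w).
by have := @cyclic_mem W w; rewrite W0 /= => /eqP; rewrite (negPf w0).
Qed.

Lemma Schur W1 W2 (f : module_hom W1 W2) x : irreducible_module W1 -> irreducible_module W2 ->
  f x != 0 -> injective f /\ surjective_hom f.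
Proof.
move=> [_ irr1] irr2 fx0; split; last first.
  exact: (generates_surj (irreducible_generates irr2 fx0)).
apply: hom_inj => y fy0; have [K0|KT] := irr1 _ (gen_submodule_ker f).
  by have : [set z | f z = 0] y by []; rewrite K0.
have : [set z | f z = 0] x by rewrite KT.
by move=> /= /eqP; rewrite (negPf fx0).
Qed.

(** Commuting [L(0)] with a homogeneous mode gives a scalar multiple of that mode, so the
    eigenvectors of [L(0)] span a submodule. It is nonzero, hence everything. Through this lemma the
    hypothesis on ordinary modules reaches every irreducible grading-restricted module. *)
Lemma irreducible_L0 W s (w : W) : irreducible_module W -> gm_homog s w ->
  gm_L 0 w = s *: w.
Proof.
move=> irr sw; pose P := span [set x : W | exists t, gm_L 0 x = t *: x].
have P_sub : gen_submodule P.
  split=> [|u n]; first exact: span_subspace.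
  apply: (span_min (subspace_preim ((gm_bilinear W).1 u n) (span_subspace _))).
  move=> x [t xt] /=.
  apply: (direct_sum_ind (voa_grading V) (P := [set u | P (gm_Y u n x)])).
    exact: (subspace_preim ((gm_bilinear W).2 _ _) (span_subspace _)).
  move=> q v vq; apply: sub_span; exists (t + (q - n - 1)%:~R).
  rewrite scalerDl -(gm_L0_mode n x vq) xt (linZ ((gm_bilinear W).1 _ _)).
  by rewrite addrC subrK.
have eig_homog t (x : W) : gm_L 0 x = t *: x -> gm_homog t x.
  by move=> xt; rewrite gm_homogE; exists 1%N; rewrite /= /eigshift xt subrr.
have PT : P = [set: W].
  have [P0|//] := irr.2 _ P_sub.
  have [x x0] := irr.1.
  have [r [_ _ xE]] := gmpr_seq x.
  have /existsNP[t /eqP t0] : ~ forall t, gmpr t x = 0.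
    by move=> all0; move: x0; rewrite xE big1 ?eqxx.
  have := gmpr_in t x; rewrite gm_homogE => -[k]; move: t0.
  (* Applying [L(0) - t] as long as the result stays nonzero ends at an eigenvector. *)
  elim: k (gmpr t x) => [y /eqP y0 /= y00 //|k IH y y0].
  have [e0|e0] := eqVneq (eigshift (gm_L 0) t y) 0; last by rewrite iterSr; apply: IH.
  move=> _; have : P y.
    by apply: sub_span; exists t; apply/eqP; rewrite -subr_eq0; apply/eqP.
  by rewrite P0 /= => y00; move: y0; rewrite y00 eqxx.
suff H x : P x -> gm_L 0 (gmpr s x) = s *: gmpr s x.
  by have := H w; rewrite (gmpr_id sw); apply; rewrite PT.
move: x; apply: (@span_min _ _ [set x | gm_L 0 (gmpr s x) = s *: gmpr s x]).
  split=> [|a x y /= xE yE] /=.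
    by rewrite !(lin0 (gmpr_linear s)) (lin0 (@gm_L0_linear R V W)) scaler0.
  by rewrite (gmpr_linear s) (@gm_L0_linear R V W) xE yE scalerDr !scalerA mulrC.
move=> x [t xt] /=; rewrite (gmprE s (eig_homog _ _ xt)).
by case: eqP => [->//|_]; rewrite (lin0 (@gm_L0_linear R V W)) scaler0.
Qed.

Lemma irreducible_ordinary W : irreducible_module W -> grading_restricted W ->
  ordinary_module W.
Proof.
move=> irr gr; split=> //.
rewrite /L0_semisimple (_ : (fun n : C => _) = @gm_homog R V W); first exact: gm_grading.
apply/funext => s; apply/seteqP; split=> w /=; last exact: irreducible_L0.
by move=> ws; rewrite gm_homogE; exists 1%N; rewrite /= /eigshift ws subrr.
Qed.
End Cyclic.

(** * The action of Zhu's algebras *)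

Section Adjoint.
Variables (R : realType) (V : voa R).
Local Notation C := R[i].
Implicit Types (W : gen_module V) (u v : V) (p q m : int) (s : C) (N : nat).

Lemma voa_homog_subspace q : subspace (@voa_homog R V q).
Proof. exact: (voa_grading V).1. Qed.

Fact adjoint_locally_finite : locally_finite (virasoro_op (voa_omega V) (@voa_Y R V) 0).
Proof.
have L_lin : linear (virasoro_op (voa_omega V) (@voa_Y R V) 0) := (voa_bilinear V).1 _ _.
apply: (direct_sum_ind (voa_grading V) (P := [set v | exists l, foldr (eigshift _) v l = 0])).
  split=> [|a u w [s su] [t tw]] /=; first by exists [::].
  exists (s ++ t); rewrite foldr_cat (foldr_eigshift_linear L_lin t).
  rewrite (foldr_eigshift_linear L_lin s) tw foldr_eigshift_foldrC // su.
  by rewrite !(lin0 (foldr_eigshift_linear L_lin _)) scaler0 addr0.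
by move=> q u uq; exists [:: q%:~R]; rewrite /= /eigshift (voa_L0 uq) subrr.
Qed.

Definition adjoint_module : gen_module V :=
  mk_module (voa_vertex_map V) adjoint_locally_finite.

Lemma voa_L_linear m : linear (@voa_L R V m).
Proof. exact: (voa_bilinear V).1. Qed.

(** The record [voa] states only the converse. Projecting the equation to weight [p] gives
    [(q - p) v_p = 0], and integers are distinct in characteristic 0. *)
Lemma voa_homog_eig q v : voa_L 0 v = q%:~R *: v -> voa_homog q v.
Proof.
move=> vq; have prL p u : dproj (voa_grading V) p (voa_L 0 u) =
    p%:~R *: dproj (voa_grading V) p u.
  have pl := dproj_linear (voa_grading V) p.
  apply: (direct_sum_ind (voa_grading V) (P := [set u |
    dproj (voa_grading V) p (voa_L 0 u) = p%:~R *: dproj (voa_grading V) p u])).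
    split=> [|a x y xE yE] /=.
      by rewrite (lin0 (voa_L_linear 0)) !(lin0 pl) scaler0.
    by rewrite /= (voa_L_linear 0) !pl xE yE scalerDr !scalerA mulrC.
  move=> r x xr /=; rewrite [voa_L 0 x](voa_L0 xr) (linZ pl) (dprojE _ _ xr).
  by case: eqP => [->//|_]; rewrite !scaler0.
have [r [_ _ vE]] := dproj_seq (voa_grading V) v.
rewrite vE; apply: (subspace_sum (voa_homog_subspace q)) => p _.
have [<-|pq] := eqVneq p q; first exact: dproj_in.
suff -> : dproj (voa_grading V) p v = 0 by apply: (subspace0 (voa_homog_subspace q)).
have /eqP := prL p v; rewrite vq (linZ (dproj_linear _ p)) -subr_eq0 -scalerBl scaler_eq0.
by rewrite -intrB intr_eq0 subr_eq0 eq_sym (negPf pq) => /eqP.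
Qed.

Lemma voa_Y_homog p q m u v : voa_homog p u -> voa_homog q v ->
  voa_homog (p + q - m - 1) (voa_Y u m v).
Proof.
move=> up vq; apply: voa_homog_eig.
have := @gm_L0_mode R V adjoint_module p u m v up.
rewrite -[LHS]/(voa_L 0 (voa_Y u m v) - voa_Y u m (voa_L 0 v)).
rewrite [voa_L 0 v](voa_L0 vq) (linZ ((voa_bilinear V).1 _ _)) => /(canRL (subrK _)) ->.
by rewrite -scalerDl -intrD; congr (_%:~R *: _); lia.
Qed.

Lemma opbinom_homog N q u k : voa_homog q u ->
  opbinom (fun x => voa_L 0 x + N%:R *: x) k u = gbinom ((q + N%:Z)%:~R : C) k *: u.
Proof.
move=> uq; rewrite /opbinom /gbinom mulrC -scalerA; congr (_ *: _).
have L_lin := voa_L_linear 0.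
rewrite -(big_mkord xpredT (fun i => (q + N%:Z)%:~R - i%:R)) /index_iota subn0.
elim: (iota 0 k) => [|i l IH] /=; first by rewrite big_nil scale1r.
rewrite big_cons IH (linZ L_lin) [voa_L 0 u](voa_L0 uq) !scalerA -!scalerDl -scalerBl.
by congr (_ *: _); rewrite intrD mulrBl mulrDl [q%:~R * _]mulrC.
Qed.

Lemma opbinom_linear N k : linear (opbinom (fun x : V => voa_L 0 x + N%:R *: x) k).
Proof.
have L_lin := voa_L_linear 0.
move=> a u v; rewrite /opbinom scalerA mulrC -scalerA -scalerDr; congr (_ *: _).
elim: (iota 0 k) => //= i l ->.
rewrite L_lin !scalerDr !scalerA [N%:R * a]mulrC [i%:R * a]mulrC.
by rewrite -[X in X - _]addrACA opprD scalerN !scalerA -[LHS]addrACA addrA.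
Qed.

(** Truncation does not apply directly, because the first argument varies with [k]; for homogeneous
    [u] it varies only by a scalar. *)
Lemma zhu_res_fin N p u v : exists k0 : nat, forall k, (k0 <= k)%N ->
  voa_Y (opbinom (fun x => voa_L 0 x + N%:R *: x) k u) (p + k%:Z) v = 0.
Proof.
apply: (direct_sum_ind (voa_grading V) (P := [set u | exists k0 : nat, forall k, (k0 <= k)%N ->
  voa_Y (opbinom (fun x => voa_L 0 x + N%:R *: x) k u) (p + k%:Z) v = 0])).
  split=> [|a x y [k1 H1] [k2 H2]].
    by exists 0%N => k _; rewrite (lin0 (opbinom_linear N k)) (lin0 ((voa_bilinear V).2 _ _)).
  exists (k1 + k2)%N => k kk; rewrite opbinom_linear ((voa_bilinear V).2).
  by rewrite H1 ?H2 ?scaler0 ?addr0 //; lia.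
move=> q x xq; have [k0 H] := truncated_nat x v p (vm_truncation (voa_vertex_map V)).
exists k0 => k kk; rewrite (opbinom_homog _ _ xq) (linZ ((voa_bilinear V).2 _ _)).
by rewrite H // scaler0.
Qed.

Lemma zhu_res_ord N p u v : exists k0 : nat, forall k, (k0 <= k)%N -> zhu_res N p u v =
  \sum_(j < k) voa_Y (opbinom (fun x => voa_L 0 x + N%:R *: x) j u) (p + j%:Z) v.
Proof.
have [k0 H] := zhu_res_fin N p u v; exists k0 => k kk.
by apply: fsum_ord => j kj; apply: H; apply: leq_trans kj.
Qed.

Lemma zhu_res_linear_l N p v : linear (fun u => zhu_res N p u v).
Proof.
move=> a x y; have [k1 H1] := zhu_res_ord N p x v; have [k2 H2] := zhu_res_ord N p y v.
have [k3 H3] := zhu_res_ord N p (a *: x + y) v.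
rewrite (H1 (k1 + k2 + k3)%N) ?(H2 (k1 + k2 + k3)%N) ?(H3 (k1 + k2 + k3)%N); try lia.
rewrite scaler_sumr -big_split; apply: eq_bigr => j _ /=.
by rewrite opbinom_linear ((voa_bilinear V).2).
Qed.

Lemma zhu_res_linear_r N p u : linear (zhu_res N p u).
Proof.
move=> a x y; have [k1 H1] := zhu_res_ord N p u x; have [k2 H2] := zhu_res_ord N p u y.
have [k3 H3] := zhu_res_ord N p u (a *: x + y).
rewrite (H1 (k1 + k2 + k3)%N) ?(H2 (k1 + k2 + k3)%N) ?(H3 (k1 + k2 + k3)%N); try lia.
rewrite scaler_sumr -big_split; apply: eq_bigr => j _ /=.
by rewrite ((voa_bilinear V).1).
Qed.

(** This puts [s] at level at most [N] among the weights in its coset of the integers, the only ones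
    that modes can reach from [s]; at such levels [A_N(V)] acts. *)
Definition gap W N s : Prop :=
  forall (j : int) (x : W), j < - N%:Z -> gm_homog (s + j%:~R) x -> x = 0.

(** [zero_mode x u] is [o(u) x], where [o(u) = u_(wt u - 1)] for homogeneous [u]. *)
Definition zero_mode W (x : W) : V -> W :=
  dext (voa_grading V) (fun q u => gm_Y u (q - 1) x).

Lemma zero_mode_linear W (x : W) : linear (zero_mode x).
Proof. by apply: dext_linear => q; apply: (gm_bilinear W).2. Qed.

Lemma zero_modeE W (x : W) q u : voa_homog q u -> zero_mode x u = gm_Y u (q - 1) x.
Proof. by apply: dextE => q'; apply: (gm_bilinear W).2. Qed.

(** In the Jacobi identity with exponents [p + N] and [q + N], every inner mode on the left lowers
    the weight by at least [N + 1] and so kills [x]. The exponent [l = - 2 N - 2] is the one for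
    which all modes on the right are zero modes, and their coefficients are those of
    [(1 + x)^(p + N)]. *)
Lemma zero_mode_res W N s (x : W) u v : gap W N s -> gm_homog s x ->
  zero_mode x (zhu_res N (- (2 * N + 2)%N%:Z) u v) = 0.
Proof.
move=> gapN sx; have ml := zero_mode_linear x.
move: u; apply: (direct_sum_ind (voa_grading V)
  (P := [set u | zero_mode x (zhu_res N (- (2 * N + 2)%N%:Z) u v) = 0])).
  split=> [|a y z yE zE] /=.
    by rewrite (lin0 (zhu_res_linear_l _ _ _)) (lin0 ml).
  by rewrite zhu_res_linear_l ml yE zE scaler0 addr0.
move=> p u up; move: v; apply: (direct_sum_ind (voa_grading V)
  (P := [set v | zero_mode x (zhu_res N (- (2 * N + 2)%N%:Z) u v) = 0])).
  split=> [|a y z yE zE] /=.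
    by rewrite (lin0 (zhu_res_linear_r _ _ _)) (lin0 ml).
  by rewrite zhu_res_linear_r ml yE zE scaler0 addr0.
move=> q v vq /=; set l := - (2 * N + 2)%N%:Z.
have [k1 H1] := zhu_res_ord N l u v.
have [k2 J] := vma_jacobi (gm_vertex_map W) u v x l (p + N%:Z) (q + N%:Z).
rewrite (H1 (k1 + k2)%N) ?leq_addr // (lin_sum ml).
have := J (k1 + k2)%N (leq_addl _ _).
rewrite big1 => [|i _]; last first.
  rewrite (gapN (q - (q + N%:Z + i%:Z) - 1) (gm_Y v (q + N%:Z + i%:Z) x)); [|lia|exact: gm_Y_homog].
  by rewrite gm_Y0 scaler0.
rewrite big1 => [|i _]; last first.
  rewrite (gapN (p - (p + N%:Z + i%:Z) - 1) (gm_Y u (p + N%:Z + i%:Z) x)); [|lia|exact: gm_Y_homog].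
  by rewrite gm_Y0 scaler0.
rewrite subrr => e; rewrite [RHS]e; apply: eq_bigr => j _.
rewrite (opbinom_homog _ _ up) (linZ ((voa_bilinear V).2 _ _)) (linZ ml).
rewrite (zero_modeE _ (voa_Y_homog _ up vq)); congr (_ *: gm_Y _ _ _).
by rewrite /l; lia.
Qed.

(** For [u] of weight [q], [L(-1) u] has weight [q + 1] and zero mode [(L(-1) u)_q = - q u_(q-1)],
    which cancels that of [L(0) u = q u]. *)
Lemma zero_mode_L W (x : W) u : zero_mode x (voa_L (-1) u + voa_L 0 u) = 0.
Proof.
have ml := zero_mode_linear x.
apply: (direct_sum_ind (voa_grading V)
  (P := [set u | zero_mode x (voa_L (-1) u + voa_L 0 u) = 0])).
  split=> [|a y z yE zE] /=.
    by rewrite !(lin0 (voa_L_linear _)) addr0 (lin0 ml).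
  by rewrite !(voa_L_linear _ a) addrACA -scalerDr ml yE zE scaler0 addr0.
move=> q v vq /=; rewrite [voa_L 0 v](voa_L0 vq) (linD ml) (linZ ml) (zero_modeE _ vq).
have L1 : voa_homog (q + 1) (voa_L (-1) v).
  have := @voa_Y_homog 2 q 0 (voa_omega V) v (voa_omega_homog V) vq.
  by rewrite (_ : 2 + q - 0 - 1 = q + 1); last lia.
rewrite (zero_modeE _ L1) (vm_derivative (gm_vertex_map W)) (_ : q + 1 - 1 = q); last lia.
by rewrite scaleNr addNr.
Qed.

Lemma zero_mode_zhu W N s (x : W) u : gap W N s -> gm_homog s x ->
  span (zhu_O_gen N) u -> zero_mode x u = 0.
Proof.
move=> gapN sx; move: u; apply: (@span_min _ _ [set u | zero_mode x u = 0]).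
  exact: subspace_ker (zero_mode_linear x).
move=> _ [[u [v ->]]|[u _ <-]]; first exact: zero_mode_res sx.
exact: zero_mode_L.
Qed.
End Adjoint.

(** * Spanning sets from C1-cofiniteness *)

Section Generation.
Variables (R : realType) (V : voa R).
Local Notation C := R[i].
Implicit Types (W : gen_module V) (u v : V) (p q m : int) (s : C) (N : nat).

Lemma quot_fin_dim (G : set V) : fin_dim [set: quot_span G] ->
  exists es : seq V, forall u, exists2 e, span [set` es] e & span G (u - e).
Proof.
move=> [s sE]; exists (map repr s) => u.
have pi_lin : linear (\pi_(quot_span G))%qT.
  by move=> a x y; rewrite quot_piD -quot_scaleE.
suff H x : span [set` s] x -> exists2 e, span [set` map repr s] e & x = (\pi_(quot_span G) e)%qT.
  have [|e es ue] := H (\pi_(quot_span G) u)%qT; first by rewrite -sE.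
  by exists e => //; apply/quot_eq.
move: x; apply: (@span_min _ _ [set x | exists2 e, _ & x = (\pi_(quot_span G) e)%qT]).
  split=> [|a x y [e1 s1 ->] [e2 s2 ->]] /=.
    by exists 0; [apply: span0|rewrite (lin0 pi_lin)].
  by exists (a *: e1 + e2); [apply: (span_subspace _).2|rewrite pi_lin].
move=> x /= xs; exists (repr x); last by rewrite reprK.
by apply: sub_span; apply: map_f.
Qed.

Lemma span_homog (es : seq V) : exists G : seq (V * int),
  (forall g, g \in G -> voa_homog g.2 g.1) /\
  forall e, e \in es -> exists2 r : seq (V * int), {subset r <= G} & e = \sum_(g <- r) g.1.
Proof.
elim: es => [|e es [G [Gh Ge]]]; first by exists [::].
have [r [_ _ eE]] := dproj_seq (voa_grading V) e.
pose H := [seq (dproj (voa_grading V) q e, q) | q <- r].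
exists (H ++ G); split=> [g|x].
  by rewrite mem_cat => /orP[/mapP[q _ ->]|/Gh //]; apply: dproj_in.
rewrite inE => /orP[/eqP ->|/Ge[t tG ->]]; last first.
  by exists t => // y /tG yG; rewrite mem_cat yG orbT.
by exists H; [move=> y yH; rewrite mem_cat yH|rewrite big_map].
Qed.

(** The list consists of homogeneous components of representatives of a spanning set of [A_N(V)]; it
    is chosen before [W], [s] and [x], which makes later bounds uniform. *)
Lemma zhu_generators N : fin_dim [set: zhu_algebra V N] ->
  exists E : seq (V * int), forall W s (x : W), gap W N s -> gm_homog s x ->
    forall u, span [set` [seq gm_Y g.1 (g.2 - 1) x | g <- E]] (zero_mode x u).
Proof.
move=> /quot_fin_dim[es esP]; have [E [Eh Ee]] := span_homog es.
exists E => W s x gapN sx u; have [e ee ue] := esP u.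
have ml := zero_mode_linear x.
have -> : zero_mode x u = zero_mode x e.
  by apply/eqP; rewrite -subr_eq0 -(linB ml) (zero_mode_zhu gapN sx).
move: e ee {ue}; apply: (span_min (subspace_preim ml (span_subspace _))) => e /= /Ee[r rE ->].
rewrite /preimage /= (lin_sum ml); apply: span_sum => g /rE gE.
by apply: sub_span; rewrite /= (zero_modeE _ (Eh _ gE)); apply: map_f.
Qed.

(** Generators of the part of weight [q] of [C_1(V)]. Both factors of a product have positive weight
    less than [q], on which the induction on degrees rests. *)
Definition C1_homog q : set V :=
  [set x | exists a b p, [/\ 0 < p, p < q, voa_homog p a, voa_homog (q - p) b
                          & x = voa_Y a (-1) b]]
  `|` [set x | exists2 c, voa_homog (q - 1) c & x = voa_L (-1) c].

Lemma voa_L_homog q v : voa_homog q v -> voa_homog (q + 1) (voa_L (-1) v).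
Proof.
move=> vq; have := @voa_Y_homog R V 2 q 0 (voa_omega V) v (voa_omega_homog V) vq.
by rewrite (_ : 2 + q - 0 - 1 = q + 1); last lia.
Qed.

Lemma C1_proj q c : span (@C1_gen R V) c -> span (C1_homog q) (dproj (voa_grading V) q c).
Proof.
have pl := dproj_linear (voa_grading V) q.
move: c; apply: (span_min (subspace_preim pl (span_subspace _))).
move=> _ [[a [b [a_pos b_pos ->]]]|[c _ <-]]; rewrite /preimage /=.
  move: a a_pos; apply: (@span_min _ _ [set a | span _ (dproj _ q (voa_Y a (-1) b))]).
    apply: (subspace_preim (f := fun a => dproj _ q (voa_Y a (-1) b))) (span_subspace _).
    by move=> k x y; rewrite (voa_bilinear V).2 pl.
  move=> a [p p_gt0 ap] /=; move: b b_pos.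
  apply: (@span_min _ _ [set b | span _ (dproj _ q (voa_Y a (-1) b))]).
    apply: (subspace_preim (f := fun b => dproj _ q (voa_Y a (-1) b))) (span_subspace _).
    by move=> k x y; rewrite (voa_bilinear V).1 pl.
  move=> b [p' p'_gt0 bp'] /=; rewrite (dprojE _ _ (voa_Y_homog (-1) ap bp')).
  case: eqP => [e|_]; last exact: span0.
  apply: sub_span; left; exists a, b, p; split=> //; first by lia.
  by rewrite (_ : q - p = p') //; lia.
apply: (direct_sum_ind (voa_grading V)
  (P := [set c | span (C1_homog q) (dproj (voa_grading V) q (voa_L (-1) c))])).
  apply: (subspace_preim (f := fun c => dproj _ q (voa_L (-1) c))) (span_subspace _).
  by move=> k x y; rewrite voa_L_linear pl.
move=> p v vp /=; rewrite (dprojE _ _ (voa_L_homog vp)).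
case: eqP => [e|_]; last exact: span0.
by apply: sub_span; right; exists v => //; rewrite e addrK.
Qed.

Lemma C1_split : C1_cofinite V ->
  exists T : nat, (0 < T)%N /\ forall q g, T%:Z < q -> voa_homog q g -> span (C1_homog q) g.
Proof.
move=> /quot_fin_dim[es esP]; have [E [Eh Ee]] := span_homog es.
(* Above all weights of the representatives, the component of weight [q] of a representative
   vanishes, so [g] lies in [C_1(V)]. The successor makes [T] positive, which keeps [q - 1] positive
   when [L(-1)] is removed. *)
exists (\max_(g <- E) `|g.2|%N).+1; split=> // q g Tq gq.
have [e ee] := esP g; have pl := dproj_linear (voa_grading V) q.
move=> /(@C1_proj q _); rewrite (linB pl) (dprojE _ _ gq) eqxx.
suff -> : dproj (voa_grading V) q e = 0 by rewrite subr0.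
move: e ee; apply: (@span_min _ _ [set e | dproj _ q e = 0]); first exact: subspace_ker pl.
move=> _ /= /Ee[r rE ->]; rewrite (lin_sum pl) big_seq big1 // => h /rE hE.
rewrite (dprojE _ _ (Eh _ hE)); case: eqP => // qh.
have : (`|h.2| <= \max_(g <- E) `|g.2|)%N by apply: leq_bigmax_seq.
by rewrite -qh; lia.
Qed.

Lemma homog_generators (T : nat) : exists G : seq (V * int),
  (forall g, g \in G -> voa_homog g.2 g.1) /\
  forall q u, q <= T%:Z -> voa_homog q u ->
    span [set x | (x, q) \in G] u.
Proof.
have [M MV] := voa_lower V.
have /choice [b bP] (i : nat) : exists b : seq V, @voa_homog R V (M + i%:Z) = span [set` b].
  exact: voa_fin_dim.
exists [seq (x, M + i%:Z) | i <- iota 0 `|T%:Z - M + 1|, x <- b i]; split.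
  move=> _ /allpairsPdep[i [x [_ xb ->]]] /=; rewrite bP.
  exact: (@sub_span _ _ [set` b i]).
move=> q u qT uq; have [qM|Mq] := ltP q M.
  by move: uq; rewrite MV // => ->; apply: span0.
have qE : q = M + `|q - M|%N%:Z by lia.
move: uq; rewrite {1}qE bP; apply: span_mono => x /= xb.
by apply/allpairsPdep; exists `|q - M|%N, x; split=> //; [rewrite mem_iota; lia|rewrite -qE].
Qed.
End Generation.

Lemma mem_iota_pos (c : int) (k : nat) : 0 < c <= k%:Z ->
  c \in [seq j.+1%:Z | j <- iota 0 k].
Proof.
by move=> ck; apply/mapP; exists `|c|.-1%N; last lia; rewrite mem_iota; lia.
Qed.

Lemma mem_iota_neg (c : int) (k : nat) : - k%:Z <= c < 0 ->
  c \in [seq - j.+1%:Z | j <- iota 0 k].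
Proof.
by move=> ck; apply/mapP; exists `|c|.-1%N; last lia; rewrite mem_iota; lia.
Qed.

(** * Degree filtration and normally ordered words *)

Section StrongGeneration.
Variables (R : realType) (V : voa R).
Local Notation C := R[i].
Variables (T : nat) (T_gt0 : (0 < T)%N).
Hypothesis C1T : forall (q : int) (g : V), T%:Z < q -> voa_homog q g -> span (@C1_homog R V q) g.
Variable G : seq (V * int).
Hypothesis Gh : forall g, g \in G -> voa_homog g.2 g.1.
Hypothesis GT : forall (q : int) (u : V), q <= T%:Z -> voa_homog q u -> span [set x | (x, q) \in G] u.
Variables (W : gen_module V) (w : W).
Implicit Types (a b : letter V) (s r t : seq (letter V)) (q : int) (x y : W).

(* Giving every letter degree at least [1] makes the filtration well founded even if
   [V] has nonpositive weights, and commutators still lower the total degree. *)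
Definition deg q : nat := maxn 1 `|Num.max 0 q|.

Lemma degE q : 0 < q -> (deg q)%:Z = q.
Proof. by rewrite /deg => q_gt0; rewrite max_r ?ltW //; lia. Qed.

Lemma deg_le0 q : q <= 0 -> deg q = 1%N.
Proof. by rewrite /deg => q_le0; rewrite max_l. Qed.

Lemma deg_gt0 q : (0 < deg q)%N.
Proof. by rewrite /deg leq_max. Qed.

Lemma deg_commutator p q (i : nat) : (deg (p + q - i%:Z - 1) <= deg p + deg q - 1)%N.
Proof.
have [gp gq] := (deg_gt0 p, deg_gt0 q).
have [r_gt0|/deg_le0 ->] := ltP 0 (p + q - i%:Z - 1); last by lia.
have dr := degE r_gt0.
have [/degE dp|p0] := ltP 0 p; have [/degE dq|q0] := ltP 0 q; lia.
Qed.

Definition wact s (x : W) : W := foldr (@lact R V W) x s.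
Definition wdeg s : nat := \sum_(a <- s) deg a.1.2.
Definition glet a : bool := a.1 \in G.

Definition Fil (d : nat) : set W :=
  span [set x | exists s, [/\ all glet s, (wdeg s <= d)%N & x = wact s w]].

Lemma Fil_mono d d' : (d <= d')%N -> Fil d `<=` Fil d'.
Proof.
move=> dd'; apply: span_mono => x [s [sG sd ->]]; exists s; split=> //.
exact: leq_trans dd'.
Qed.

Lemma glet_ok a : glet a -> lok a.
Proof. exact: Gh. Qed.

Lemma Fil_glet a d y : glet a -> Fil d y -> Fil (d + deg a.1.2) (lact a y).
Proof.
move=> aG; move: y; apply: (span_min (subspace_preim (lact_linear a) (span_subspace _))).
move=> _ [s [sG sd ->]]; apply: sub_span; exists (a :: s); split=> //=; first by rewrite aG.
by rewrite /wdeg big_cons addnC leq_add2r.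
Qed.

Lemma lact_letter (g : V) q (k : int) y : gm_Y g k y = lact (g, q, q - 1 - k) y.
Proof. by rewrite /lact /=; congr gm_Y; lia. Qed.

(** Induction on the degree of the letter. Up to weight [T] its vector is a combination of
    generators; above, it is a combination of products [a_(-1) b] and derivatives [L(-1) c], whose
    modes are expressed by modes of [a], [b] and [c], which have smaller degree. *)
Lemma Fil_lact a d y : lok a -> Fil d y -> Fil (d + deg a.1.2) (lact a y).
Proof.
move En : (deg a.1.2) => n; elim/ltn_ind: n a En d y => n IH [[g q] j] /= qn d y gq dy.
rewrite -qn; rewrite /lok /= in gq.
have FY : subspace [set g | Fil (d + deg q) (gm_Y g (q - 1 - j) y)].
  apply: (subspace_preim (f := fun g => gm_Y g (q - 1 - j) y)) (span_subspace _).
  exact: (gm_bilinear W).2.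
have [qT|Tq] := leP q T%:Z.
  apply: (span_min FY) (GT qT gq) => x /= xG.
  exact: (@Fil_glet (x, q, j)).
apply: (span_min FY) (C1T Tq gq) => _ [[a [b [p [p_gt0 pq ap bp ->]]]]|[c cq ->]] /=.
  (* With [l = -1] and [m = 0] the right side is the single mode of [a_(-1) b], and the left side is
     its normally ordered expansion. *)
  have [k0 J] := vma_jacobi (gm_vertex_map W) a b y (-1) 0 (q - 1 - j).
  have := J k0.+1 (leqnSn _); rewrite [RHS]big_ord_recl /= gbinom0 scale1r.
  rewrite [X in _ = _ + X]big1 ?addr0; last first.
    by move=> i _; rewrite (@gbinom_small _ 0) ?scale0r.
  rewrite [0 + (q - 1 - j)]add0r => <-.
  have qp_gt0 : 0 < q - p by rewrite subr_gt0.
  have [[dp dqp] dq] := (degE p_gt0, degE qp_gt0, degE (lt_trans p_gt0 pq)).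
  have Fa k z d' : Fil d' z -> Fil (d' + deg p) (gm_Y a k z).
    move=> zd'; rewrite (lact_letter _ p).
    by apply: (IH (deg p) _ (a, p, p - 1 - k)) => //; lia.
  have Fb k z d' : Fil d' z -> Fil (d' + deg (q - p)) (gm_Y b k z).
    move=> zd'; rewrite (lact_letter _ (q - p)).
    by apply: (IH (deg (q - p)) _ (b, q - p, q - p - 1 - k)) => //; lia.
  have le : (d + deg (q - p) + deg p <= d + deg q)%N by lia.
  apply: spanB; apply: span_sum => i _; apply: spanZ; apply: (Fil_mono le).
    by apply: Fa; apply: Fb.
  by rewrite addnAC; apply: Fb; apply: Fa.
rewrite (vm_derivative (gm_vertex_map W)); apply: spanZ.
have [q_gt0 q1_gt0] : 0 < q /\ 0 < q - 1 by lia.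
have [dq dq1] := (degE q_gt0, degE q1_gt0).
rewrite (lact_letter _ (q - 1)); apply: (@Fil_mono (d + deg (q - 1))); first lia.
by apply: (IH (deg (q - 1)) _ (c, q - 1, q - 1 - 1 - (q - 1 - j - 1))) => //; lia.
Qed.

Lemma Fil_generates x : generates w -> exists d, Fil d x.
Proof.
move=> /(_ x) /cyclicP[l [l_ok ->]].
elim: l l_ok => [|a l IH] l_ok; first by exists 0%N; rewrite big_nil; apply: span0.
have [|d ld] := IH; first by move=> b bl; apply: l_ok; rewrite inE bl orbT.
exists (d + deg a.1.2)%N; rewrite big_cons; apply: spanD.
  apply: (@Fil_mono (0 + deg a.1.2)); first by rewrite leq_add2r.
  apply: Fil_lact; first by apply: l_ok; rewrite inE eqxx.
  by apply: sub_span; exists [::]; split=> //; rewrite /wdeg big_nil.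
by apply: (Fil_mono (leq_addr _ _)).
Qed.

(** The commutator is a sum of modes of [a_i b] with [i >= 0]. The weight of [a_i b] is smaller than
    the sum of the two weights, so at least one degree is gained. *)
Lemma Fil_commutator a b d y : lok a -> lok b -> Fil d y ->
  Fil (d + deg a.1.2 + deg b.1.2 - 1) (lact a (lact b y) - lact b (lact a y)).
Proof.
move=> oka okb dy; rewrite /lact.
have [k0 H] := gm_commutator a.1.1 b.1.1 (a.1.2 - 1 - a.2) (b.1.2 - 1 - b.2) y.
rewrite (H k0) //; apply: span_sum => i _; apply: spanZ.
have ab := voa_Y_homog i%:Z oka okb.
rewrite (lact_letter _ (a.1.2 + b.1.2 - i%:Z - 1)).
set c : letter V := (_, _, _); have okc : lok c by [].
apply: Fil_mono (Fil_lact okc dy); rewrite -/c /=.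
rewrite -addnA -addnBA ?leq_add2l; last by rewrite addn_gt0 deg_gt0.
exact: deg_commutator.
Qed.

Lemma wact_cat s t x : wact (s ++ t) x = wact s (wact t x).
Proof. exact: foldr_cat. Qed.

Lemma wact_linear s : linear (wact s).
Proof. by move=> c x y; elim: s => //= a s ->; apply: lact_linear. Qed.

Lemma wdeg_cons a s : wdeg (a :: s) = (deg a.1.2 + wdeg s)%N.
Proof. exact: big_cons. Qed.

Lemma wdeg_cat s t : wdeg (s ++ t) = (wdeg s + wdeg t)%N.
Proof. exact: big_cat. Qed.

Lemma Fil_wact s : all glet s -> Fil (wdeg s) (wact s w).
Proof. by move=> sG; apply: sub_span; exists s. Qed.

Lemma wact_move a r t : glet a -> all glet r -> all glet t ->
  Fil (deg a.1.2 + wdeg r + wdeg t - 1) (wact (a :: r ++ t) w - wact (r ++ a :: t) w).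
Proof.
move=> aG; elim: r => [|b r IH] /= => [_ tG|/andP[bG rG] tG]; first by rewrite subrr; apply: span0.
pose x := wact (r ++ t) w.
have -> : lact a (lact b x) - lact b (wact (r ++ a :: t) w) =
    (lact a (lact b x) - lact b (lact a x)) + lact b (lact a x - wact (r ++ a :: t) w).
  by rewrite (linB (lact_linear b)) addrA subrK.
have [ga gb] := (deg_gt0 a.1.2, deg_gt0 b.1.2).
rewrite wdeg_cons; apply: spanD.
  apply: Fil_mono (Fil_commutator (glet_ok aG) (glet_ok bG) (Fil_wact _)).
    by rewrite wdeg_cat; lia.
  by rewrite all_cat rG.
by apply: Fil_mono (Fil_glet bG (IH rG tG)); lia.
Qed.

Definition raising s := [seq a <- s | 0 < a.2].
Definition neutral s := [seq a <- s | a.2 == 0].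
Definition lowering s := [seq a <- s | a.2 < 0].
Definition normal s := raising s ++ neutral s ++ lowering s.

Lemma wdeg_normal s : wdeg (normal s) = wdeg s.
Proof.
rewrite /normal !wdeg_cat /wdeg !big_filter ; rewrite [X in (X + _)%N]big_mkcond [X in (_ + (X + _))%N]big_mkcond [X in (_ + (_ + X))%N]big_mkcond -!big_split.
by apply: eq_bigr => a _ /=; case: (ltgtP a.2 0); rewrite ?addn0.
Qed.
Lemma glet_normal s : all glet s -> all glet (normal s).
Proof.
move=> /allP sG; apply/allP => a.
by rewrite !mem_cat !mem_filter => /or3P[] /andP[_ /sG].
Qed.

Lemma wact_normal s : all glet s -> Fil (wdeg s - 1) (wact s w - wact (normal s) w).
Proof.
elim: s => [_|a s IH /= /andP[aG sG]]; first by rewrite subrr; apply: span0.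
have [rG nG] : all glet (raising s) /\ all glet (neutral s ++ lowering s).
  by apply/andP; rewrite -all_cat; apply: glet_normal.
have [ga da] := (deg_gt0 a.1.2, wdeg_normal s); rewrite !wdeg_cat in da.
have step : Fil (wdeg (a :: s) - 1) (lact a (wact s w) - lact a (wact (normal s) w)).
  case: s IH sG {rG nG da} => [|b s] IH sG; first by rewrite subrr; apply: span0.
  rewrite -(linB (lact_linear a)); apply: Fil_mono (Fil_glet aG (IH sG)).
  by have := deg_gt0 b.1.2; rewrite !wdeg_cons; lia.
rewrite -[X in Fil _ X](subrKA (lact a (wact (normal s) w))); apply: spanD step _.
have le d : (d = deg a.1.2 + wdeg s - 1)%N -> Fil d `<=` Fil (wdeg (a :: s) - 1).
  by move=> ->; rewrite wdeg_cons.
rewrite /normal /raising /neutral /lowering /=.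
case: (ltgtP a.2 0) => a2 /=.
- rewrite -/(raising s) -/(neutral s) -/(lowering s) !catA.
  have := @wact_move a (raising s ++ neutral s) (lowering s) aG.
  move: nG; rewrite all_cat => /andP[nG lG].
  rewrite all_cat rG nG => /(_ isT lG); apply: le.
  by rewrite wdeg_cat; lia.
- by rewrite subrr; apply: span0.
- rewrite -/(raising s) -/(neutral s) -/(lowering s).
  apply: le (wact_move aG rG nG).
  by rewrite wdeg_cat; lia.
Qed.

(** Induction on [d]: sorting the letters of a word by the sign of their shift costs only
    commutators, which lie in lower degree. *)
Lemma Fil_normal d : Fil d `<=`
  span [set x | exists r t s, [/\ all glet (r ++ t ++ s), all (fun a => 0 < a.2) r,
    all (fun a => a.2 == 0) t, all (fun a => a.2 < 0) s & x = wact (r ++ t ++ s) w]].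
Proof.
elim/ltn_ind: d => d IH; apply: span_min; first exact: span_subspace.
move=> _ [s [sG sd ->]]; rewrite -[wact s w](subrK (wact (normal s) w)).
apply: spanD; last first.
  apply: sub_span; exists (raising s), (neutral s), (lowering s).
  by split=> //; [exact: glet_normal|exact: filter_all|exact: filter_all|exact: filter_all].
(* The empty word is set apart because [wdeg s - 1] is truncated at 0 and would not decrease. *)
case: s sG sd => [|a s] sG sd; first by rewrite subrr; apply: span0.
apply: (IH (wdeg (a :: s) - 1)%N) (wact_normal sG).
by have := deg_gt0 a.1.2; move: sd; rewrite wdeg_cons; lia.
Qed.

Fixpoint words (A : seq (letter V)) (k : nat) : seq (seq (letter V)) :=
  if k is k'.+1 then [::] :: [seq a :: s | a <- A, s <- words A k'] else [:: [::]].

Lemma mem_words A k s : (size s <= k)%N -> {subset s <= A} -> s \in words A k.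
Proof.
elim: k s => [|k IH] [|a s] //= sk sA; rewrite inE /=.
apply/allpairsP; exists (a, s); split=> //=; first by apply: sA; rewrite inE eqxx.
by apply: IH => // b bs; apply: sA; rewrite inE bs orbT.
Qed.

Definition shift s : int := \sum_(a <- s) a.2.

Lemma shift_cat s t : shift (s ++ t) = shift s + shift t.
Proof. exact: big_cat. Qed.

Lemma wact_homog n x s : all glet s -> gm_homog n x ->
  gm_homog (n + (shift s)%:~R) (wact s x).
Proof.
move=> sG nx; elim: s sG => [_|a s IH /= /andP[aG /IH sx]].
  by rewrite /shift big_nil addr0.
have := lact_homog (glet_ok aG) sx; rewrite -addrA -intrD.
by rewrite /shift big_cons [a.2 + _]addrC.
Qed.

Lemma shift_pos s a : all (fun a => 0 < a.2) s ->
  (size s)%:Z <= shift s /\ (a \in s -> a.2 <= shift s).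
Proof.
rewrite /shift; elim: s => [_|b s IH /= /andP[b_gt0 /IH[IH1 IH2]]].
  by rewrite big_nil.
rewrite big_cons; split; first by move: IH1; rewrite /= -addn1 PoszD; lia.
rewrite inE => /orP[/eqP ->|/IH2 /le_trans]; first by rewrite lerDl (le_trans _ IH1).
by apply; rewrite lerDr ltW.
Qed.

Lemma shift_neg s a : all (fun a => a.2 < 0) s ->
  shift s <= - (size s)%:Z /\ (a \in s -> shift s <= a.2).
Proof.
rewrite /shift; elim: s => [_|b s IH /= /andP[b_gt0 /IH[IH1 IH2]]].
  by rewrite big_nil.
rewrite big_cons; split; first by move: IH1; rewrite /= -addn1 PoszD; lia.
rewrite inE => /orP[/eqP ->|/IH2].
  by rewrite gerDl (le_trans IH1) // oppr_le0.
by apply: le_trans; rewrite gerDr ltW.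
Qed.

Lemma shift_zero s : all (fun a => a.2 == 0) s -> shift s = 0.
Proof.
by move=> /allP s0; rewrite /shift big_seq big1 // => a /s0 /eqP.
Qed.

Definition shifted (J : seq int) : seq (letter V) := [seq (g, j) | g <- G, j <- J].

Lemma mem_shifted J a : glet a -> a.2 \in J -> a \in shifted J.
Proof. by move=> aG aJ; apply/allpairsP; exists (a.1, a.2); split=> //; case: a aG aJ. Qed.

Lemma gap_lower N (n : R[i]) (j : int) : gap W N n -> j <= 0 -> gap W N (n + j%:~R).
Proof.
move=> gapN j0 i x iN; rewrite -addrA -intrD; apply: gapN; lia.
Qed.

(** Products of zero modes collapse: the vector lies in [cyclic_set x], hence is a sum of single
    modes of [x], and projecting to weight [n] keeps the zero modes among them. No bound on the
    length of [s] is required. *)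
Lemma wact_neutral (E : seq (V * int)) n x s :
  (forall u, span [set` [seq gm_Y g.1 (g.2 - 1) x | g <- E]] (zero_mode x u)) ->
  gm_homog n x -> all glet s -> all (fun a => a.2 == 0) s ->
  span [set` [seq gm_Y g.1 (g.2 - 1) x | g <- E]] (wact s x).
Proof.
move=> Ex nx sG s0.
have sx : gm_homog n (wact s x).
  by have := wact_homog sG nx; rewrite shift_zero // addr0.
have cx : cyclic_set x (wact s x).
  elim: s {sG s0 sx} => [|a s IH] /=; first exact: cyclic_mem.
  exact: (cyclic_submodule x).2.
rewrite -(gmpr_id sx); move: cx => /cyclicP[l [l_ok ->]].
rewrite -[n]addr0 -[0]/(0%:~R : R[i]) (gmpr_lact_sum _ l_ok nx) -big_filter.
apply: span_sum => a; rewrite mem_filter => /andP[/eqP a0 /l_ok oka].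
by rewrite /lact a0 subr0 -(zero_modeE _ oka).
Qed.

(** A lowering word with nonzero value has total shift at least [- N], which bounds its length and
    its letters by [N]. To reach shift at most [N] the raising word then needs total shift at most
    [N + N]. The weight-preserving part is a single letter from [E]. *)
Definition normal_words (E : seq (V * int)) (N : nat) : seq (seq (letter V)) :=
  [seq r ++ s | r <- words (shifted [seq j.+1%:Z | j <- iota 0 (N + N)]) (N + N),
     s <- [seq (g, 0) :: s | g <- E,
             s <- words (shifted [seq - j.+1%:Z | j <- iota 0 N]) N]].

Lemma normal_words_span (E : seq (V * int)) N (n : R[i]) (k : int) x :
  (forall (c : R[i]) y, gap W N c -> gm_homog c y ->
    forall u, span [set` [seq gm_Y g.1 (g.2 - 1) y | g <- E]] (zero_mode y u)) ->
  generates w -> gm_homog n w -> gap W N n -> `|k| <= N%:Z ->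
  gm_homog (n + k%:~R) x -> span [set` [seq wact s w | s <- normal_words E N]] x.
Proof.
move=> Es gen nw gapN kN xk; rewrite -(gmpr_id xk).
have [d /Fil_normal] := Fil_generates x gen.
set S := span [set` _]; move: x {xk}.
apply: (span_min (subspace_preim (gmpr_linear _) (span_subspace _))).
move=> _ [r [t [s [rtsG r_pos t_zero s_neg ->]]]]; rewrite /preimage /=.
move: (rtsG); rewrite !all_cat => /and3P[rG tG sG].
rewrite (gmprE _ (wact_homog rtsG nw)) (inj_eq (addrI n)) eqr_int.
case: eqP => [kE|_]; last exact: span0.
rewrite !shift_cat (shift_zero t_zero) add0r in kE.
have sw := wact_homog sG nw.
have [sN|Ns] := ltP (shift s) (- N%:Z).
  rewrite !wact_cat (gapN _ _ sN sw) (lin0 (wact_linear t)) (lin0 (wact_linear r)).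
  exact: span0.
have s_le0 : shift s <= 0.
  by have [] := @shift_neg s (0, 0, 0) s_neg; clear; lia.
have := wact_neutral (Es _ _ (gap_lower gapN s_le0) sw) sw tG t_zero.
rewrite !wact_cat; move: (wact t _).
apply: (span_min (subspace_preim (wact_linear r) (span_subspace _))).
move=> _ /= /mapP[g gE ->]; apply: sub_span => /=; apply/mapP.
exists (r ++ (g, 0) :: s); last by rewrite wact_cat /= /lact /= subr0.
apply/allpairsP; exists (r, (g, 0) :: s); split=> //=.
  have [r_size _] := @shift_pos r (0, 0, 0) r_pos.
  apply: mem_words => [|a ar]; first by move: r_size kE kN Ns; clear; lia.
  apply: mem_shifted; first exact: (allP rG).
  have [_ /(_ ar) ar_le] := @shift_pos r a r_pos; have a_gt0 := allP r_pos _ ar.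
  apply: mem_iota_pos; rewrite [X in X && _]a_gt0 (le_trans ar_le) //.
  by move: kE kN Ns; clear; lia.
apply/allpairsP; exists (g, s); split=> //=.
have [s_size _] := @shift_neg s (0, 0, 0) s_neg.
apply: mem_words => [|a as_]; first by move: s_size Ns; clear; lia.
apply: mem_shifted; first exact: (allP sG).
have [_ /(_ as_) as_le] := @shift_neg s a s_neg; have a_lt0 := allP s_neg _ as_.
by apply: mem_iota_neg; rewrite [X in _ && X]a_lt0 (le_trans Ns).
Qed.

End StrongGeneration.

Lemma cyclic_bound (R : realType) (V : voa R) (N : nat) :
  C1_cofinite V -> fin_dim [set: zhu_algebra V N] ->
  exists B : seq (seq (letter V)), forall (W : gen_module V) (w : W) n (k : int) x,
    generates w -> gm_homog n w -> gap W N n -> `|k| <= N%:Z -> gm_homog (n + k%:~R) x ->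
    span [set` [seq wact s w | s <- B]] x.
Proof.
move=> /C1_split[T [T_gt0 C1T]] /zhu_generators[E EP].
have [G [Gh GT]] := homog_generators V T.
exists (normal_words G E N) => W w n k x.
by apply: (normal_words_span T_gt0 C1T Gh GT) => c y; apply: EP.
Qed.

(** * Lowest weights and irreducible modules *)

Section Restricted.
Variables (R : realType) (V : voa R).
Local Notation C := R[i].
Implicit Types (W : gen_module V) (n m : C) (j : int).

Lemma Re_addz n j : complex.Re (n + j%:~R) = complex.Re n + j%:~R.
Proof.
have -> : j%:~R = (j%:~R : R)%:C%C by rewrite rmorph_int.
by case: n.
Qed.

Lemma homog_neq0 W n : @gm_homog R V W n <> [set 0] <-> exists2 x : W, gm_homog n x & x != 0.
Proof.
split=> [h0|[x xn x0] h0]; last by move: xn; rewrite h0 => /eqP; rewrite (negPf x0).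
apply: contrapT => /forall2NP none; apply: h0; apply/seteqP; split=> [x xn|_ ->].
  by have [//|/negP/negPn/eqP] := none x.
exact: subspace0 (gm_homog_subspace W n).
Qed.

Lemma homog_eq0 W n : @gm_homog R V W n = [set 0] <-> forall x : W, gm_homog n x -> x = 0.
Proof.
split=> [-> //|h0]; apply/seteqP; split=> [x /h0 //|_ ->].
exact: subspace0 (gm_homog_subspace W n).
Qed.

Lemma grading_restricted_inj W W' (f : module_hom W W') : injective f ->
  grading_restricted W' -> grading_restricted W.
Proof.
move=> f_inj [[B W'B] W'_fin]; have fl := hom_linear f.
have f0 x : f x = 0 -> x = 0 by rewrite -(lin0 fl) => /f_inj.
split.
  exists B => n /W'B W'n; apply/homog_eq0 => x /(hom_homog f).
  by rewrite W'n => /f0.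
move=> n; apply: fin_spanned_dim; first exact: gm_homog_subspace.
apply: (fin_spanned_ker fl) => //; first exact: gm_homog_subspace.
  apply: fin_spanned_sub (fin_dim_spanned (W'_fin n)).
  by move=> _ [x xn <-]; apply: hom_homog.
by exists [::] => x [_ /f0 ->]; apply: span0.
Qed.

Lemma homog_surj W W' (f : module_hom W W') n y : surjective_hom f -> gm_homog n y ->
  exists2 x, gm_homog n x & f x = y.
Proof.
move=> f_surj yn; have [x xy] := f_surj y.
by exists (gmpr n x); [apply: gmpr_in|rewrite hom_gmpr xy gmpr_id].
Qed.

Lemma grading_restricted_surj W W' (f : module_hom W W') : surjective_hom f ->
  grading_restricted W -> grading_restricted W'.
Proof.
move=> f_surj [[B WB] W_fin]; have fl := hom_linear f.
split.
  exists B => n /WB Wn; apply/homog_eq0 => y /(homog_surj f_surj)[x].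
  by rewrite Wn => /= -> <-; rewrite (lin0 fl).
move=> n; apply: fin_spanned_dim; first exact: gm_homog_subspace.
apply: fin_spanned_sub (fin_spanned_img fl (fin_dim_spanned (W_fin n))).
by move=> y /(homog_surj f_surj)[x xn <-]; exists x.
Qed.

Lemma grading_restricted_prod W W' : grading_restricted W -> grading_restricted W' ->
  grading_restricted (prod_module W W').
Proof.
move=> [[B WB] W_fin] [[B' W'B] W'_fin]; split.
  exists (Num.min B B') => n; rewrite lt_min => /andP[/WB Wn /W'B W'n].
  apply/homog_eq0 => x xn; apply: pair_inj.
    by have := hom_homog (prod_fst W W') xn; rewrite Wn.
  by have := hom_homog (prod_snd W W') xn; rewrite W'n.
move=> n; apply: fin_spanned_dim; first exact: gm_homog_subspace.
apply: (fin_spanned_ker (hom_linear (prod_fst W W'))); first exact: gm_homog_subspace.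
  apply: fin_spanned_sub (fin_dim_spanned (W_fin n)).
  by move=> _ [x xn <-]; apply: hom_homog.
apply: fin_spanned_sub
  (fin_spanned_img (hom_linear (prod_inr W W')) (fin_dim_spanned (W'_fin n))).
move=> x [xn /= x1]; exists x.2; first exact: (hom_homog (prod_snd W W') xn).
exact: pair_inj.
Qed.

Lemma zero_module_restricted : grading_restricted (zero_module V).
Proof.
split; first by exists 0 => n _; apply/homog_eq0 => x _; apply: zero_module_eq.
move=> n; apply: fin_spanned_dim; first exact: gm_homog_subspace.
exists [::] => x _; rewrite (zero_module_eq x 0); exact: span0.
Qed.

Definition zero_gr : gr_module V := GrModule zero_module_restricted.

Definition sub_gr (W : gr_module V) (S : set W) (S_sub : gen_submodule S) : gr_module V :=
  GrModule (grading_restricted_inj (@sub_incl_inj R V W S S_sub) (grm_restricted W)).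

Definition quo_gr (W : gr_module V) (S : set W) (S_sub : gen_submodule S) : gr_module V :=
  GrModule (grading_restricted_surj (@quo_proj_surj R V W S S_sub) (grm_restricted W)).

Definition prod_gr (W W' : gr_module V) : gr_module V :=
  GrModule (grading_restricted_prod (grm_restricted W) (grm_restricted W')).

Lemma cyclic_inj W W' (f : module_hom W W') w x : injective f ->
  cyclic_set (f w) (f x) -> cyclic_set w x.
Proof.
move=> f_inj /cyclicP[l [l_ok fx]]; apply/cyclicP; exists l; split=> //; apply: f_inj.
by rewrite fx (lin_sum (hom_linear f)); apply: eq_bigr => a _; rewrite lact_hom.
Qed.

Lemma lower_truncated_min W m : lower_truncated W -> @gm_homog R V W m <> [set 0] ->
  exists k : nat, @gm_homog R V W (m - k%:R) <> [set 0] /\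
    forall j, j < 0 -> @gm_homog R V W (m - k%:R + j%:~R) = [set 0].
Proof.
move=> [B WB] m0.
have ex0 : exists k : nat, `[< @gm_homog R V W (m - k%:R) <> [set 0] >].
  by exists 0%N; rewrite subr0; apply/asboolP.
have ub (k : nat) : `[< @gm_homog R V W (m - k%:R) <> [set 0] >] ->
    (k <= Num.bound (complex.Re m - B))%N.
  move=> /asboolP; apply: contra_notT; rewrite -ltnNge => lt_k; apply: WB.
  rewrite -[- k%:R]/(- k%:Z%:~R) -intrN Re_addz intrN ltrBlDr -ltrBlDl.
  apply: le_lt_trans (ler_norm _) _.
  apply: lt_trans (archi_boundP (normr_ge0 _)) _.
  by rewrite /Num.bound normr_id ltr_nat.
case: (ex_maxnP ex0 ub) => k /asboolP k0 k_max; exists k; split=> // j j_lt0.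
apply: contrapT => kj; have : (k + `|j| <= k)%N.
  apply: k_max; apply/asboolP; rewrite natrD opprD addrA.
  by rewrite -[`|j|%:R]/(`|j|%N%:Z%:~R) -[- (_%:~R)]intrN (_ : - `|j|%N%:Z = j) //; lia.
by lia.
Qed.

(** The set [L] of the overview. Minimality is tested along integers only; for irreducible modules
    this is enough by [irreducible_lowest], since all weights lie in one coset. *)
Definition low_weights : set C := [set n | exists S : gr_module V,
  [/\ irreducible_module S, @gm_homog R V S n <> [set 0]
    & forall j, j < 0 -> @gm_homog R V S (n + j%:~R) = [set 0]]].

Lemma irreducible_weights W n m : irreducible_module W ->
  @gm_homog R V W n <> [set 0] -> (forall j, j < 0 -> @gm_homog R V W (n + j%:~R) = [set 0]) ->
  @gm_homog R V W m <> [set 0] -> exists k : nat, m = n + k%:R.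
Proof.
move=> irr /homog_neq0[x xn x0] low /[dup] m0 /homog_neq0[y ym y0].
have [|j mE] := cyclic_weight (t := m) xn (irreducible_generates irr x0 y).
  by rewrite gmpr_id.
have [j_lt0|j_ge0] := ltP j 0; first by case: m0; rewrite mE; apply: low.
by exists `|j|%N; rewrite mE; congr (_ + _); rewrite -[RHS]/(`|j|%N%:Z%:~R) gez0_abs.
Qed.

Lemma irreducible_lowest W n : irreducible_module W ->
  @gm_homog R V W n <> [set 0] -> (forall j, j < 0 -> @gm_homog R V W (n + j%:~R) = [set 0]) ->
  lowest_weight W n.
Proof.
move=> irr n0 low; split=> // m lt_mn; apply: contrapT.
move=> /(irreducible_weights irr n0 low)[k mE].
move: lt_mn; rewrite mE -[k%:R]/(k%:Z%:~R) Re_addz.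
rewrite -[X in _ < X]addr0 ltrD2l ltrz0 -[X in _ = X /\ _]addr0 => -[//|[/addrI/eqP]].
by rewrite intr_eq0 => /eqP ->; rewrite addr0.
Qed.

(* Pass to a submodule generated by a vector x of minimal weight n for which the weight-n
   space is as small as possible; then every nonzero vector of weight n generates it, and
   its largest submodule without vectors of weight n is maximal. *)
Lemma low_weight_min (W : gr_module V) n : @gm_homog R V W n <> [set 0] ->
  (forall j, j < 0 -> @gm_homog R V W (n + j%:~R) = [set 0]) -> low_weights n.
Proof.
move=> /homog_neq0[x0 x0n x0_neq0] low.
pose P d := `[< exists x : W, [/\ gm_homog n x, x != 0
  & set_dim (cyclic_set x `&` @gm_homog R V W n) = d] >].
have exP : exists d, P d.
  by exists (set_dim (cyclic_set x0 `&` @gm_homog R V W n)); apply/asboolP; exists x0.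
case: (ex_minnP exP) => d /asboolP[x [xn x_neq0 dE]] d_min.
have x_min y : cyclic_set x y -> gm_homog n y -> y != 0 -> cyclic_set y x.
  move=> xy yn y_neq0.
  have sub : cyclic_set y `&` @gm_homog R V W n `<=` cyclic_set x `&` @gm_homog R V W n.
    by move=> z [yz zn]; split=> //; apply: (cyclic_min (cyclic_submodule x) xy).
  have cS z : subspace (cyclic_set z `&` @gm_homog R V W n).
    by apply: subspaceI; [apply: span_subspace|apply: gm_homog_subspace].
  suff H : cyclic_set x `&` @gm_homog R V W n `<=` cyclic_set y `&` @gm_homog R V W n.
    by have [] := H x (conj (@cyclic_mem R V W x) xn).
  apply: (set_dim_eq (cS y) (cS x) sub).
    apply: fin_spanned_sub (fin_dim_spanned ((grm_restricted W).2 n)).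
    by move=> z [].
  by rewrite dE; apply: d_min; apply/asboolP; exists y.
pose X := sub_gr (cyclic_submodule x); pose i : module_hom X W := sub_incl (cyclic_submodule x).
have i_inj : injective i := @sub_incl_inj _ _ _ _ _.
have [x' ix'] : exists x', i x' = x by apply: sub_incl_surj; apply: cyclic_mem.
have i_homog m (y : X) : gm_homog m (i y) -> gm_homog m y.
  by move=> iy; rewrite -(i_inj _ _ (etrans (hom_gmpr i m y) (gmpr_id iy))); apply: gmpr_in.
have x'n : gm_homog n x' by apply: i_homog; rewrite ix'.
have i0 y : i y = 0 -> y = 0 by rewrite -(lin0 (hom_linear i)) => /i_inj.
have gen (y : X) : gm_homog n y -> y != 0 -> generates y.
  move=> yn y_neq0 z; apply: (cyclic_inj i_inj).
  apply: (@cyclic_min _ _ _ _ x); first exact: cyclic_submodule.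
    apply: x_min; [exact: sub_incl_in|exact: hom_homog|].
    by apply: contraNN y_neq0 => /eqP /i0 ->.
  exact: sub_incl_in.
pose Z : set X := [set z | forall u k, gmpr n (gm_Y u k z) = 0].
have prl := @gmpr_linear R V X n.
have Z_sub : gen_submodule Z.
  split=> [|u m z Zz v k].
    split=> [u m|a z t Zz Zt u m]; first by rewrite gm_Y0 (lin0 prl).
    by rewrite (gm_bilinear X).1 prl Zz Zt scaler0 addr0.
  have := @cyclic_assoc R V X v u k m z; move: (gm_Y v k _).
  by apply: (span_min (subspace_ker prl)) => _ [v' [k' ->]]; apply: Zz.
have Z_out z : ~ Z z -> exists u k, gmpr n (gm_Y u k z) != 0.
  by move=> /existsNP[u /existsNP[m /eqP]]; exists u, m.
pose Q := quo_gr Z_sub; pose p : module_hom X Q := quo_proj Z_sub.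
have p_surj : surjective_hom p := @quo_proj_surj _ _ _ _ Z_sub.
have px'_neq0 : p x' != 0.
  apply/eqP => /quo_proj_eq0 /(_ (voa_vac V) (-1)).
  rewrite (vm_vacuum (gm_vertex_map X)) eqxx (gmpr_id x'n) => x'0.
  by move: x_neq0; rewrite -ix' x'0 (lin0 (hom_linear i)) eqxx.
exists Q; split.
- split=> [|S S_sub]; first by exists (p x').
  have [S0|/existsNP[s /not_implyP[Ss /eqP s_neq0]]] := EM (forall s, S s -> s = 0).
    left; apply/seteqP; split=> [s /S0 //|_ ->]; exact: subspace0 S_sub.1.
  right; have [z pz] := p_surj s.
  have [u [m y_neq0]] : exists u k, gmpr n (gm_Y u k z) != 0.
    by apply: Z_out => /quo_proj_eq0 pz0; move: s_neq0; rewrite -pz [p z]pz0 eqxx.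
  have Sy : S (p (gmpr n (gm_Y u m z))).
    by rewrite hom_gmpr homY pz; apply: gmpr_sub => //; apply: S_sub.2.
  apply/seteqP; split=> // t _; have [z' <-] := p_surj t.
  apply: (cyclic_min (gen_submodule_preim p S_sub) Sy).
  exact: gen (gmpr_in _ _) y_neq0 z'.
- by apply/homog_neq0; exists (p x') => //; apply: hom_homog.
- move=> j /low lowj; apply/homog_eq0 => q /(homog_surj p_surj)[z zj <-].
  rewrite (i0 z) ?(lin0 (hom_linear p)) //.
  by have := hom_homog i zj; rewrite lowj.
Qed.

Lemma weight_low_weight (W : gr_module V) m : @gm_homog R V W m <> [set 0] ->
  exists k : nat, @gm_homog R V W (m - k%:R) <> [set 0] /\ low_weights (m - k%:R).
Proof.
move=> /(lower_truncated_min (grm_restricted W).1)[k [k0 low]].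
by exists k; split=> //; apply: low_weight_min low.
Qed.

Section Bounded.
Variable N : nat.
Hypothesis VN : forall W1 W2 : gen_module V,
  ordinary_module W1 -> irreducible_module W1 ->
  ordinary_module W2 -> irreducible_module W2 ->
  forall n1 n2 : C, lowest_weight W1 n1 -> lowest_weight W2 n2 ->
  `|complex.Re n1 - complex.Re n2| <= N%:R.

Lemma low_weights_near n1 n2 : low_weights n1 -> low_weights n2 ->
  `|complex.Re n1 - complex.Re n2| <= N%:R.
Proof.
move=> [S1 [irr1 n10 low1]] [S2 [irr2 n20 low2]].
apply: (VN (irreducible_ordinary irr1 (grm_restricted S1)) irr1
           (irreducible_ordinary irr2 (grm_restricted S2)) irr2).
  exact: irreducible_lowest.
exact: irreducible_lowest.
Qed.

Lemma low_weights_near_int n j : low_weights n -> low_weights (n + j%:~R) -> `|j| <= N%:Z.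
Proof.
move=> n1 n2; have := low_weights_near n2 n1.
by rewrite Re_addz addrAC subrr add0r -intr_norm -[N%:R]/(N%:Z%:~R) ler_int.
Qed.

(** A weight more than [N] below [n] would have below it a minimal one, again in [low_weights] but
    too far from [n]. *)
Lemma low_weights_gap (W : gr_module V) n : low_weights n -> gap W N n.
Proof.
move=> n_low j x jN xj; apply: contrapT => /eqP x_neq0.
have : @gm_homog R V W (n + j%:~R) <> [set 0] by apply/homog_neq0; exists x.
move=> /weight_low_weight[k [_]].
rewrite -[- k%:R]/(- k%:Z%:~R) -addrA -intrB => /(low_weights_near_int n_low).
lia.
Qed.
End Bounded.
End Restricted.

(** * Density and the number of irreducible modules *)

Section Density.
Variables (R : realType) (V : voa R).
Local Notation C := R[i].
Implicit Types (W Y T : gen_module V) (l : seq (letter V)).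

Lemma nonzero_homog W (x : W) : x != 0 -> exists n : C, @gm_homog R V W n <> [set 0].
Proof.
move=> x_neq0; have [r [_ _ xE]] := gmpr_seq x.
have /existsNP[n /eqP xn] : ~ forall n, gmpr n x = 0.
  by move=> all0; move: x_neq0; rewrite xE big1 ?eqxx.
by exists n; apply/homog_neq0; exists (gmpr n x) => //; apply: gmpr_in.
Qed.

Lemma irreducible_low_weight (S : gr_module V) : irreducible_module S ->
  exists2 n, low_weights V n & exists2 w : S, gm_homog n w & w != 0.
Proof.
move=> irr; have [x x_neq0] := irr.1; have [m m0] := nonzero_homog x_neq0.
have [k [k0 low]] := lower_truncated_min (grm_restricted S).1 m0.
by exists (m - k%:R); [exists S|apply/homog_neq0].
Qed.

Lemma lact_sum_hom W1 W2 (f : module_hom W1 W2) l x :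
  f (\sum_(a <- l) lact a x) = \sum_(a <- l) lact a (f x).
Proof.
by rewrite (lin_sum (hom_linear f)); apply: eq_bigr => a _; rewrite lact_hom.
Qed.

(** Goursat's argument: otherwise the submodule generated by [(y, w)] meets [S] in zero by
    irreducibility, so it is the graph of a homomorphism sending [y] to the generator [w], which is
    therefore surjective. *)
Lemma cyclic_pair Y (S : gen_module V) (y : Y) (w : S) : irreducible_module S -> generates y -> w != 0 ->
  (forall f : module_hom Y S, ~ surjective_hom f) ->
  @cyclic_set R V (prod_module Y S) (y, w) (0, w).
Proof.
move=> irr gen w_neq0 no_surj; apply: contrapT => out.
pose G := @cyclic_set R V (prod_module Y S) (y, w).
have G_sub : gen_submodule G := cyclic_submodule _.
have K0 : [set s | G (0, s)] = [set 0].
  have [//|KT] := irr.2 _ (gen_submodule_preim (prod_inr Y S) G_sub).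
  by case: out; have : [set: S] w by []; rewrite -KT.
have [||||f fG] := @hom_of_rel R V Y S (fun x s => G (x, s)).
- move=> x; have /cyclicP[l [l_ok xE]] := gen x.
  exists (\sum_(a <- l) lact a w); apply/cyclicP; exists l; split=> //.
  apply: pair_inj; first by rewrite [RHS](lact_sum_hom (prod_fst Y S)).
  by rewrite [RHS](lact_sum_hom (prod_snd Y S)).
- by move=> s Gs; have : [set s | G (0, s)] s by []; rewrite K0.
- by move=> a x x' s s' xs xs'; apply: (G_sub.1.2 a (x, s) (x', s')).
- by move=> u n x s; apply: (G_sub.2 u n (x, s)).
apply: (no_surj f); apply: (generates_surj (w := y)).
suff -> : f y = w by apply: irreducible_generates.
have : G (0, f y - w).
  rewrite -(subrr y); apply: (subspaceB G_sub.1 (u := (y, f y)) (v := (y, w))) => //.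
  exact: cyclic_mem.
by move=> Gs; have : [set s | G (0, s)] (f y - w) by []; rewrite K0 /= => /eqP; rewrite subr_eq0 => /eqP.
Qed.

Variables (S : nat -> gr_module V) (w : forall i, S i).
Variables (r : nat).
Hypothesis S_irr : forall i, (i < r)%N -> irreducible_module (S i).
Hypothesis S_neq : forall i j, (i < j)%N -> (j < r)%N -> ~ equivalent_modules (S i) (S j).
Hypothesis w_neq0 : forall i, (i < r)%N -> w i != 0.

(* Y stands for the direct sum of the first k modules. *)
Lemma irreducible_sum (k : nat) : (k <= r)%N -> exists (Y : gen_module V) (y : Y),
  [/\ generates y,
      forall l, \sum_(a <- l) lact a y = 0 ->
        forall i, (i < k)%N -> \sum_(a <- l) lact a (w i) = 0
    & forall (T : gen_module V) (f : module_hom Y T), irreducible_module T ->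
        surjective_hom f -> exists2 i, (i < k)%N & equivalent_modules (S i) T].
Proof.
elim: k => [_|k IH kr].
  exists (zero_module V), 0; split=> //.
    by move=> x; rewrite (zero_module_eq x 0); apply: span0.
  move=> T f irr f_surj; have [x /eqP[]] := irr.1.
  have [y <-] := f_surj x; rewrite (zero_module_eq y 0).
  exact: lin0 (hom_linear f).
have [Y [y [gen y_sum y_surj]]] := IH (ltnW kr).
have no_surj (f : module_hom Y (S k)) : ~ surjective_hom f.
  by move=> /(y_surj _ _ (S_irr kr))[i ik]; apply: S_neq.
have cyc := cyclic_pair (S_irr kr) gen (w_neq0 kr) no_surj.
exists (prod_module Y (S k)), (y, w k); split.
- move=> [x s].
  have [G_lin G_Y] := cyclic_submodule ((y, w k) : prod_module Y (S k)).
  have Gs : @cyclic_set R V (prod_module Y (S k)) (y, w k) (0, s).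
    apply: (cyclic_min (conj G_lin G_Y) cyc).
    refine (@cyclic_hom R V _ _ (prod_inr Y (S k)) (w k) s _).
    exact: irreducible_generates (S_irr kr) (w_neq0 kr) s.
  have Gy : @cyclic_set R V (prod_module Y (S k)) (y, w k) (y, 0).
    have -> : (y, 0) = ((y, w k) : prod_module Y (S k)) - (0, w k).
      by apply: pair_inj; rewrite /= ?subr0 ?subrr.
    by apply: (subspaceB G_lin) => //; apply: cyclic_mem.
  have Gx : @cyclic_set R V (prod_module Y (S k)) (y, w k) (x, 0).
    apply: (cyclic_min (conj G_lin G_Y) Gy).
    exact (@cyclic_hom R V _ _ (prod_inl Y (S k)) y x (gen x)).
  have -> : (x, s) = ((x, 0) : prod_module Y (S k)) + (0, s).
    by apply: pair_inj; rewrite /= ?addr0 ?add0r.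
  exact: (subspaceD G_lin Gx Gs).
- move=> l l0 i; rewrite ltnS leq_eqVlt => /orP[/eqP ->|ik].
    rewrite -[w k]/(prod_snd Y (S k) (y, w k)) -lact_sum_hom l0.
    exact: lin0 (hom_linear _).
  apply: y_sum ik; rewrite -[y]/(prod_fst Y (S k) (y, w k)) -lact_sum_hom l0.
  exact: lin0 (hom_linear _).
- move=> T f irr f_surj.
  (* Either [f] is nonzero on the new summand, and Schur's lemma applies, or it factors through
     [Y]. *)
  have [f0|/existsNP[s /eqP fs]] := EM (forall s, f (prod_inr Y (S k) s) = 0); last first.
    have [g_inj g_surj] := Schur (f := comp_hom f (prod_inr Y (S k))) (x := s) (S_irr kr) irr fs.
    by exists k => //; apply: (bij_equivalent g_inj g_surj).
  have [|i ik iT] := y_surj T (comp_hom f (prod_inl Y (S k))) irr; last first.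
    by exists i => //; apply: ltnW.
  move=> t; have [[x s] <-] := f_surj t; exists x.
  have -> : (x, s) = prod_inl Y (S k) x + prod_inr Y (S k) s.
    by apply: pair_inj; rewrite /= ?addr0 ?add0r.
  by rewrite (linD (hom_linear f)) f0 addr0.
Qed.

Variables (N : nat) (n : nat -> C).
Hypothesis w_homog : forall i, (i < r)%N -> gm_homog (n i) (w i).

(** A sum of modes takes [(y, w k)] to [(0, w k)], where [y] records all earlier [w i]. Its letters
    of shift 0 add up to [u], because the [w i] are homogeneous. *)
Lemma zero_mode_select (k : nat) : (k < r)%N -> exists u : V,
  zero_mode (w k) u = w k /\ forall i, (i < k)%N -> zero_mode (w i) u = 0.
Proof.
move=> kr; have [Y [y [gen y_sum y_surj]]] := irreducible_sum (ltnW kr).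
have no_surj (f : module_hom Y (S k)) : ~ surjective_hom f.
  by move=> /(y_surj _ _ (S_irr kr))[i ik]; apply: S_neq.
have /cyclicP[l [l_ok lE]] := cyclic_pair (S_irr kr) gen (w_neq0 kr) no_surj.
have zE i : (i < r)%N -> zero_mode (w i) (\sum_(a <- l | a.2 == 0) a.1.1) =
    gmpr (n i) (\sum_(a <- l) lact a (w i)).
  move=> ir; rewrite [X in gmpr X _](_ : n i = n i + 0%:~R); last by rewrite addr0.
  rewrite (gmpr_lact_sum _ l_ok (w_homog ir)).
  rewrite (lin_sum (zero_mode_linear (w i))) big_seq_cond [RHS]big_seq_cond.
  apply: eq_bigr => a /andP[/l_ok oka /eqP a0].
  by rewrite (zero_modeE _ oka) /lact a0 subr0.
exists (\sum_(a <- l | a.2 == 0) a.1.1); split=> [|i ik].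
  rewrite zE // -[X in gmpr _ X](lact_sum_hom (prod_snd Y (S k)) l (y, w k)) -lE.
  exact: gmpr_id (w_homog kr).
rewrite zE; last exact: ltn_trans kr.
rewrite (y_sum l) ?(lin0 (gmpr_linear _)) //.
by rewrite -[LHS](lact_sum_hom (prod_fst Y (S k)) l (y, w k)) -lE.
Qed.

Hypothesis S_gap : forall i, (i < r)%N -> gap (S i) N (n i).

(** The classes of the selected [u k] are independent in [A_N(V)] by triangularity: evaluating a
    relation at [w k], the terms [j < k] vanish by induction and the terms [j > k] kill [w k]. *)
Lemma irreducibles_le (s : seq (zhu_algebra V N)) : [set: zhu_algebra V N] = span [set` s] ->
  (r <= size s)%N.
Proof.
move=> sE; have /choice[u uP] (k : nat) : exists u : V, (k < r)%N ->
    zero_mode (w k) u = w k /\ forall i, (i < k)%N -> zero_mode (w i) u = 0.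
  have [kr|_] := boolP (k < r)%N; last by exists 0.
  by have [u uP] := zero_mode_select kr; exists u.
pose O := zhu_O_gen (V := V) N; pose p (x : V) : zhu_algebra V N := (\pi_(quot_span O) x)%qT.
have pl : linear p by move=> a x y; rewrite /p quot_piD -quot_scaleE.
apply: (@free_family_le _ _ _ (fun i : 'I_r => p (u i))) => [c c0 i|i]; last by rewrite -sE.
have cO : span O (\sum_(i < r) c i *: u i).
  rewrite -[X in span O X]subr0; apply/quot_eq; rewrite -/(p _) -/(p 0) (lin0 pl) -c0.
  by rewrite (lin_sum pl); apply: eq_bigr => j _; rewrite (linZ pl).
have := ltn_ord i; move iE : (val i) => k kr.
elim/ltn_ind: k => k IH in i iE kr *.
have ml := zero_mode_linear (w k).
have := zero_mode_zhu (S_gap kr) (w_homog kr) cO.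
rewrite (lin_sum ml) (bigD1 i) //= (linZ ml) iE (uP k kr).1 big1 ?addr0 => [|j ji].
  by move/eqP; rewrite scaler_eq0 (negPf (w_neq0 kr)) orbF => /eqP.
have [jk|kj] := ltnP j k; first by rewrite (IH j jk) ?scale0r ?(lin0 ml).
rewrite (linZ ml) (uP j (ltn_ord j)).2 ?scaler0 // ltn_neqAle kj andbT.
by rewrite -iE; apply: contraNneq ji => /val_inj ->.
Qed.
End Density.

Lemma irreducibles_finite (R : realType) (V : voa R) (N : nat) :
  fin_dim [set: zhu_algebra V N] ->
  (forall (S : gr_module V) n, low_weights V n -> gap S N n) ->
  exists (k : nat) (S : 'I_k -> gr_module V), (forall i, irreducible_module (S i)) /\
    forall W : gr_module V, irreducible_module W -> exists i, equivalent_modules W (S i).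
Proof.
move=> [s sE] all_gap.
pose P r := `[< exists S : nat -> gr_module V,
  (forall i, (i < r)%N -> irreducible_module (S i)) /\
  (forall i j, (i < j)%N -> (j < r)%N -> ~ equivalent_modules (S i) (S j)) >].
have exP : exists r, P r by exists 0%N; apply/asboolP; exists (fun=> zero_gr V).
have P_ub r : P r -> (r <= size s)%N.
  move=> /asboolP[S [S_irr S_neq]].
  have ex i : exists w : S i, exists n : R[i], (i < r)%N ->
      [/\ w != 0, gm_homog n w & gap (S i) N n].
    have [ir|_] := boolP (i < r)%N; last by exists 0, 0.
    have [n n_low [w wn w_neq0]] := irreducible_low_weight (S_irr i ir).
    by exists w, n => _; split=> //; apply: all_gap.
  (* The type of [w i] depends on [i], so the vectors are chosen pointwise, and the weights
     afterwards. *)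
  pose w i := projT1 (cid (ex i)).
  have /choice[n nP] i : exists n : R[i], (i < r)%N ->
      [/\ w i != 0, gm_homog n (w i) & gap (S i) N n].
    by rewrite /w; case: cid.
  apply: (@irreducibles_le R V S w r S_irr S_neq _ N n _ _ s sE) => i ir.
  - by have [] := nP i ir.
  - by have [] := nP i ir.
  - by have [] := nP i ir.
case: (ex_maxnP exP P_ub) => r /asboolP[S [S_irr S_neq]] r_max.
exists r, (fun i : 'I_r => S i); split=> [i|W W_irr]; first exact: S_irr.
apply: contrapT => /forallNP no; suff /r_max : P r.+1 by rewrite ltnn.
pose S' i := if i == r then W else S i.
have S'r : S' r = W by rewrite /S' eqxx.
have S'i i : (i < r)%N -> S' i = S i by move=> ir; rewrite /S' ltn_eqF.
apply/asboolP; exists S'; split=> [i|i j ij].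
  by rewrite ltnS leq_eqVlt => /orP[/eqP ->|ir]; rewrite ?S'r ?S'i //; apply: S_irr.
rewrite ltnS leq_eqVlt => /orP[/eqP jr|jr].
  have ir : (i < r)%N by rewrite -jr.
  by rewrite jr S'r S'i // => /equivalent_sym; apply: (no (Ordinal ir)).
by rewrite !S'i ?(ltn_trans ij) //; apply: S_neq.
Qed.

(** * Finite length and projective covers *)

Section LowPart.
Variables (R : realType) (V : voa R).
Local Notation C := R[i].
Implicit Types (W X Y : gr_module V).

(** The space [F(W)], described by vanishing components rather than as a sum over [L], so that its
    formal properties hold before [L] is known to be finite. *)
Definition low_part (W : gen_module V) : set W :=
  [set x | forall n, ~ low_weights V n -> gmpr n x = 0].

Arguments low_part : clear implicits.

Lemma low_part_subspace (W : gen_module V) : subspace (low_part W).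
Proof.
split=> [n _|a x y x0 y0 n n_low]; first exact: lin0 (gmpr_linear n).
by rewrite gmpr_linear x0 // y0 // scaler0 addr0.
Qed.

Lemma low_part_homog (W : gen_module V) n (x : W) : low_weights V n -> gm_homog n x ->
  low_part W x.
Proof.
by move=> n_low xn m m_low; rewrite (gmprE _ xn); case: eqP => // mn; rewrite mn in m_low.
Qed.

Lemma low_part_hom (W W' : gen_module V) (f : module_hom W W') x : low_part W x ->
  low_part W' (f x).
Proof. by move=> x0 n /x0 xn; rewrite -hom_gmpr xn (lin0 (hom_linear f)). Qed.

Lemma low_part_lift (W W' : gen_module V) (f : module_hom W W') (S : set W) x :
  gen_submodule S -> S x -> low_part W' (f x) ->
  exists x', [/\ S x', low_part W x' & f x' = f x].
Proof.
move=> S_sub Sx fx; have [r [_ _ xE]] := gmpr_seq x.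
exists (\sum_(n <- r | `[< low_weights V n >]) gmpr n x); split.
- by apply: (subspace_sum S_sub.1) => n _; apply: gmpr_sub.
- apply: (subspace_sum (low_part_subspace W)) => n /asboolP n_low.
  by apply: low_part_homog n_low _; apply: gmpr_in.
- rewrite [in RHS]xE !(lin_sum (hom_linear f)) [LHS]big_mkcond; apply: eq_bigr => n _.
  by case: asboolP => // n_low; rewrite hom_gmpr fx.
Qed.

Lemma submodule_low_weight W (S : set W) x : gen_submodule S -> S x -> x != 0 ->
  exists n y, [/\ low_weights V n, S y, gm_homog n y & y != 0].
Proof.
move=> S_sub Sx x_neq0; have [x' x'E] := sub_incl_surj S_sub Sx.
have i_lin := hom_linear (sub_incl S_sub).
have x'_neq0 : x' != 0 by apply: contraNneq x_neq0 => x'0; rewrite -x'E x'0 (lin0 i_lin).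
have [m /(@weight_low_weight R V (sub_gr S_sub))[k [k0 k_low]]] := nonzero_homog x'_neq0.
have /homog_neq0[y yk y_neq0] := k0.
have Sy : S (sub_incl S_sub y) by apply: sub_incl_in.
exists (m - k%:R), (sub_incl S_sub y); split=> //.
exact: hom_homog.
Qed.

Lemma submodule_low_part0 W (S : set W) : gen_submodule S ->
  (forall x, S x -> low_part W x -> x = 0) -> forall x, S x -> x = 0.
Proof.
move=> S_sub S0 x Sx; apply: contrapT => /eqP /(submodule_low_weight S_sub Sx).
move=> [n [y [n_low Sy yn]]]; rewrite (S0 y) ?eqxx //.
exact: low_part_homog yn.
Qed.

(** Otherwise the image of [S'] in the quotient by [S] is nonzero, so contains a nonzero vector with
    weight in [L], and this vector lifts to [S'] in the same weight. *)
Lemma submodule_low_part_le W (S S' : set W) : gen_submodule S -> gen_submodule S' ->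
  S' `&` low_part W `<=` S -> S' `<=` S.
Proof.
move=> S_sub S'_sub le x S'x; apply: contrapT => Sx.
pose p := quo_proj S_sub; have pS'_sub := gen_submodule_img p S'_sub.
have px_neq0 : p x != 0 by apply/eqP => /quo_proj_eq0.
have [n [y [n_low [z S'z zy] yn /eqP[]]]] :=
  @submodule_low_weight (quo_gr S_sub) _ _ pS'_sub (ex_intro2 _ _ x S'x erefl) px_neq0.
rewrite -(gmpr_id yn) -zy -hom_gmpr; apply/quo_proj_eq0; apply: le; split.
  exact: gmpr_sub.
by apply: low_part_homog n_low _; apply: gmpr_in.
Qed.

Hypothesis low_part_fin : forall W, fin_spanned (low_part W).

Definition low_dim W : nat := set_dim (low_part W).
Definition sub_dim W (S : set W) : nat := set_dim (S `&` low_part W).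

Lemma sub_low_part_fin W (S : set W) : fin_spanned (S `&` low_part W).
Proof. by apply: fin_spanned_sub (low_part_fin W) => x []. Qed.

Lemma sub_low_part_subspace W (S : set W) : gen_submodule S -> subspace (S `&` low_part W).
Proof. by move=> S_sub; apply: subspaceI S_sub.1 (low_part_subspace W). Qed.

Lemma sub_dim_strict W (S S' : set W) : gen_submodule S -> gen_submodule S' ->
  S `<=` S' -> (sub_dim S' <= sub_dim S)%N -> S' `<=` S.
Proof.
move=> S_sub S'_sub SS' le_dim; apply: submodule_low_part_le => // x xS'.
have sub : S `&` low_part W `<=` S' `&` low_part W by move=> y [Sy Fy]; split=> //; apply: SS'.
by have [] := set_dim_eq (sub_low_part_subspace S_sub) (sub_low_part_subspace S'_sub) sub
  (sub_low_part_fin S') le_dim xS'.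
Qed.

Lemma sub_dimT W : sub_dim [set: W] = low_dim W.
Proof. by rewrite /sub_dim setTI. Qed.

Lemma low_dim_inj (X W : gr_module V) (f : module_hom X W) (S : set W) : injective f ->
  (forall x, S (f x)) -> (low_dim X <= sub_dim S)%N.
Proof.
move=> f_inj Sf; apply: (set_dim_inj (hom_linear f)) => //.
- exact: low_part_subspace.
- by move=> _ [x Fx <-]; split=> //; apply: low_part_hom.
- exact: sub_low_part_fin.
- by move=> x _; rewrite -(lin0 (hom_linear f)) => /f_inj.
Qed.

(** Among proper submodules one with [sub_dim] maximal is a maximal submodule, by [sub_dim_strict].
    The quotient is irreducible, and the submodule has smaller [low_dim]. *)
Lemma gr_finite_length W : finite_length W.
Proof.
have [m] := ubnP (low_dim W); elim: m W => // m IH W; rewrite ltnS => Wm.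
have [W0|/existsNP[x0 x0_neq0]] := EM (forall w : W, w = 0); first exact: finite_length_zero.
pose P d := `[< exists S : set W, [/\ gen_submodule S, ~ (forall x, S x) & sub_dim S = d] >].
have exP : exists d, P d.
  exists (sub_dim [set 0 : W]); apply/asboolP; exists [set 0]; split=> //.
    exact: gen_submodule0.
  by move=> /(_ x0) /x0_neq0.
have P_ub d : P d -> (d <= low_dim W)%N.
  move=> /asboolP[S [_ _ <-]]; apply: set_dim_mono (low_part_fin W).
  by move=> x [].
case: (ex_maxnP exP P_ub) => d /asboolP[S [S_sub S_proper dE]] d_max.
have S_dim : (sub_dim S < low_dim W)%N.
  rewrite ltnNge; apply/negP => le; apply: S_proper => x.
  apply: (sub_dim_strict S_sub (gen_submoduleT W)) => //.
  by rewrite sub_dimT.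
apply: (@finite_length_ext R V (sub_gr S_sub) W (quo_gr S_sub)
  (sub_incl S_sub) (quo_proj S_sub)).
- apply: IH; apply: leq_trans Wm; apply: leq_ltn_trans S_dim.
  by apply: (@low_dim_inj (sub_gr S_sub) W (sub_incl S_sub)) => //; apply: sub_incl_in.
- split=> [|T T_sub].
    have /existsNP[x Sx] := S_proper; exists (quo_proj S_sub x).
    by apply/eqP => /quo_proj_eq0.
  have T'_sub := gen_submodule_preim (quo_proj S_sub) T_sub.
  have [T'_all|T'_proper] := EM (forall x, T (quo_proj S_sub x)).
    right; apply/seteqP; split=> // t _.
    by have [x <-] := @quo_proj_surj _ _ _ _ S_sub t.
  left; apply/seteqP; split=> [t|_ ->]; last exact: subspace0 T_sub.1.
  have [x <-] := @quo_proj_surj _ _ _ _ S_sub t => Tx; apply/quo_proj_eq0.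
  apply: (sub_dim_strict S_sub T'_sub _ _ Tx).
    move=> y /(quo_proj_eq0 S_sub) y0.
    suff : T (quo_proj S_sub y) by [].
    by rewrite y0; apply: subspace0 T_sub.1.
  by rewrite dE; apply: d_max; apply/asboolP; exists (quo_proj S_sub @^-1` T).
- split; [exact: sub_incl_inj|exact: quo_proj_surj|move=> y; split].
    by move=> /quo_proj_eq0 /(sub_incl_surj S_sub).
  by move=> [x <-]; apply/quo_proj_eq0; apply: sub_incl_in.
Qed.

(** A homomorphism vanishing on [F(X)] is zero, and its values on [F(X)] lie in [F(Y)]. The
    vanishing conditions at a finite basis list [s] are removed one by one, each costing at most a
    subspace of [F(Y)]. *)
Lemma gr_hom_fin X Y : fin_dim [set: (module_hom X Y : lmodType C)].
Proof.
apply: fin_spanned_dim; first exact: subspace_setT.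
have [s sE] := fin_spanned_dim (low_part_subspace X) (low_part_fin X).
have sF x : x \in s -> low_part X x by move=> xs; rewrite sE; apply: (@sub_span _ _ [set` s]).
pose H (t : seq X) : set (module_hom X Y) := [set f | forall x, x \in t -> f x = 0].
have H_sub t : subspace (H t).
  split=> [x _ //|a f g f0 g0 x xt].
  rewrite -[LHS]/(a *: f x + g x) f0 // g0 // scaler0 addr0 //.
suff Hnil : fin_spanned (H [::]) by apply: fin_spanned_sub Hnil.
have Hs : fin_spanned (H s).
  exists [::] => f f0; suff -> : f = 0 by apply: span0.
  apply: hom_ext => x; apply: (submodule_low_part_le (gen_submodule_ker f)
    (gen_submoduleT X)) => // y [_]; rewrite sE.
  apply: (span_min (subspace_ker (hom_linear f))) => z; exact: f0.
elim: s sF Hs {sE} => [//|x s IH] sF Hs; apply: IH.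
  by move=> y ys; apply: sF; rewrite inE ys orbT.
have ev_lin : linear (fun f : module_hom X Y => f x) by [].
apply: (fin_spanned_ker ev_lin) => //.
  apply: fin_spanned_sub (low_part_fin Y) => _ [f _ <-]; apply: low_part_hom.
  by apply: sF; rewrite inE eqxx.
apply: fin_spanned_sub Hs => f [f0 /= fx0] y; rewrite inE => /orP[/eqP -> //|].
exact: f0.
Qed.

Section Universal.
Variables (n : C) (B : nat).
Hypothesis low_dim_bound : forall W (w : W), gm_homog n w -> generates w -> (low_dim W <= B)%N.

(* A pair (W, w) of maximal dimension is universal: the submodule of W x X generated by
   (w, x) is no larger than W, hence projects isomorphically onto it. *)
Lemma universal_module : exists (P : gr_module V) (w : P), [/\ gm_homog n w, generates w &
  forall X (x : X), gm_homog n x -> exists g : module_hom P X, g w = x].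
Proof.
pose Q d := `[< exists W (w : W), [/\ gm_homog n w, generates w & low_dim W = d] >].
have exQ : exists d, Q d.
  exists (low_dim (zero_gr V)); apply/asboolP; exists (zero_gr V), 0; split=> //.
    exact: subspace0 (gm_homog_subspace _ n).
  by move=> x; rewrite (zero_module_eq x 0); apply: span0.
have Q_ub d : Q d -> (d <= B)%N by move=> /asboolP[W [w [wn gen <-]]]; apply: low_dim_bound gen.
case: (ex_maxnP exQ Q_ub) => d /asboolP[P [w [wn gen dE]]] d_max.
exists P, w; split=> // X x xn.
pose G := @cyclic_set R V (prod_gr P X) (w, x).
have G_sub : gen_submodule G := cyclic_submodule _.
pose Z := sub_gr G_sub; pose i : module_hom Z (prod_gr P X) := sub_incl G_sub.
have i_inj : injective i := @sub_incl_inj _ _ _ _ G_sub.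
have [z zE] : exists z : Z, i z = (w, x) by apply: sub_incl_surj; apply: cyclic_mem.
have zn : gm_homog n z.
  suff : gmpr n z = z by move=> <-; apply: gmpr_in.
  apply: i_inj; rewrite hom_gmpr zE; apply: pair_inj.
    by rewrite -[LHS]/(prod_fst P X _) hom_gmpr; apply: gmpr_id.
  by rewrite -[LHS]/(prod_snd P X _) hom_gmpr; apply: gmpr_id.
have z_gen : generates z.
  by move=> t; apply: (cyclic_inj i_inj); rewrite zE; exact (sub_incl_in t).
pose p : module_hom Z P := comp_hom (prod_fst P X) i.
have pz : p z = w := congr1 fst zE.
have p_surj : surjective_hom p by apply: (generates_surj (w := z)); rewrite pz.
have p0 t : p t = 0 -> t = 0.
  apply: (submodule_low_part0 (gen_submodule_ker p)) => {}t pt0 Ft.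
  apply: (set_dim_surj_inj (hom_linear p) (low_part_subspace Z) (low_part_fin Z)
    _ (low_part_fin P) _ Ft pt0).
    move=> y Fy; have [y' y'E] := p_surj y; rewrite -y'E in Fy.
    have [t' [_ Ft' t'E]] := low_part_lift (gen_submoduleT Z) I Fy.
    by exists t'; rewrite // t'E.
  by rewrite -/(low_dim P) dE; apply: d_max; apply/asboolP; exists Z, z.
(* Since [p] is now bijective, the relation below is the graph of [q] after the inverse of [p]. *)
pose q : module_hom Z X := comp_hom (prod_snd P X) i.
have [||||g gP] := @hom_of_rel R V P X (fun a b => exists2 t, p t = a & q t = b).
- by move=> a; have [t tE] := p_surj a; exists (q t), t.
- by move=> b [t /p0 -> <-]; apply: lin0 (hom_linear q).
- move=> c a a' b b' [t <- <-] [t' <- <-]; exists (c *: t + t'); exact: hom_linear.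
- by move=> u k a b [t <- <-]; exists (gm_Y u k t); apply: homY.
exists g; have [t tE <-] := gP w.
have -> : t = z by apply: (hom_inj p0); rewrite tE pz.
exact (congr1 snd zE).
Qed.

(** A map out of [P] is determined by the image of [w], and vectors of weight [n] lift along
    surjections to vectors of weight [n]. *)
Lemma projective_generator : exists (P : gr_module V) (w : P), [/\ gm_homog n w, projective P &
  forall X (x : X), gm_homog n x -> exists g : module_hom P X, g w = x].
Proof.
have [P [w [wn gen univ]]] := universal_module; exists P, w; split=> //.
move=> X Y q f q_surj; have fw := hom_homog f wn.
have [x xn xE] := homog_surj q_surj fw.
have [g gw] := univ X x xn; exists g; apply: (generates_hom_ext gen).
by rewrite /= gw.
Qed.
End Universal.

Lemma retract_projective (U I : gr_module V) (i : module_hom I U) (r : module_hom U I) :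
  projective U -> cancel i r -> projective I.
Proof.
move=> U_proj ri X Y q f q_surj.
have [g gE] := U_proj X Y q (comp_hom f r) q_surj; exists (comp_hom g i).
apply: hom_ext => x; have e := congr1 (fun h : module_hom U Y => h (i x)) gE.
by apply: etrans e _; rewrite /= ri.
Qed.

(* Fitting's argument: replacing e by a similar endomorphism with minimal image gives a
   retraction onto a projective module that still covers S. *)
Lemma minimal_projective_endo (S U : gr_module V) (p : module_hom U S) (e0 : module_hom U U) :
  projective U -> surjective_hom p ->
  (forall (U' : gr_module V) (p' : module_hom U' S), projective U' -> surjective_hom p' ->
     (low_dim U <= low_dim U')%N) ->
  comp_hom p e0 = p -> surjective_hom e0.
Proof.
move=> U_proj p_surj U_min pe0.
have pe_eq (e : module_hom U U) : comp_hom p e = p -> forall u, p (e u) = p u.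
  by move=> pe u; rewrite -[in RHS]pe.
have im_sub (e : module_hom U U) : gen_submodule (e @` [set: U]).
  exact: gen_submodule_img (gen_submoduleT U).
(* Keeping the image inside that of [e0] is what finally returns surjectivity to [e0]. *)
pose P d := `[< exists e : module_hom U U, [/\ comp_hom p e = p,
  e @` [set: U] `<=` e0 @` [set: U] & sub_dim (e @` [set: U]) = d] >].
have exP : exists d, P d.
  exists (sub_dim (e0 @` [set: U])); apply/asboolP; exists e0; split=> //.
case: (ex_minnP exP) => d /asboolP[e [pe ee0 dE]] d_min.
set I := e @` [set: U] in ee0 dE *; have I_sub : gen_submodule I := im_sub e.
have eI u : I (e u) by exists u.
(* The square of [e] is again a competitor, so by minimality its image is not smaller: [e] maps [I]
   onto itself, hence bijectively. *)
have I_ee : I `<=` e @` I.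
  have ee_I : (comp_hom e e) @` [set: U] `<=` I by move=> _ [u _ <-]; apply: eI.
  have : I `<=` (comp_hom e e) @` [set: U].
    apply: (sub_dim_strict (im_sub _) I_sub ee_I); rewrite dE; apply: d_min.
    apply/asboolP; exists (comp_hom e e); split=> //.
      by apply: hom_ext => u /=; rewrite !pe_eq.
    exact: subset_trans ee0.
  by move=> H x /H[u _ <-]; exists (e u).
have e_inj x : I x -> e x = 0 -> x = 0.
  move=> Ix ex0; have K_sub := gen_submoduleI I_sub (gen_submodule_ker e).
  apply: (submodule_low_part0 K_sub _ (conj Ix ex0)) => {Ix ex0}x [Ix ex0] Fx.
  apply: (set_dim_surj_inj (hom_linear e) (sub_low_part_subspace I_sub)
    (sub_low_part_fin I) _ (sub_low_part_fin I) (leqnn _) (conj Ix Fx) ex0).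
  move=> y [/I_ee[x' Ix' <-] Fy].
  have [x'' [Ix'' Fx'' <-]] := low_part_lift I_sub Ix' Fy.
  by exists x''.
pose J := sub_gr I_sub; pose i : module_hom J U := sub_incl I_sub.
have iI x : I (i x) := @sub_incl_in _ _ _ _ I_sub x.
have i_inj : injective i := @sub_incl_inj _ _ _ _ I_sub.
have ei_inj x y : e (i x) = e (i y) -> x = y.
  move=> exy; apply: i_inj; apply/eqP; rewrite -subr_eq0; apply/eqP/e_inj.
    by apply: (subspaceB I_sub.1).
  by rewrite (linB (hom_linear e)) exy subrr.
(* The retraction [r] is [e] followed by the inverse of its restriction to [I]. *)
have [||||r rP] := @hom_of_rel R V U J (fun u x => e (i x) = e u).
- move=> u; have [x Ix xE] := I_ee _ (eI u).
  by have [x' x'E] := sub_incl_surj I_sub Ix; exists x'; rewrite [i x']x'E.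
- by move=> x; rewrite -(lin0 (hom_linear i)) => /ei_inj.
- by move=> a u v x y xu yv; rewrite (hom_linear i) !(hom_linear e) xu yv.
- by move=> u k v x xv; rewrite !homY xv.
have ri : cancel i r by move=> x; apply: ei_inj; rewrite rP.
have le : (low_dim U <= low_dim J)%N.
  apply: (U_min J (comp_hom p i)); first exact: retract_projective ri.
  move=> s; have [u <-] := p_surj s; have [x xE] := sub_incl_surj I_sub (eI u).
  by exists x; apply: etrans (congr1 p xE) _; apply: pe_eq.
have UI : [set: U] `<=` I.
  apply: (sub_dim_strict I_sub (gen_submoduleT U)) => //.
  by rewrite sub_dimT; apply: leq_trans le _; apply: low_dim_inj i_inj iI.
by move=> u; have [u' _ <-] := ee0 _ (UI u Logic.I); exists u'.
Qed.

Lemma minimal_projective_cover (S U0 : gr_module V) (p0 : module_hom U0 S) :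
  projective U0 -> surjective_hom p0 ->
  exists (U : gr_module V) (p : module_hom U S), projective_cover p.
Proof.
move=> U0_proj p0_surj.
pose P d := `[< exists (U : gr_module V) (p : module_hom U S),
  [/\ projective U, surjective_hom p & low_dim U = d] >].
have exP : exists d, P d by exists (low_dim U0); apply/asboolP; exists U0, p0.
case: (ex_minnP exP) => d /asboolP[U [p [U_proj p_surj dE]]] d_min.
exists U, p; split=> // W q W_proj q_surj.
have [qt pqt] := W_proj U S p q p_surj; have [r qr] := U_proj W S q p q_surj.
exists qt => //.
(* Lifting [q] through [p] and [p] through [q] yields an endomorphism of [U] over [S]; its
   surjectivity forces that of [qt]. *)
have surj : surjective_hom (comp_hom qt r).
  apply: minimal_projective_endo p_surj _ _ => //.
    by move=> U' p' U'_proj p'_surj; rewrite dE; apply: d_min; apply/asboolP; exists U', p'.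
  by rewrite -[RHS]qr -[in RHS]pqt; apply: hom_ext.
by move=> u; have [u' <-] := surj u; exists (r u').
Qed.
End LowPart.

(** * The abelian category *)

Section Abelian.
Variables (R : realType) (V : voa R).
Implicit Types X Y T M : gr_module V.

Lemma factor_injective X T M (i : module_hom M X) (g : module_hom T X) : injective i ->
  (forall t, exists m, i m = g t) -> exists! h : module_hom T M, comp_hom i h = g.
Proof.
move=> i_inj ig; have [||||h hP] := @hom_of_rel R V T M (fun t m => i m = g t).
- exact: ig.
- move=> m; rewrite (lin0 (hom_linear g)) -(lin0 (hom_linear i)).
  exact: i_inj.
- by move=> a x y z t iz it; rewrite (hom_linear i) (hom_linear g) iz it.
- by move=> u n x y xy; rewrite !homY xy.
exists h; split=> [|h' h'E]; first exact: hom_ext.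
by apply: hom_ext => t; apply: i_inj; rewrite hP -h'E.
Qed.

Lemma factor_surjective X T M (p : module_hom X M) (g : module_hom X T) : surjective_hom p ->
  (forall x, p x = 0 -> g x = 0) -> exists! h : module_hom M T, comp_hom h p = g.
Proof.
move=> p_surj pg.
have [||||h hP] := @hom_of_rel R V M T (fun m t => exists2 x, p x = m & g x = t).
- by move=> m; have [x xm] := p_surj m; exists (g x), x.
- by move=> t [x /pg ->].
- by move=> a x y z t [x' <- <-] [y' <- <-]; exists (a *: x' + y'); apply: hom_linear.
- by move=> u n x y [x' <- <-]; exists (gm_Y u n x'); apply: homY.
have hE x : h (p x) = g x.
  have [x' x'E <-] := hP (p x); apply/eqP; rewrite -subr_eq0 -(linB (hom_linear g)).
  by apply/eqP/pg; rewrite (linB (hom_linear p)) x'E subrr.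
exists h; split=> [|h' h'E]; first exact: hom_ext.
by apply: hom_ext => m; have [x <-] := p_surj m; rewrite hE -h'E.
Qed.

Local Notation A := (gr_module_category V).

Lemma monic_injective (X Y : gr_module V) (f : module_hom X Y) : @monic _ A X Y f -> injective f.
Proof.
move=> f_monic; have K_sub := gen_submodule_ker f.
have f0 : comp_hom f (sub_incl K_sub) = comp_hom f 0.
  apply: hom_ext => x; apply: etrans (sub_incl_in x) _.
  by rewrite -[LHS](lin0 (hom_linear f)).
have e : sub_incl K_sub = 0 := f_monic (sub_gr K_sub) (sub_incl K_sub) 0 f0.
apply: hom_inj => x fx0; have [x' <-] := sub_incl_surj K_sub fx0.
by rewrite e.
Qed.

Lemma epic_surjective (X Y : gr_module V) (f : module_hom X Y) :
  @epic _ A X Y f -> surjective_hom f.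
Proof.
move=> f_epic; have I_sub := gen_submodule_img f (gen_submoduleT X).
have f0 : comp_hom (quo_proj I_sub) f = comp_hom 0 f.
  by apply: hom_ext => x; apply/(quo_proj_eq0 I_sub); exists x.
have e : quo_proj I_sub = 0 := f_epic (quo_gr I_sub) (quo_proj I_sub) 0 f0.
move=> y; have /quo_proj_eq0[x _ xy] : quo_proj I_sub y = 0 by rewrite e.
by exists x.
Qed.

Lemma gr_module_abelian : is_abelian A.
Proof.
split.
- exists (zero_gr V : A) => X; split=> f; apply: hom_ext => x.
    exact: zero_module_eq.
  rewrite (zero_module_eq x 0); exact: lin0 (hom_linear (f : module_hom _ _)).
- move=> X Y; exists (prod_gr X Y : A), (prod_inl X Y), (prod_inr X Y),
    (prod_fst X Y), (prod_snd X Y).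
  split; apply: hom_ext => // -[x y]; apply: pair_inj => /=; first exact: addr0.
  exact: add0r.
- move=> X Y f; have K_sub := gen_submodule_ker (f : module_hom X Y).
  exists (sub_gr K_sub : A), (sub_incl K_sub); split.
    by apply: hom_ext => x; apply: (sub_incl_in x).
  move=> T g fg; apply: factor_injective; first exact: sub_incl_inj.
  move=> t; apply: (sub_incl_surj K_sub).
  exact: (congr1 (fun h : module_hom T Y => h t) fg).
- move=> X Y f; have I_sub := gen_submodule_img (f : module_hom X Y) (gen_submoduleT X).
  exists (quo_gr I_sub : A), (quo_proj I_sub); split.
    by apply: hom_ext => x; apply/(quo_proj_eq0 I_sub); exists x.
  move=> T g gf; apply: factor_surjective; first exact: quo_proj_surj.
  move=> y /quo_proj_eq0[x _ <-].
  exact: (congr1 (fun h : module_hom X T => h x) gf).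
- move=> X Y f /monic_injective f_inj.
  have I_sub := gen_submodule_img (f : module_hom X Y) (gen_submoduleT X).
  exists (quo_gr I_sub : A), (quo_proj I_sub); split.
    by apply: hom_ext => x; apply/(quo_proj_eq0 I_sub); exists x.
  move=> T g pg; apply: factor_injective => // t.
  have /quo_proj_eq0[x _ xt] : quo_proj I_sub ((g : module_hom T Y) t) = 0.
    exact: (congr1 (fun h : module_hom T (quo_gr I_sub) => h t) pg).
  by exists x.
- move=> X Y f /epic_surjective f_surj; have K_sub := gen_submodule_ker (f : module_hom X Y).
  exists (sub_gr K_sub : A), (sub_incl K_sub); split.
    by apply: hom_ext => x; apply: (sub_incl_in x).
  move=> T g gi; apply: factor_surjective => // x fx0.
  have [k <-] := sub_incl_surj K_sub fx0.
  exact: (congr1 (fun h : module_hom (sub_gr K_sub) T => h k) gi).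
Qed.
End Abelian.

(** * Finiteness from the hypotheses on the vertex operator algebra *)

Section Finiteness.
Variables (R : realType) (V : voa R) (N : nat).
Hypothesis VN : forall W1 W2 : gen_module V,
  ordinary_module W1 -> irreducible_module W1 ->
  ordinary_module W2 -> irreducible_module W2 ->
  forall n1 n2 : R[i], lowest_weight W1 n1 -> lowest_weight W2 n2 ->
  `|complex.Re n1 - complex.Re n2| <= N%:R.
Hypothesis V_C1 : C1_cofinite V.
Hypothesis V_zhu : fin_dim [set: zhu_algebra V N].

Lemma irreducible_list : exists (k : nat) (S : 'I_k -> gr_module V),
  (forall i, irreducible_module (S i)) /\
  forall W : gr_module V, irreducible_module W -> exists i, equivalent_modules W (S i).
Proof.
by apply: irreducibles_finite V_zhu _ => S n; apply: low_weights_gap VN _ _.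
Qed.

(** An irreducible module has one minimal weight: of two such weights, each is the other plus a
    natural number. Equivalent modules share it, so the finite list of irreducible modules gives the
    list. *)
Lemma low_weights_finite : exists L : seq R[i], forall n, low_weights V n -> n \in L.
Proof.
have [k [S [S_irr S_all]]] := irreducible_list.
have /choice[m mP] i : exists m, @gm_homog R V (S i) m <> [set 0] /\
    forall j : int, j < 0 -> @gm_homog R V (S i) (m + j%:~R) = [set 0].
  have [x x_neq0] := (S_irr i).1; have [m m0] := nonzero_homog x_neq0.
  have [l lP] := lower_truncated_min (grm_restricted (S i)).1 m0.
  by exists (m - l%:R).
exists [seq m i | i <- enum 'I_k] => n [S' [irr n0 low]].
have [i equ] := S_all S' irr.
have n0' : @gm_homog R V (S i) n <> [set 0] by move=> /(equivalent_homog (equivalent_sym equ)).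
have low' (j : int) : j < 0 -> @gm_homog R V (S i) (n + j%:~R) = [set 0].
  by move=> /low /(equivalent_homog equ).
have [mi0 mi_low] := mP i.
have [a na] := irreducible_weights (S_irr i) mi0 mi_low n0'.
have [b mb] := irreducible_weights (S_irr i) n0' low' mi0.
suff -> : n = m i by apply: map_f; rewrite mem_enum.
rewrite na; move: mb; rewrite na -addrA -natrD => /eqP.
rewrite -{1}[m i]addr0 (inj_eq (addrI _)) eq_sym pnatr_eq0 addn_eq0 => /andP[/eqP -> _].
by rewrite addr0.
Qed.

Lemma low_part_fin (W : gr_module V) : fin_spanned (@low_part R V W).
Proof.
have [L LP] := low_weights_finite.
apply: fin_spanned_sub (@fin_spanned_bigcup _ _ _ L (@gm_homog R V W) _); last first.
  by move=> n _; apply: fin_dim_spanned; apply: (grm_restricted W).2.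
move=> x x_low; have [r [_ _ ->]] := gmpr_seq x.
apply: span_sum => n _; have [n_low|n_low] := EM (low_weights V n).
  by apply: sub_span; exists n; [apply: LP|apply: gmpr_in].
by rewrite x_low //; apply: span0.
Qed.

(** A weight of [F(W)] has the form [n + k] because [W] is cyclic, and [|k| <= N] because both
    weights lie in [L]. The words of [cyclic_bound] therefore span [F(W)], and their number depends
    on neither [n] nor [W]. *)
Lemma low_dim_bounded : exists B : nat, forall n, low_weights V n ->
  forall (W : gr_module V) (w : W), gm_homog n w -> generates w -> (low_dim W <= B)%N.
Proof.
have [B BP] := cyclic_bound V_C1 V_zhu; exists (size B) => n n_low W w wn gen.
rewrite -(size_map (fun s => wact s w) B); apply: set_dim_le => x x_low.
have [r [_ _ ->]] := gmpr_seq x; apply: span_sum => m _.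
have [m_low|m_low] := EM (low_weights V m); last by rewrite x_low //; apply: span0.
have [->|m_neq0] := eqVneq (gmpr m x) 0; first exact: span0.
have [k mE] := cyclic_weight wn (gen x) m_neq0.
have gapN := low_weights_gap VN (W := W) n_low.
apply: (BP W w n k) => //.
  by rewrite mE in m_low; apply: (low_weights_near_int VN n_low m_low).
by rewrite -mE; apply: gmpr_in.
Qed.

Lemma gr_module_finite_abelian : finite_abelian_category V.
Proof.
split.
- exact: gr_module_abelian.
- exact: gr_finite_length low_part_fin.
- exact: gr_hom_fin low_part_fin.
- by have [k [S [_ S_all]]] := irreducible_list; exists k, S.
- move=> W irr; have [n n_low [w wn w_neq0]] := irreducible_low_weight irr.
  have [B BP] := low_dim_bounded.
  have [P [x [xn P_proj univ]]] := projective_generator low_part_fin (BP n n_low).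
  have [g gx] := univ W w wn.
  apply: (minimal_projective_cover low_part_fin P_proj (p0 := g)).
  by apply: (generates_surj (w := x)); rewrite gx; apply: irreducible_generates.
Qed.
End Finiteness.

Theorem theorem3p24 (R : realType) (V : voa R)
  (V_C1 : C1_cofinite V)
  (V_N : exists N : nat,
    [/\ (0 < N)%N,
        forall W1 W2 : gen_module V,
          ordinary_module W1 -> irreducible_module W1 ->
          ordinary_module W2 -> irreducible_module W2 ->
          forall n1 n2 : R[i], lowest_weight W1 n1 -> lowest_weight W2 n2 ->
          `|complex.Re n1 - complex.Re n2| <= N%:R
      & fin_dim [set: zhu_algebra V N]]) :
  finite_abelian_category V.
Proof.
by have [N [_ VN V_zhu]] := V_N; apply: gr_module_finite_abelian VN V_C1 V_zhu.
Qed.
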